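(* $\Xi_+\subseteq\Xi_{nr}$, i.e. $E(\xi)\cap X=\emptyset$ for all $\xi\in\Xi_+$.
   Context: Setting. $G$ is a connected semisimple Lie group with Lie algebra $\mathfrak g$, contained in its universal complexification $G_{\mathbb C}$, which is simply connected. $\tau$ is a non-trivial involution of $G$ (also denoting its derivative and its holomorphic extension to $G_{\mathbb C}$), $H=G^\tau$, $H_{\mathbb C}=G_{\mathbb C}^\tau$, $X=G/H\subset X_{\mathbb C}=G_{\mathbb C}/H_{\mathbb C}$ with base point $x_0$, $\mathfrak g=\mathfrak h+\mathfrak q$ the $\pm1$-eigenspaces of $\tau$. $(\mathfrak g,\mathfrak h)$ is irreducible (the only $\tau$-invariant ideals are $0,\mathfrak g$). $\theta$ is a Cartan involution commuting with $\tau$, $K=G^\theta$, $\mathfrak g=\mathfrak k+\mathfrak s$. $G$ is of Hermitian type and $\tau$ is anti-holomorphic on $G/K$, equivalently $\mathfrak z(\mathfrak k)\cap\mathfrak q\ne0$. Then $\mathfrak z(\mathfrak k)\cap\mathfrak q=i\mathbb R Z_0$ with $\mathrm{Spec}\,\mathrm{ad}(Z_0)=\{-1,0,1\}$ and zero eigenspace $\mathfrak k_{\mathbb C}$. $\mathfrak t\subset\mathfrak q$ is maximal abelian containing $iZ_0$ (so $\mathfrak t\subset\mathfrak k$), $\mathfrak a=i\mathfrak t$, $A=\exp\mathfrak a$. $\Delta$ is the set of roots of $\mathfrak t_{\mathbb C}$ in $\mathfrak g_{\mathbb C}$, $\Delta_n=\{\alpha:\alpha(Z_0)=\pm1\}$,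 $\Delta^+$ a positive system such that $\alpha(Z_0)>0$ implies $\alpha\in\Delta_n^+\subset\Delta^+$; $\check\alpha\in\mathfrak a$ is the coroot of $\alpha$. $\Omega=\sum_{\alpha\in\Delta_n^+}\mathbb R_{>0}\check\alpha$, $A_+=\exp(\Omega)$. $\mathfrak n_{\mathbb C}=\bigoplus_{\alpha\in\Delta^+}\mathfrak g^\alpha_{\mathbb C}$, $N_{\mathbb C}=\exp\mathfrak n_{\mathbb C}$, $M_{\mathbb C}=Z_{H_{\mathbb C}}(\mathfrak t_{\mathbb C})$. $\Xi=G_{\mathbb C}/M_{\mathbb C}N_{\mathbb C}$ with base point $\xi_0$, $\Xi_+=GA_+\cdot\xi_0$. For $\xi=g\cdot\xi_0\in\Xi$ ($g\in G_{\mathbb C}$) the horosphere is $E(\xi)=gN_{\mathbb C}\cdot x_0\subset X_{\mathbb C}$. $\Xi_{nr}$ is the set of $\xi\in\Xi$ with $E(\xi)\cap X=\emptyset$ (horospheres with no real points). *)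

(* Defs.v *)
From HB Require Import structures.
From mathcomp Require Import all_boot all_order all_algebra complex.
From mathcomp Require Import all_classical all_reals all_analysis.

Set Implicit Arguments.
Unset Strict Implicit.
Unset Printing Implicit Defensive.

Import Order.TTheory GRing.Theory Num.Theory.
Import numFieldNormedType.Exports.

Local Open Scope classical_set_scope.
Local Open Scope ring_scope.

(* Lie groups are defined over a field K that is specialized to R (real Lie
   groups) and to R[i] (complex Lie groups).

   Total functions are used for charts and their inverses; smooth_on U f is
   only meaningful when U is open. Over [R] it is C^oo; over [R[i]] the
   differentials are C-linear and it is holomorphy. *)
Definition iter_derive (K : numFieldType) (V W : normedModType K)
    (vs : seq V) (f : V -> W) : V -> W :=
  foldr (fun v g x => 'D_v g x) f vs.

Definition smooth_on (K : numFieldType) (V W : normedModType K)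
    (U : set V) (f : V -> W) : Prop :=
  forall (vs : seq V) (x : V), U x -> differentiable (iter_derive vs f) x.

Record chart (T V : topologicalType) := Chart {
  cdom : set T;
  cmap : T -> V;
  cinv : V -> T;
  chart_open_dom : open cdom;
  chart_open_ran : open (cmap @` cdom);
  chart_mapK : forall x, cdom x -> cinv (cmap x) = x;
  chart_map_continuous : {within cdom, continuous cmap};
  chart_inv_continuous : {within cmap @` cdom, continuous cinv}
}.

Definition cran (T V : topologicalType) (c : chart T V) : set V :=
  cmap c @` cdom c.

#[short(type="pregroupTopType")]
HB.structure Definition PreTopGroup := {T of Group T & Topological T}.

HB.mixin Record isTopGroup T of PreTopGroup T := {
  mulg_cts : continuous (fun p : T * T => (p.1 * p.2)%g);
  invg_cts : continuous (fun x : T => x^-1%g)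
}.

#[short(type="topGroupType")]
HB.structure Definition TopGroup := {T of isTopGroup T & PreTopGroup T}.

(* The distinguished chart at 1 only serves to identify the tangent space at 1,
   i.e. the Lie algebra, with K^n. Second countability is not required: it is
   automatic for connected groups. *)
HB.mixin Record isLieGroup (K : numFieldType) (n : nat) T of TopGroup T := {
  lie_atlas : set (chart T 'rV[K]_n);
  lie_atlas_cover : forall x : T, exists2 c, lie_atlas c & cdom c x;
  lie_atlas_smooth : forall c d, lie_atlas c -> lie_atlas d ->
    smooth_on [set v | cran c v /\ cdom d (cinv c v)]
              (fun v => cmap d (cinv c v));
  chart1 : chart T 'rV[K]_n;
  chart1_atlas : lie_atlas chart1;
  chart1_dom : cdom chart1 1%g;
  lie_hausdorff : hausdorff_space T;
  lie_mul_smooth : forall c d e, lie_atlas c -> lie_atlas d -> lie_atlas e ->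
    smooth_on
      [set p : 'rV[K]_n * 'rV[K]_n |
        [/\ cran c p.1, cran d p.2 & cdom e (cinv c p.1 * cinv d p.2)%g]]
      (fun p : 'rV[K]_n * 'rV[K]_n => cmap e (cinv c p.1 * cinv d p.2)%g);
  lie_inv_smooth : forall c d, lie_atlas c -> lie_atlas d ->
    smooth_on [set v | cran c v /\ cdom d (cinv c v)^-1%g]
              (fun v => cmap d (cinv c v)^-1%g)
}.

#[short(type="lieGroupType")]
HB.structure Definition LieGroup (K : numFieldType) (n : nat) :=
  {T of isLieGroup K n T & TopGroup T}.

Section LieAlgebra.
Variables (K : numFieldType) (n : nat) (G : lieGroupType K n).
Local Notation lie := 'rV[K]_n.
Local Notation phi := (@chart1 K n G).

Definition id_coord : lie := cmap phi 1%g.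

(* The differential at 1 of conjugation by g. *)
Definition Ad (g : G) (Y : lie) : lie :=
  'd (fun v => cmap phi (g * cinv phi v * g^-1)%g) id_coord Y.

(* [X, Y] = ad X (Y), where ad is the differential of Ad at 1. *)
Definition bracket (X Y : lie) : lie :=
  'D_X (fun v => Ad (cinv phi v) Y) id_coord.

Definition ad_mx (X : lie) : 'M[K]_n := lin1_mx (bracket X).

Definition killing (X Y : lie) : K := \tr (ad_mx X *m ad_mx Y).

(* For K = R[i] the parameter runs over the complex line. *)
Definition one_param (X : lie) (gamma : K -> G) : Prop :=
  [/\ forall s t, gamma (s + t) = (gamma s * gamma t)%g,
      continuous gamma
    & is_derive (0 : K) (1 : K) (fun t => cmap phi (gamma t)) X].

(* The one-parameter subgroup with velocity X exists and is unique. *)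
Definition lie_exp (X : lie) : G :=
  xget 1%g [set gamma 1 | gamma in one_param X].

Definition is_ideal (U : {vspace lie}) : Prop :=
  forall X Y, Y \in U -> bracket X Y \in U.

Definition is_abelian (U : {vspace lie}) : Prop :=
  {in U &, forall X Y, bracket X Y = 0}.

Definition semisimple : Prop :=
  forall U, is_ideal U -> is_abelian U -> U = 0%VS.

End LieAlgebra.

Arguments lie_exp {K n G}.
Arguments Ad {K n G}.
Arguments bracket {K n} G.
Arguments ad_mx {K n} G.
Arguments killing {K n} G.

Section LieMorphisms.
Variables (K : numFieldType) (n l : nat).
Variables (G : lieGroupType K n) (L : lieGroupType K l).

(* Over R[i] these are the holomorphic homomorphisms. *)
Definition lie_hom (f : G -> L) : Prop :=
  [/\ {morph f : x y / (x * y)%g},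
      continuous f
    & forall c d, lie_atlas c -> lie_atlas d ->
        smooth_on [set v | cran c v /\ cdom d (f (cinv c v))]
                  (fun v => cmap d (f (cinv c v)))].

Definition dhom (f : G -> L) (X : 'rV[K]_n) : 'rV[K]_l :=
  'd (fun v => cmap chart1 (f (cinv chart1 v))) (id_coord G) X.

End LieMorphisms.

Definition involution (K : numFieldType) (n : nat) (G : lieGroupType K n)
    (f : G -> G) : Prop :=
  lie_hom f /\ involutive f.

Section RealToComplex.
Variables (R : realType) (n l : nat).
Variables (G : lieGroupType R n) (L : lieGroupType R[i] l).

Definition re_mx (u : 'rV[R[i]]_l) : 'rV[R]_l := \row_j complex.Re (u 0 j).
Definition im_mx (u : 'rV[R[i]]_l) : 'rV[R]_l := \row_j complex.Im (u 0 j).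

(* Morphisms of real Lie groups from G to the group L viewed as a real Lie
   group: smoothness and differentials are those of the real and imaginary
   parts of the coordinates. *)
Definition rc_hom (f : G -> L) : Prop :=
  [/\ {morph f : x y / (x * y)%g},
      continuous f
    & forall c d, lie_atlas c -> lie_atlas d ->
        let U := [set v | cran c v /\ cdom d (f (cinv c v))] in
        smooth_on U (fun v => re_mx (cmap d (f (cinv c v)))) /\
        smooth_on U (fun v => im_mx (cmap d (f (cinv c v))))].

Definition rc_dhom (f : G -> L) (X : 'rV[R]_n) : 'rV[R[i]]_l :=
  let u := 'd (fun v => re_mx (cmap chart1 (f (cinv chart1 v))))
              (id_coord G) X in
  let v := 'd (fun v => im_mx (cmap chart1 (f (cinv chart1 v))))
              (id_coord G) X in
  \row_j (Complex (u 0 j) (v 0 j)).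

End RealToComplex.

Definition universal_complexification (R : realType) (n m : nat)
    (G : lieGroupType R n) (GC : lieGroupType R[i] m) (eta : G -> GC) : Prop :=
  rc_hom eta /\
  forall (l : nat) (L : lieGroupType R[i] l) (f : G -> L), rc_hom f ->
    exists! F : GC -> L, lie_hom F /\ f = F \o eta.

(* Lie(GC) = Lie(G) + i Lie(G), a direct sum. *)
Definition lie_complexification (R : realType) (n m : nat)
    (G : lieGroupType R n) (GC : lieGroupType R[i] m) (eta : G -> GC) : Prop :=
  forall Z : 'rV[R[i]]_m, exists! XY : 'rV[R]_n * 'rV[R]_n,
    Z = rc_dhom eta XY.1 + 'i%C *: rc_dhom eta XY.2.

Definition path_connected (R : realType) (T : topologicalType) : Prop :=
  forall x y : T, exists gamma : R -> T,
    [/\ {within `[0, 1], continuous gamma}, gamma 0 = x & gamma 1 = y].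

Definition simply_connected (R : realType) (T : topologicalType) : Prop :=
  path_connected R T /\
  forall gamma : R -> T, {within `[0, 1], continuous gamma} ->
    gamma 0 = gamma 1 ->
    exists F : R * R -> T,
      [/\ {within `[0, 1] `*` `[0, 1], continuous F},
          {in `[0, 1], forall t, F (0, t) = gamma t /\ F (1, t) = gamma 0}
        & {in `[0, 1], forall s, F (s, 0) = gamma 0 /\ F (s, 1) = gamma 0}].

Section RealStructure.
Variables (R : realType) (n : nat) (G : lieGroupType R n).

Definition plus_space (f : G -> G) : set 'rV[R]_n :=
  [set X | dhom f X = X].

Definition minus_space (f : G -> G) : set 'rV[R]_n :=
  [set X | dhom f X = - X].

Definition cartan_involution (theta : G -> G) : Prop :=
  involution theta /\
  forall X : 'rV[R]_n, X != 0 -> killing G X (dhom theta X) < 0.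

Definition irreducible_pair (tau : G -> G) : Prop :=
  forall U : {vspace 'rV[R]_n}, is_ideal G U ->
    (forall X, X \in U -> dhom tau X \in U) -> U = 0%VS \/ U = fullv.

(* G/K carries a G-invariant complex structure for which tau is
   anti-holomorphic. Here K = G^theta, the tangent space of G/K at the base
   point is the (-1)-eigenspace of theta, and an invariant complex structure is
   an Ad(K)-equivariant J on it with J^2 = -1. *)
Definition hermitian_antiholomorphic (theta tau : G -> G) : Prop :=
  exists J : {linear 'rV[R]_n -> 'rV[R]_n},
    forall X, minus_space theta X ->
      [/\ minus_space theta (J X), J (J X) = - X,
          forall k : G, theta k = k -> J (Ad k X) = Ad k (J X)
        & dhom tau (J X) = - J (dhom tau X)].

Definition max_abelian_in (Q : set 'rV[R]_n) (t : {vspace 'rV[R]_n}) : Prop :=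
  [/\ forall X, X \in t -> Q X, is_abelian G t
    & forall t' : {vspace 'rV[R]_n}, (t <= t')%VS ->
        (forall X, X \in t' -> Q X) -> is_abelian G t' -> t' = t].

End RealStructure.

(* eta is the inclusion of G in its complexification GC. *)
Section Horospheres.
Variables (R : realType) (n m : nat).
Variables (G : lieGroupType R n) (GC : lieGroupType R[i] m) (eta : G -> GC).
Local Notation gC := 'rV[R[i]]_m.
Local Notation deta := (rc_dhom eta).

Definition complexify (S : set 'rV[R]_n) : set gC :=
  [set Z | exists X Y, [/\ S X, S Y & Z = deta X + 'i%C *: deta Y]].

(* The element Z0 attached to the centre of k: z(k) \cap q = i R Z0,
   Spec (ad Z0) = {-1, 0, 1} and the zero eigenspace of ad Z0 is k_C. *)
Definition is_Z0 (theta tau : G -> G) (Z0 : gC) : Prop :=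
  [/\ deta @` [set X | [/\ plus_space theta X, minus_space tau X
                         & forall Y, plus_space theta Y -> bracket G X Y = 0]]
        = [set ('i%C * r%:C%C) *: Z0 | r in [set: R]],
      forall z : R[i], eigenvalue (ad_mx GC Z0) z = (z \in [:: -1; 0; 1])
    & [set Z | bracket GC Z0 Z = 0] = complexify (plus_space theta)].

Variable t : {vspace 'rV[R]_n}.

Definition tC : {vspace gC} := <<[seq deta X | X <- vbasis t]>>%VS.

(* a = i t *)
Definition a_space : set gC := [set 'i%C *: deta X | X in [set X | X \in t]].

Definition functional := 'Hom(subvs_of tC, R[i]^o).

Definition pairing (alpha : functional) (Z : gC) : R[i] :=
  alpha (vsproj tC Z).

Definition root_space (alpha : functional) : set gC :=
  [set Z | forall T : subvs_of tC, bracket GC (vsval T) Z = alpha T *: Z].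

Definition Delta : set functional :=
  [set alpha | alpha != 0 /\ exists2 Z, root_space alpha Z & Z != 0].

Definition positive_system (P : set functional) : Prop :=
  [/\ P `<=` Delta,
      forall alpha, Delta alpha -> P alpha <-> ~ P (- alpha)
    & forall alpha beta, P alpha -> P beta -> Delta (alpha + beta) ->
        P (alpha + beta)].

(* The coroot of alpha: proportional, under the identification of t_C with its
   dual given by the Killing form, to alpha, and normalized by alpha(v) = 2. *)
Definition is_coroot (alpha : functional) (v : gC) : Prop :=
  [/\ a_space v, pairing alpha v = 2
    & exists c : R[i], forall T : subvs_of tC,
        killing GC v (vsval T) = c * alpha T].

Variables (Z0 : gC) (Delta_plus : set functional) (coroot : functional -> gC).

Definition Delta_n : set functional :=
  [set alpha | Delta alpha /\ (pairing alpha Z0 = 1 \/ pairing alpha Z0 = -1)].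

Definition Delta_n_plus : set functional := Delta_n `&` Delta_plus.

Definition Omega : set gC :=
  [set Z | exists2 c : functional -> R,
     forall alpha, Delta_n_plus alpha -> 0 < c alpha
   & Z = \sum_(alpha \in Delta_n_plus) (c alpha)%:C%C *: coroot alpha].

Definition A_plus : set GC := lie_exp @` Omega.

Definition nC : set gC :=
  [set Z | exists2 f : functional -> gC,
     forall alpha, Delta_plus alpha -> root_space alpha (f alpha)
   & Z = \sum_(alpha \in Delta_plus) f alpha].

Definition NC : set GC := lie_exp @` nC.

Variable tauC : GC -> GC.

Definition HC : set GC := [set x | tauC x = x].

Definition MC : set GC :=
  [set h | HC h /\ forall T, T \in tC -> Ad h T = T].

(* Points of a homogeneous space GC/S are left cosets, i.e. subsets of GC, and
   act g is the action of g on them. *)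
Definition act (g : GC) (S : set GC) : set GC := [set (g * x)%g | x in S].

Definition x0 : set GC := HC.

(* X = G/H is embedded in X_C = GC/HC by gH |-> eta(g) HC, i.e. as the G-orbit
   of x0; here H = G^tau is the stabilizer of x0 in G. *)
Definition X_real : set (set GC) := [set act (eta g) x0 | g in [set: G]].

Definition xi0 : set GC := [set (x * y)%g | x in MC & y in NC].

Definition Xi : set (set GC) := [set act g xi0 | g in [set: GC]].

(* E(g . xi0) = g NC . x0. As the result does not depend on the representative
   g of xi, all of them can be used. *)
Definition horosphere (xi : set GC) : set (set GC) :=
  [set y | exists g u, [/\ xi = act g xi0, NC u & y = act (g * u)%g x0]].

Definition Xi_plus : set (set GC) :=
  [set xi | exists g a, A_plus a /\ xi = act (eta g * a)%g xi0].

Definition Xi_nr : set (set GC) :=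
  [set xi | Xi xi /\ horosphere xi `&` X_real = set0].

End Horospheres.

(* Main.v *)
(* [L = ad Z0] grades the complexified Lie algebra as p_- + k_C + p_+. Let c_-(T)
   and c_+(T) be the determinants of the compressions of T to p_- and p_+.

   If the horosphere of g a . xi0 meets X, there is w in G with w = b h, where h
   is in H_C and b = a m nu, with m in M_C and nu a product of elements of N_C and
   their inverses. Then z = w tau(w)^-1 belongs to G and equals b tau(b)^-1. As tau
   exchanges p_- and p_+, and Ad(b) is block triangular for the grading,
   |c_-(Ad z)| = |c_-(Ad b) c_+(Ad b^-1)| = exp (- kappa(Z0, Z)) for a = exp Z, kappa
   being the Killing form; this is < 1 because kappa(Z0, .) is positive on the
   coroots of the positive non-compact roots.

   But |c_-(Ad z)| >= 1 for all z in G. Write Ad z = M U, with M positive definite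
   and U unitary, for the inner product - kappa(X, theta Y). As G is connected, U
   commutes with L, so |c_-(U)| = 1. As theta M theta = M^-1 and theta = -1 on p_-,
   the compression of M to p_- is >= 1. *)

From HB Require Import structures.
Require Import Defs.
From mathcomp Require Import all_boot all_order all_algebra complex.
From mathcomp Require Import all_classical all_reals all_analysis.
From mathcomp Require Import sesquilinear spectral ring lra.

Set Implicit Arguments.
Unset Strict Implicit.
Unset Printing Implicit Defensive.

Import Order.TTheory GRing.Theory Num.Theory.
Import numFieldNormedType.Exports.

Local Open Scope classical_set_scope.
Local Open Scope ring_scope.

(** No matrix exponential occurs. Along a one-parameter group [gamma] with velocity Y, Ad (gamma 1)
    is the k-th power of Ad (gamma (1/k)), hence the limit of (1 + ad Y / k)^k, and the determinants
    of triangular blocks of these powers are bounded by exp of a trace. Inequalities suffice, since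
    an upper bound for b is confronted with the lower bound 1. [lie_exp] is 1 when its argument has
    no one-parameter group. On [nC] this is harmless, because 1 satisfies the same bound. On [Omega]
    the strict inequality would be lost, so one-parameter groups are constructed, for Z with [Z, Z]
    = 0, which in t_C follows from commutativity. Strictness also requires that a positive
    non-compact root exists and that the roots are finitely many, the sums in [Omega] being finitely
    supported ones. In the lower bound, connectedness of G enters through a continuous function with
    discrete values, so neither paths nor logarithms are needed. Vectors are rows: linear maps act
    from the right, and the matrix of Ad reverses products. *)

Section Differentials.
Variable K : numFieldType.

(** * Differentials of local identities and of matrix products *)

Lemma near_sub0 (V : normedModType K) (x : V) (P : set V) :
  nbhs (0 : V) P -> \forall y \near x, P (y - x).
Proof.
have : (fun y : V => y - x) @ x --> (0 : V).
  by rewrite -(subrr x); apply: cvgB; [exact: cvg_id|exact: cvg_cst].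
by move=> /(_ P) H /H.
Qed.

Lemma near_add0 (V : normedModType K) (x : V) (P : set V) :
  nbhs x P -> \forall h \near (0 : V), P (h + x).
Proof.
have : (fun h : V => h + x) @ (0 : V) --> x.
  by rewrite -[X in _ --> X]add0r; apply: cvgD; [exact: cvg_id|exact: cvg_cst].
by move=> /(_ P) H /H.
Qed.

Lemma differentiable_id (V : normedModType K) (x : V) :
  differentiable (fun y : V => y) x.
Proof. exact: (@ex_diff _ _ _ _ _ _ _ (is_diff_id x)). Qed.

(** With [eps_is_diff] this trades differentials for inequalities at explicit points, the form in
    which the later error estimates are made. *)
Lemma diff_eps (V W : normedModType K) (f : V -> W) (x : V) (e : K) :
  differentiable f x -> 0 < e ->
  \forall y \near x, `|f y - f x - 'd f x (y - x)| <= e * `|y - x|.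
Proof.
move=> /diff_locallyP[_ dE] e0.
have /(_ e e0) H := (eqaddoP _ _ _ _).1 dE.
have := @near_sub0 V x (fun h => `|(f \o shift x - (cst (f x) + 'd f x)) h| <= e * `|h|) H.
by apply: filterS => y; rewrite !fctE /= subrK opprD addrA.
Qed.

Lemma eps_is_diff (V W : normedModType K) (f : V -> W) (df : {linear V -> W})
    (x : V) :
  continuous df ->
  (forall e : K, 0 < e ->
     \forall y \near x, `|f y - f x - df (y - x)| <= e * `|y - x|) ->
  is_diff x f df.
Proof.
move=> cdf H.
have E : f \o shift x = cst (f x) + df +o_ (0 : V) id.
  apply/eqaddoP => e e0.
  have := near_add0 (H e e0); apply: filterS => h.
  by rewrite !fctE /= addrK opprD addrA.
have D := diff_unique cdf E.
by apply: DiffDef => //; apply/diff_locallyP; rewrite D.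
Unshelve. all: by end_near. Qed.

Lemma is_diff_near (V W : normedModType K) (f g : V -> W) (df : V -> W)
    (x : V) :
  is_diff x f df -> (\forall y \near x, f y = g y) -> is_diff x g df.
Proof.
move=> [df_ex <-] fg; apply: eps_is_diff; first exact: diff_continuous.
move=> e e0; have H := diff_eps df_ex e0; near=> y.
have <- : f y = g y by near: y.
by rewrite -(nbhs_singleton fg); near: y.
Unshelve. all: by end_near. Qed.

Lemma differentiable_near (V W : normedModType K) (f g : V -> W) (x : V) :
  differentiable f x -> (\forall y \near x, f y = g y) -> differentiable g x.
Proof. by move=> /differentiableP/is_diff_near H /H[]. Qed.

Lemma diff_near (V W : normedModType K) (f g : V -> W) (x : V) :
  differentiable f x -> (\forall y \near x, f y = g y) ->
  'd g x = 'd f x :> (V -> W).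
Proof. by move=> /differentiableP/is_diff_near H /H[]. Qed.

(** The device behind the Lie algebra identities below: a group identity is written in charts near 1
    and both sides are differentiated. *)
Lemma is_diff_near_eq (V W : normedModType K) (f g df dg : V -> W) (x : V) :
  is_diff x f df -> is_diff x g dg -> (\forall y \near x, f y = g y) ->
  df =1 dg.
Proof. by move=> Hf [_ <-] /(is_diff_near Hf)[_ ->]. Qed.

Lemma diff_entry (V : normedModType K) m n (M : V -> 'M[K]_(m, n)) x v i j :
  differentiable M x ->
  'd M x v i j = 'd (fun y => M y i j) x v.
Proof.
move=> dM.
have @co : {linear 'M[K]_(m, n) -> K}.
  by exists (fun N : 'M[K]_(_, _) => N i j); do 2![eexists]; do ?[constructor];
     rewrite ?mxE// => ? *; rewrite ?mxE//; move=> ?; rewrite !mxE.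
have -> : (fun y => M y i j) = co \o M by [].
have cC : continuous co by exact/coord_continuous.
by rewrite (diff_comp dM (linear_differentiable _ cC)) diff_lin.
Qed.

Lemma differentiable_mx (V : normedModType K) m n (M : V -> 'M[K]_(m, n)) x :
  (forall i j, differentiable (fun y => M y i j) x) -> differentiable M x.
Proof.
move=> dM.
have -> : M = \sum_(i < m) \sum_(j < n) (fun y => M y i j *: delta_mx i j).
  apply/funext => y; rewrite [LHS]matrix_sum_delta fct_sumE.
  by apply: eq_bigr => i _; rewrite fct_sumE.
apply: differentiable_sum => i; apply: differentiable_sum => j.
exact: differentiableZl.
Qed.

Lemma is_diff_mulmx (V : normedModType K) m n p (A dA : V -> 'M[K]_(m, n))
    (B dB : V -> 'M[K]_(n, p)) x :
  is_diff x A dA -> is_diff x B dB ->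
  is_diff x (fun y => A y *m B y) (fun h => A x *m dB h + dA h *m B x).
Proof.
move=> [dfA dAE] [dfB dBE].
have dA_ i j : differentiable (fun y => A y i j) x.
  apply: (@differentiable_comp _ _ _ _ A (fun N : 'M[K]_(m, n) => N i j)) => //.
  exact: differentiable_coord.
have dB_ i j : differentiable (fun y => B y i j) x.
  apply: (@differentiable_comp _ _ _ _ B (fun N : 'M[K]_(n, p) => N i j)) => //.
  exact: differentiable_coord.
have E i j : (fun y => (A y *m B y) i j) =
    \sum_(k < n) (fun y => A y i k) * (fun y => B y k j).
  by apply/funext => y; rewrite mxE fct_sumE.
have D : differentiable (fun y => A y *m B y) x.
  apply: differentiable_mx => i j; rewrite E; apply: differentiable_sum => k.
  exact: differentiableM.
apply: DiffDef => //; apply/funext => h; apply/matrixP => i j.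
rewrite diff_entry // -deriveE; last first.
  rewrite E; apply: differentiable_sum => k; exact: differentiableM.
rewrite E derive_sum => [|k]; last first.
  by apply: diff_derivable; apply: differentiableM.
rewrite mxE !mxE -big_split /=; apply: eq_bigr => k _.
rewrite deriveM; try exact: diff_derivable.
rewrite !deriveE // -!diff_entry // dAE dBE.
by congr (_ + _); rewrite mulrC.
Qed.

Lemma is_diff_mulmxl (V : normedModType K) m n p (A : 'M[K]_(m, n))
    (B dB : V -> 'M[K]_(n, p)) x :
  is_diff x B dB -> is_diff x (fun y => A *m B y) (fun h => A *m dB h).
Proof.
move=> HB; have [D E] := is_diff_mulmx (is_diff_cst A x) HB.
by apply: DiffDef => //; rewrite E; apply/funext => h; rewrite mul0mx addr0.
Qed.

Lemma is_diff_mulmxr (V : normedModType K) m n p (A dA : V -> 'M[K]_(m, n))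
    (B : 'M[K]_(n, p)) x :
  is_diff x A dA -> is_diff x (fun y => A y *m B) (fun h => dA h *m B).
Proof.
move=> HA; have [D E] := is_diff_mulmx HA (is_diff_cst B x).
by apply: DiffDef => //; rewrite E; apply/funext => h; rewrite mulmx0 add0r.
Qed.

(** Each entry of [f u] is [u] times a fixed column, so continuity of [f] comes from that of matrix
    multiplication. *)
Lemma is_diff_rV_linear (V : normedModType K) m n p
    (f : {linear 'rV[K]_m -> 'M[K]_(n, p)}) (A dA : V -> 'rV[K]_m) x :
  is_diff x A dA -> is_diff x (fun y => f (A y)) (fun h => f (dA h)).
Proof.
move=> HA; pose C i j : 'cV[K]_m := \col_k f (delta_mx 0 k) i j.
have fE u i j : f u i j = (u *m C i j) 0 0.
  rewrite {1}(row_sum_delta u) linear_sum summxE mxE; apply: eq_bigr => k _.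
  by rewrite linearZ !mxE.
have D i j : is_diff x (fun y => A y *m C i j) (fun h => dA h *m C i j).
  exact: is_diff_mulmxr.
have D2 i j : differentiable (fun y => f (A y) i j) x.
  have -> : (fun y => f (A y) i j) = (fun N : 'M[K]_1 => N 0 0) \o (fun y => A y *m C i j).
    by apply/funext => y; rewrite fE.
  have [Dij _] := D i j.
  exact: (differentiable_comp Dij (differentiable_coord _ 0 0)).
have D3 : differentiable (fun y => f (A y)) x by exact: differentiable_mx.
apply: DiffDef => //; apply/funext => h; apply/matrixP => i j.
rewrite diff_entry// fE; have [Dij Eij] := D i j.
have -> : dA h *m C i j = 'd (fun y => A y *m C i j) x h by rewrite Eij.
by rewrite diff_entry//; congr ('d _ x h); apply/funext => y; rewrite fE.
Qed.

End Differentials.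

(** * Real-valued norms on complex spaces, and curves with a real parameter *)

Section RealNorm.
Variable R : realType.
Local Notation C := (R[i] : numFieldType).

(* [`|v|] is an element of [R[i]]; [rn v] is the same number in [R]. *)
Definition rn (V : normedModType C) (v : V) : R := complex.Re `|v|.

Lemma rnE (V : normedModType C) (v : V) : `|v| = (rn v)%:C%C.
Proof. by rewrite RRe_real//; apply: ger0_real. Qed.

Lemma rn_ge0 (V : normedModType C) (v : V) : 0 <= rn v.
Proof. by rewrite -lecR -rnE; exact: normr_ge0. Qed.

Lemma rn0 (V : normedModType C) : rn (0 : V) = 0.
Proof. by rewrite /rn normr0. Qed.

Lemma rn_eq0 (V : normedModType C) (v : V) : rn v <= 0 -> v = 0.
Proof.
move=> h; apply/eqP; rewrite -normr_eq0 rnE; apply/eqP; congr (_%:C%C).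
by apply/le_anti; rewrite h rn_ge0.
Qed.

Lemma rnN (V : normedModType C) (v : V) : rn (- v) = rn v.
Proof. by rewrite /rn normrN. Qed.

Lemma rnB (V : normedModType C) (v w : V) : rn (v - w) = rn (w - v).
Proof. by rewrite -opprB rnN. Qed.

Lemma rnD (V : normedModType C) (v w : V) : rn (v + w) <= rn v + rn w.
Proof. by rewrite -lecR rmorphD /= -!rnE; exact: ler_normD. Qed.

Lemma rn_triB (V : normedModType C) (u v w : V) :
  rn (u - w) <= rn (u - v) + rn (v - w).
Proof. by have := rnD (u - v) (v - w); rewrite addrA subrK. Qed.

Lemma rn_triS (V : normedModType C) (u v : V) : rn u <= rn (u - v) + rn v.
Proof. by have := rnD (u - v) v; rewrite subrK. Qed.

Lemma rn_sum (V : normedModType C) I (r : seq I) (F : I -> V) :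
  rn (\sum_(i <- r) F i) <= \sum_(i <- r) rn (F i).
Proof.
elim/big_ind2 : _ => [|a b c d H1 H2|//]; first by rewrite rn0.
by apply: le_trans (rnD _ _) (lerD H1 H2).
Qed.

Lemma rnZ (V : normedModType C) (z : C) (v : V) : rn (z *: v) = rn z * rn v.
Proof. by apply: (@complexI R); rewrite rmorphM /= -!rnE normrZ. Qed.

Lemma rnM (z w : C) : rn (z * w) = rn z * rn w.
Proof. by apply: (@complexI R); rewrite rmorphM /= -!rnE normrM. Qed.

Lemma rnR (t : R) : rn (t%:C%C : C) = `|t|.
Proof. by rewrite /rn normc_def /= expr0n addr0 sqrtr_sqr. Qed.

Lemma rn_natr k : rn (k%:R : C) = k%:R.
Proof. by rewrite -(rmorph_nat (@real_complex R)) rnR ger0_norm. Qed.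

Lemma rnV (z : C) : rn z^-1 = (rn z)^-1.
Proof. by apply: (@complexI R); rewrite fmorphV /= -!rnE normfV. Qed.

Lemma rn_Re (z : C) : `|complex.Re z| <= rn z.
Proof. by rewrite -lecR -rnE normc_ge_Re. Qed.

Lemma rn_i : rn ('i%C : C) = 1.
Proof. by rewrite /rn normc_def /= expr0n expr1n add0r sqrtr1. Qed.

Lemma rn_Im (z : C) : `|complex.Im z| <= rn z.
Proof. by have := rn_Re (z * 'i%C); rewrite ReiNIm normrN rnM rn_i mulr1. Qed.

Lemma rn_ReIm (z : C) : rn z <= `|complex.Re z| + `|complex.Im z|.
Proof.
rewrite {1}(complexE z); apply: le_trans (rnD _ _) _.
by rewrite rnM !rnR rn_i mul1r.
Qed.

(** A positive element of [R[i]] is real, so radii can be taken in [R]. *)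
Lemma rn_nbhsP (V : normedModType C) (x : V) (P : V -> Prop) :
  (\forall y \near x, P y) <->
  exists2 d : R, 0 < d & forall y, rn (y - x) < d -> P y.
Proof.
split=> [/nbhs_normP[e /= e0 H]|[d d0 H]].
  have eE : e = (complex.Re e)%:C%C by rewrite RRe_real ?gtr0_real.
  exists (complex.Re e); first by rewrite -ltcR -eE.
  by move=> y yx; apply: H; rewrite /= distrC rnE eE ltcR.
apply/nbhs_normP; exists d%:C%C; first by rewrite /= ltcR.
by move=> y /=; rewrite distrC rnE ltcR; exact: H.
Qed.

Lemma real_nbhsP (x : R) (P : R -> Prop) :
  (\forall y \near x, P y) <->
  exists2 d : R, 0 < d & forall y, `|y - x| < d -> P y.
Proof.
split=> [/nbhs_normP[e /= e0 H]|[d d0 H]].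
  by exists e => // y yx; apply: H; rewrite /= distrC.
by apply/nbhs_normP; exists d => // y /=; rewrite distrC; exact: H.
Qed.

Lemma rn_diff (V W : normedModType C) (f df : V -> W) (x : V) (e : R) :
  is_diff x f df -> 0 < e ->
  exists2 d : R, 0 < d &
    forall y, rn (y - x) < d -> rn (f y - f x - df (y - x)) <= e * rn (y - x).
Proof.
move=> [D <-] e0.
have e0' : 0 < e%:C%C :> C by rewrite ltcR.
have /rn_nbhsP[d d0 H] := diff_eps D e0'.
by exists d => // y /H; rewrite !rnE -rmorphM lecR.
Qed.

Lemma rn_diff_bound (V W : normedModType C) (f df : V -> W) (x : V) :
  is_diff x f df -> exists2 k : R, 0 < k & forall v, rn (df v) <= k * rn v.
Proof.
move=> [D <-]; have [k k0 H] := linear_lipschitz (diff_continuous D).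
have kE : k = (complex.Re k)%:C%C by rewrite RRe_real ?gtr0_real.
exists (complex.Re k); first by rewrite -ltcR -kE.
by move=> v; have := H v; rewrite !rnE kE -rmorphM lecR.
Qed.

Lemma rn_entry m n (M : 'M[C]_(m, n)) i j : rn (M i j) <= rn M.
Proof.
rewrite -lecR -!rnE [leRHS]/Num.norm /= mx_normE -[leLHS]nngE num_le.
exact: (le_bigmax _ (fun ij : 'I_m * 'I_n => `|M ij.1 ij.2|%:nng) (i, j)).
Qed.

Lemma rn_mxle m n (M : 'M[C]_(m, n)) (c : R) :
  0 <= c -> (forall i j, rn (M i j) <= c) -> rn M <= c.
Proof.
move=> c0 H; have [E|] := eqVneq (mx_norm M) 0.
  by rewrite /rn (E : `|M| = 0).
move=> /mx_norm_neq0[[i j] /= E].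
by have := H i j; rewrite /rn -[`|M i j|]E.
Qed.

Lemma rn_mulmx m n p (A : 'M[C]_(m, n)) (B : 'M[C]_(n, p)) :
  rn (A *m B) <= n%:R * (rn A * rn B).
Proof.
apply: rn_mxle => [|i j]; first by rewrite !mulr_ge0 ?rn_ge0.
rewrite mxE; apply: le_trans (@rn_sum C _ _ _) _.
have -> : n%:R * (rn A * rn B) = \sum_(k < n) (rn A * rn B).
  by rewrite sumr_const card_ord mulr_natl.
by apply: ler_sum => k _; rewrite rnM ler_pM ?rn_ge0 ?rn_entry.
Qed.

(** A real-parameter derivative inside a space normed over [R[i]]: it lets curves in the real group
    be compared with maps that are differentiable over the complex field. *)
Definition rderiv (V : normedModType C) (f : R -> V) (t0 : R) (l : V) :=
  forall e : R, 0 < e -> exists2 d : R, 0 < d & forall t, `|t - t0| < d ->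
    rn (f t - f t0 - (t - t0)%:C%C *: l) <= e * `|t - t0|.

Lemma rderiv_comp (V W : normedModType C) (f : R -> V) (t0 : R) (l : V)
    (h dh : V -> W) :
  rderiv f t0 l -> is_diff (f t0) h dh -> rderiv (h \o f) t0 (dh l).
Proof.
move=> Hf Hh e e0; have [k k0 Hk] := rn_diff_bound Hh.
have [Dh dhE] := Hh.
have Dlin a x y : dh (x - a *: y) = dh x - a *: dh y.
  by rewrite -dhE linearB linearZ.
pose e1 := e / (2 * (rn l + 1)); pose e2 := e / (2 * k).
have l1 : 0 < rn l + 1 by rewrite ltr_wpDl ?rn_ge0.
have e10 : 0 < e1 by rewrite divr_gt0// mulr_gt0.
have e20 : 0 < e2 by rewrite divr_gt0// mulr_gt0.
have [d1 d10 H1] := rn_diff Hh e10.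
have [d2 d20 H2] := Hf e2 e20.
have [d3 d30 H3] := Hf 1 ltr01.
exists (Num.min (Num.min d2 d3) (d1 / (rn l + 1))).
  by rewrite !lt_min d20 d30 divr_gt0.
move=> t; rewrite !lt_min => /andP[/andP[td2 td3] td1].
have B : rn (f t - f t0) <= (rn l + 1) * `|t - t0|.
  apply: le_trans (rn_triS _ ((t - t0)%:C%C *: l)) _.
  by rewrite rnZ rnR mulrDl addrC lerD ?(mulrC `|_|)//; exact: H3.
have B1 : rn (f t - f t0) < d1.
  by apply: le_lt_trans B _; rewrite mulrC -ltr_pdivlMr.
have E : (h \o f) t - (h \o f) t0 - (t - t0)%:C%C *: dh l =
   (h (f t) - h (f t0) - dh (f t - f t0)) + dh (f t - f t0 - (t - t0)%:C%C *: l).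
  by rewrite Dlin addrA subrK.
rewrite E; apply: le_trans (rnD _ _) _.
have P1 := H1 _ B1; have P2 := Hk (f t - f t0 - (t - t0)%:C%C *: l).
have P3 := H2 _ td2.
have P1' : rn (h (f t) - h (f t0) - dh (f t - f t0)) <= e / 2 * `|t - t0|.
  apply: le_trans P1 _; apply: le_trans (ler_wpM2l (ltW e10) B) _.
  rewrite le_eqVlt; apply/orP; left; apply/eqP.
  by rewrite /e1; field; rewrite gt_eqF.
have P2' : rn (dh (f t - f t0 - (t - t0)%:C%C *: l)) <= e / 2 * `|t - t0|.
  apply: le_trans P2 _; apply: le_trans (ler_wpM2l (ltW k0) P3) _.
  rewrite le_eqVlt; apply/orP; left; apply/eqP.
  by rewrite /e2; field; rewrite gt_eqF.
by rewrite (splitr e) mulrDl lerD.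
Qed.

Lemma rderiv_unique (V : normedModType C) (f : R -> V) t0 l l' :
  rderiv f t0 l -> rderiv f t0 l' -> l = l'.
Proof.
move=> H H'; apply/eqP; rewrite -subr_eq0; apply/eqP/rn_eq0.
rewrite leNgt; apply/negP => p.
(* With a quarter each, the two errors at [t0 + m / 2] add up to half of |l - l'| |t - t0|, against
   the triangle inequality. *)
have e0 : 0 < rn (l - l') / 4 by rewrite divr_gt0.
have [d d0 D] := H _ e0; have [d' d'0 D'] := H' _ e0.
pose m := Num.min d d'; have m0 : 0 < m by rewrite lt_min d0.
have Hm : `|t0 + m / 2 - t0| = m / 2 by rewrite addrC addKr gtr0_norm// divr_gt0.
have mled : m <= d by rewrite ge_min lexx.
have mled' : m <= d' by rewrite ge_min lexx orbT.
have md : m / 2 < d by lra.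
have md' : m / 2 < d' by lra.
have := D (t0 + m / 2); have := D' (t0 + m / 2).
rewrite Hm => /(_ md') P' /(_ md) P.
set u := f _ - f t0 in P P'; set z := (_)%:C%C in P P'.
have zE : rn (z : C) = m / 2 by rewrite rnR Hm.
have := rn_triB (z *: l) u (z *: l').
rewrite -scalerBr rnZ zE (rnB (z *: l)) => Q.
have := le_trans Q (lerD P P').
nra.
Qed.

Lemma rderiv_affine (V : normedModType C) (y v : V) t0 :
  rderiv (fun t : R => y + t%:C%C *: v) t0 v.
Proof.
move=> e e0; exists 1 => // t _.
rewrite opprD addrACA subrr add0r -scalerBl -rmorphB subrr rn0.
by rewrite mulr_ge0// ltW.
Qed.

(** Real and imaginary parts are separated because the mean value theorem is a statement on real
    functions. *)
Lemma rderiv_is_derive (f : R -> C) t0 (l : C) : rderiv f t0 l ->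
  is_derive t0 (1 : R) (fun t => complex.Re (f t)) (complex.Re l) /\
  is_derive t0 (1 : R) (fun t => complex.Im (f t)) (complex.Im l).
Proof.
have key (g : R -> R) (a : R) : (forall e : R, 0 < e -> exists2 d : R, 0 < d &
    forall t, `|t - t0| < d -> `|g t - g t0 - (t - t0) * a| <= e * `|t - t0|) ->
    is_derive t0 (1 : R) g a.
  move=> H.
  have cl : continuous ( *:%R a : R -> R) by exact: scaler_continuous.
  have D : is_diff t0 g ( *:%R a : R -> R).
    apply: (@eps_is_diff R R R g ( *:%R a)) => // e e0.
    apply/real_nbhsP; have [d d0 Hd] := H e e0; exists d => // y /Hd.
    by rewrite [_ * a]mulrC.
  have [D1 D2] := D.
  apply: DeriveDef; first exact: diff_derivable.
  by rewrite deriveE// D2 /= [LHS]mulr1.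
move=> H; split; apply: key => e e0; have [d d0 D] := H e e0; exists d => // t td.
  apply: le_trans (D t td); apply: le_trans (rn_Re _).
  by rewrite le_eqVlt; apply/orP; left; apply/eqP; congr `|_|; rewrite !raddfB /=; case: (l) => ? ? /=; simpc.
apply: le_trans (D t td); apply: le_trans (rn_Im _).
by rewrite le_eqVlt; apply/orP; left; apply/eqP; congr `|_|; rewrite !raddfB /=; case: (l) => ? ? /=; simpc.
Qed.

End RealNorm.

(** * The adjoint representation of a Lie group and its derivative *)

Lemma near_preim (T U : topologicalType) (f : T -> U) (x : T) (P : set U) :
  {for x, continuous f} -> nbhs (f x) P -> \forall y \near x, P (f y).
Proof. by move=> cf /cf. Qed.

Section LieBasics.
Variables (K : numFieldType) (n : nat) (G : lieGroupType K n).
Local Notation lie := 'rV[K]_n.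
Local Notation phi := (@chart1 K n G).
Local Notation e := (id_coord G).

Lemma mulg_cont2 (x y : G) (P : set G) : nbhs (x * y)%g P ->
  exists A B, [/\ nbhs x A, nbhs y B & forall a b, A a -> B b -> P (a * b)%g].
Proof.
move=> /(@mulg_cts G (x, y)) [[A B] /= [nA nB] AB].
by exists A, B; split=> // a b Aa Bb; apply: (AB (a, b)).
Qed.

Lemma mulgl_cont (g : G) : continuous (fun x : G => g * x)%g.
Proof.
move=> x P /mulg_cont2[A [B [nA nB AB]]].
by apply: filterS nB => b; apply: AB; exact: nbhs_singleton.
Qed.

Lemma mulgr_cont (g : G) : continuous (fun x : G => x * g)%g.
Proof.
move=> x P /mulg_cont2[A [B [nA nB AB]]].
by apply: filterS nA => b Ab; apply: AB => //; exact: nbhs_singleton.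
Qed.

Lemma cmap_cont (V : topologicalType) (c : chart G V) x :
  cdom c x -> {for x, continuous (cmap c)}.
Proof.
move=> cx; have := @chart_map_continuous _ _ c.
rewrite continuous_open_subspace; last exact: chart_open_dom.
by apply; rewrite inE.
Qed.

Lemma cinv_cont (V : topologicalType) (c : chart G V) v :
  cran c v -> {for v, continuous (cinv c)}.
Proof.
move=> cv; have := @chart_inv_continuous _ _ c.
rewrite continuous_open_subspace; last exact: chart_open_ran.
by apply; rewrite inE.
Qed.

Lemma cdom_nbhs (V : topologicalType) (c : chart G V) x :
  cdom c x -> nbhs x (cdom c).
Proof. by move=> cx; apply: open_nbhs_nbhs; split=> //; exact: chart_open_dom. Qed.

Lemma cran_nbhs (V : topologicalType) (c : chart G V) v :
  cran c v -> nbhs v (cran c).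
Proof. by move=> cx; apply: open_nbhs_nbhs; split=> //; exact: chart_open_ran. Qed.

Lemma cran_map (V : topologicalType) (c : chart G V) x :
  cdom c x -> cran c (cmap c x).
Proof. by move=> cx; exists x. Qed.

Lemma cinvK (V : topologicalType) (c : chart G V) v :
  cran c v -> cmap c (cinv c v) = v.
Proof. by move=> [x cx <-]; rewrite chart_mapK. Qed.

Lemma cinv_dom (V : topologicalType) (c : chart G V) v :
  cran c v -> cdom c (cinv c v).
Proof. by move=> [x cx <-]; rewrite chart_mapK. Qed.

Lemma phi1 : cdom phi 1%g. Proof. exact: chart1_dom. Qed.
Lemma cran_e : cran phi e. Proof. exact: cran_map phi1. Qed.
Lemma cinv_e : cinv phi e = 1%g. Proof. exact: chart_mapK phi1. Qed.

Lemma cinv_phi_cont : {for e, continuous (cinv phi)}.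
Proof. exact: cinv_cont cran_e. Qed.

Lemma near_cran : \forall v \near e, cran phi v.
Proof. exact: cran_nbhs cran_e. Qed.

Definition pmul (v w : lie) : lie := cmap phi (cinv phi v * cinv phi w)%g.
Definition pinv (v : lie) : lie := cmap phi (cinv phi v)^-1%g.
Definition pconj (g : G) (v : lie) : lie := cmap phi (g * cinv phi v * g^-1)%g.

Lemma AdE (g : G) Y : Ad g Y = 'd (pconj g) e Y. Proof. by []. Qed.

Lemma pconj_e g : pconj g e = e.
Proof. by rewrite /pconj cinv_e mulg1 mulgV. Qed.

Lemma pconj_dom g : \forall v \near e, cdom phi (g * cinv phi v * g^-1)%g.
Proof.
apply: (@near_preim _ _ (fun v => g * cinv phi v * g^-1)%g e (cdom phi)).
  apply: (@continuous_comp _ _ _ (fun v => g * cinv phi v)%g (fun x => x * g^-1)%g); last exact: mulgr_cont.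
  by apply: (@continuous_comp _ _ _ (cinv phi) (fun x => g * x)%g); [exact: cinv_phi_cont | exact: mulgl_cont].
by rewrite cinv_e mulg1 mulgV; exact: cdom_nbhs phi1.
Qed.

(** Neither g nor its inverse need lie in the chart at 1. Conjugation is cut after the left
    translation, and the intermediate point g x is read in an atlas chart around g. *)
Lemma diff_pconj g : differentiable (pconj g) e.
Proof.
have [c cA cg] := @lie_atlas_cover K n G g.
have [d dA dg] := @lie_atlas_cover K n G g^-1%g.
pose f1 v := cmap c (g * cinv phi v)%g.
pose f2 w := cmap phi (cinv c w * g^-1)%g.
have dom1 : \forall v \near e, cdom c (g * cinv phi v)%g.
  apply: (@near_preim _ _ (fun v => g * cinv phi v)%g e (cdom c)).
    by apply: (@continuous_comp _ _ _ (cinv phi) (fun x => g * x)%g); [exact: cinv_phi_cont | exact: mulgl_cont].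
  by rewrite cinv_e mulg1; exact: cdom_nbhs cg.
have f1e : f1 e = cmap c g by rewrite /f1 cinv_e mulg1.
have D1 : differentiable f1 e.
  have /(_ [::] (cmap c g, e)) := @lie_mul_smooth K n G c phi c cA (@chart1_atlas K n G) cA.
  rewrite /= chart_mapK// cinv_e mulg1.
  move=> /(_ (And3 (cran_map cg) cran_e cg)) D.
  have := @differentiable_comp _ _ _ _ (fun v => (cmap c g, v)) _ e
    (differentiable_pair (differentiable_cst _ _) (differentiable_id _)) D.
  by congr (differentiable _ _); apply/funext => v; rewrite /= chart_mapK.
have D2 : differentiable f2 (f1 e).
  rewrite f1e.
  have /(_ [::] (cmap c g, cmap d g^-1)%g) := @lie_mul_smooth K n G c d phi cA dA (@chart1_atlas K n G).
  rewrite /= !chart_mapK// mulgV.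
  move=> /(_ (And3 (cran_map cg) (cran_map dg) phi1)) D.
  have := @differentiable_comp _ _ _ _ (fun v => (v, cmap d g^-1%g)) _ (cmap c g)
    (differentiable_pair (differentiable_id _) (differentiable_cst _ _)) D.
  by congr (differentiable _ _); apply/funext => v; rewrite /= chart_mapK.
apply: (differentiable_near (differentiable_comp D1 D2)).
near=> v; rewrite /= /f1 /f2 /pconj chart_mapK //; near: v; exact: dom1.
Unshelve. all: by end_near. Qed.

Lemma is_diff_pconj g : is_diff e (pconj g) (Ad g).
Proof. exact/differentiableP/diff_pconj. Qed.

Lemma pconjM g h : \forall v \near e, pconj g (pconj h v) = pconj (g * h)%g v.
Proof.
have H := pconj_dom h; near=> v; rewrite /pconj chart_mapK; last by near: v.
by rewrite invgM !mulgA.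
Unshelve. all: by end_near. Qed.

Lemma pconj1 : \forall v \near e, v = pconj 1%g v.
Proof.
have H := near_cran; near=> v.
by rewrite /pconj mul1g invg1 mulg1 cinvK//; near: v.
Unshelve. all: by end_near. Qed.

(* [adm] and [adM] are sealed, since comparing two unequal instances of them by
   unfolding does not terminate in practice. *)
Fact adm_sig : {f : G -> 'M[K]_n | forall g, f g = lin1_mx ('d (pconj g) e)}.
Proof. by eexists. Qed.
Definition adm : G -> 'M[K]_n := sval adm_sig.

Lemma Ad_adm g Y : Ad g Y = Y *m adm g.
Proof. by rewrite /adm (svalP adm_sig) mul_rV_lin1. Qed.

Lemma AdM (g h : G) Y : Ad (g * h)%g Y = Ad g (Ad h Y).
Proof.
have D : differentiable (pconj g) (pconj h e) by rewrite pconj_e; exact: diff_pconj.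
rewrite AdE (diff_near _ (pconjM g h)).
  by rewrite (diff_comp (diff_pconj h) D) /= pconj_e.
exact: differentiable_comp (diff_pconj h) D.
Qed.

Lemma Ad1 Y : @Ad K n G 1%g Y = Y.
Proof. by rewrite AdE (diff_near (differentiable_id _) pconj1) diff_val. Qed.

(** Rows are acted on from the right, which turns Ad into an anti-homomorphism of matrices. *)
Lemma admM g h : adm (g * h)%g = adm h *m adm g.
Proof. by apply/row_matrixP => i; rewrite !rowE -(Ad_adm (g * h)%g) AdM (Ad_adm h) (Ad_adm g) mulmxA. Qed.

Lemma adm1 : adm 1%g = 1%:M.
Proof. by apply/row_matrixP => i; rewrite !rowE -(@Ad_adm 1%g) Ad1 mulmx1. Qed.

Lemma admVM g : adm g^-1%g *m adm g = 1%:M.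
Proof. by rewrite -admM mulgV adm1. Qed.

Lemma admMV g : adm g *m adm g^-1%g = 1%:M.
Proof. by rewrite -admM mulVg adm1. Qed.


Local Notation pm := (fun p : lie * lie => pmul p.1 p.2).

Lemma diff_pmul_iter (vs : seq (lie * lie)) (v w : lie) :
  cran phi v -> cran phi w -> cdom phi (cinv phi v * cinv phi w)%g ->
  differentiable (iter_derive vs pm) (v, w).
Proof.
move=> cv cw cvw.
by apply: (@lie_mul_smooth K n G phi phi phi) => //; exact: chart1_atlas.
Qed.

Lemma diff_pinv v : cran phi v -> cdom phi (cinv phi v)^-1%g ->
  differentiable pinv v.
Proof.
move=> cv cV.
by apply: (@lie_inv_smooth K n G phi phi _ _ [::]) => //; exact: chart1_atlas.
Qed.

Lemma pmul_e v : cran phi v -> pmul v e = v.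
Proof. by move=> cv; rewrite /pmul cinv_e mulg1 cinvK. Qed.

Lemma pinv_e : pinv e = e.
Proof. by rewrite /pinv cinv_e invg1. Qed.

Lemma near_mulg (g : G) : cdom phi g ->
  \forall w \near e, cdom phi (g * cinv phi w)%g.
Proof.
move=> cg; apply: (@near_preim _ _ (fun v => g * cinv phi v)%g e (cdom phi)).
  by apply: (@continuous_comp _ _ _ (cinv phi) (fun x => g * x)%g); [exact: cinv_phi_cont | exact: mulgl_cont].
by rewrite cinv_e mulg1; exact: cdom_nbhs cg.
Qed.

Lemma near_invg : \forall v \near e, cdom phi (cinv phi v)^-1%g.
Proof.
apply: (@near_preim _ _ (fun v => (cinv phi v)^-1)%g e (cdom phi)).
  by apply: (@continuous_comp _ _ _ (cinv phi) (fun x => x^-1)%g); [exact: cinv_phi_cont | exact: invg_cts].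
by rewrite cinv_e invg1; exact: cdom_nbhs phi1.
Qed.

(** Conjugation by g is left translation by g followed by right translation by its inverse, so its
    differential is a product of two partial differentials of the multiplication. Here g enters only
    through first derivatives of a smooth map. *)
Lemma Ad_cinvE v Y : cran phi v -> cdom phi (cinv phi v)^-1%g ->
  Ad (cinv phi v) Y = 'D_(0, Y) pm (v, e) *m
     \matrix_(i, j) ('D_((delta_mx 0 i : lie), 0) pm (v, pinv v)) 0 j.
Proof.
move=> cv cV.
have D1 : differentiable pm (v, e).
  apply: (diff_pmul_iter [::]) => //; first exact: cran_e.
  by rewrite cinv_e mulg1; exact: cinv_dom.
have D2 : differentiable pm (v, pinv v).
  apply: (diff_pmul_iter [::]) => //; first exact: cran_map.
  by rewrite chart_mapK// mulgV; exact: phi1.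
have D1' := differentiable_pair (differentiable_cst v e) (differentiable_id e).
have D3 : differentiable (fun w => pmul v w) e.
  exact: (differentiable_comp D1' D1).
have D3' := differentiable_pair D3 (differentiable_cst (pinv v) e).
have D2' : differentiable pm (pmul v e, pinv v) by rewrite pmul_e.
have H : \forall w \near e, pmul (pmul v w) (pinv v) = pconj (cinv phi v) w.
  have H := near_mulg (cinv_dom cv); near=> w.
  by rewrite /pmul /pconj !chart_mapK//; near: w.
have E0 : 'd (fun w => pmul v w) e Y = 'D_(0, Y) pm (v, e).
  rewrite deriveE// (diff_comp D1' D1).
  have E1 : 'd (fun w : lie => (v, w)) e Y = (0, Y).
    rewrite (diff_pair (differentiable_cst v e) (differentiable_id e)).
    by congr (_, _); [rewrite (diff_cst v e) | rewrite diff_val].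
  exact: (congr1 ('d pm (v, e)) E1).
set W := 'D_(0, Y) pm (v, e) in E0 *.
have E2 : 'd (fun w => (pmul v w, pinv v)) e Y = (W, 0).
  rewrite (diff_pair D3 (differentiable_cst (pinv v) e)).
  by congr (_, _); [exact: E0 | rewrite (diff_cst (pinv v) e)].
rewrite AdE (diff_near (differentiable_comp D3' D2') H) (diff_comp D3' D2').
have E3 : 'd pm (pmul v e, pinv v) (W, 0) = 'd pm (v, pinv v) (W, 0).
  by rewrite pmul_e.
apply: (etrans (congr1 ('d pm (pmul v e, pinv v)) E2)); apply: (etrans E3).
rewrite {1}(matrix_sum_delta W) big_ord1.
have -> : (\sum_j W 0 j *: delta_mx 0 j, 0) =
    \sum_j W 0 j *: ((delta_mx 0 j : lie, 0 : lie)).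
  apply: (@big_ind2 lie (lie * lie)%type (fun a b => (a, 0) = b)).
    exact: erefl.
    move=> a1 b1 a2 b2 <- <-.
    exact: (congr1 (pair (a1 + a2)) (esym (addr0 (0 : lie)))).
  by move=> j _; exact: (congr1 (pair _) (esym (scaler0 lie (W 0 j)))).
rewrite linear_sum mulmx_sum_row; apply: eq_bigr => j _.
rewrite linearZ; congr (_ *: _); apply/rowP => k; rewrite !mxE.
by rewrite (deriveE _ D2).
Unshelve. all: by end_near. Qed.

(** Second order smoothness of the multiplication makes Ad differentiable in the group variable: the
    derivatives in [Ad_cinvE] are iterated derivatives along lists of one vector. *)
Lemma diff_Ad_cinv Y : differentiable (fun v => Ad (cinv phi v) Y) e.
Proof.
have E : \forall v \near e, 'D_(0, Y) pm (v, e) *m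
     \matrix_(i, j) ('D_((delta_mx 0 i : lie), 0) pm (v, pinv v)) 0 j = Ad (cinv phi v) Y.
  have H1 := near_cran; have H2 := near_invg; near=> v.
  by rewrite Ad_cinvE//; near: v.
apply: differentiable_near E.
have dome : cdom phi (cinv phi e * cinv phi e)%g.
  by rewrite cinv_e mulg1; exact: phi1.
have D1 : differentiable (fun v => 'D_(0, Y) pm (v, e)) e.
  apply: (@differentiable_comp _ _ _ _ (fun v => (v, e)) ('D_(0, Y) pm) e).
    exact: (differentiable_pair (differentiable_id e) (differentiable_cst e e)).
  by apply: (diff_pmul_iter [:: (0, Y)]) => //; exact: cran_e.
have D2 j : differentiable (fun v => 'D_((delta_mx 0 j : lie), 0) pm (v, pinv v)) e.
  apply: (@differentiable_comp _ _ _ _ (fun v => (v, pinv v)) ('D_((delta_mx 0 j : lie), 0) pm) e).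
    apply: (differentiable_pair (differentiable_id e)).
    apply: diff_pinv; first exact: cran_e.
    by rewrite cinv_e invg1; exact: phi1.
  rewrite pinv_e.
  by apply: (diff_pmul_iter [:: (delta_mx 0 j, 0)]) => //; exact: cran_e.
have D2' : differentiable (fun v => \matrix_(i, j) ('D_((delta_mx 0 i : lie), 0) pm (v, pinv v)) 0 j : 'M[K]_n) e.
  apply: differentiable_mx => i j.
  have -> : (fun v => (\matrix_(i, j) ('D_((delta_mx 0 i : lie), 0) pm (v, pinv v)) 0 j : 'M[K]_n) i j) =
      (fun N : lie => N 0 j) \o (fun v => 'D_((delta_mx 0 i : lie), 0) pm (v, pinv v)).
    by apply/funext => v; rewrite mxE.
  exact: (differentiable_comp (D2 i) (differentiable_coord _ 0 j)).
by have [] := is_diff_mulmx (differentiableP D1) (differentiableP D2').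
Unshelve. all: by end_near. Qed.

Definition Adm (v : lie) : 'M[K]_n := adm (cinv phi v).

Lemma Adm_e : Adm e = 1%:M.
Proof. by rewrite /Adm cinv_e adm1. Qed.

Lemma diff_Adm : differentiable Adm e.
Proof.
apply: differentiable_mx => i j.
have -> : (fun y => Adm y i j) = (fun N : lie => N 0 j) \o (fun v => Ad (cinv phi v) (delta_mx 0 i)).
  by apply/funext => v; rewrite [RHS]/= Ad_adm -rowE [RHS]mxE.
exact: (differentiable_comp (diff_Ad_cinv _) (differentiable_coord _ 0 j)).
Qed.

Lemma bracketE X Y : bracket G X Y = Y *m 'd Adm e X.
Proof.
rewrite /bracket deriveE; last exact: diff_Ad_cinv.
have -> : (fun v => Ad (cinv phi v) Y) = (fun v => Y *m Adm v).
  by apply/funext => v; rewrite Ad_adm.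
by have [_ ->] := is_diff_mulmxl Y (differentiableP diff_Adm).
Qed.

Fact adM_sig : {f : lie -> 'M[K]_n | forall X, f X = ad_mx G X}.
Proof. by eexists. Qed.
Definition adM : lie -> 'M[K]_n := sval adM_sig.

Lemma adME X : ad_mx G X = adM X. Proof. exact: esym (svalP adM_sig X). Qed.

Lemma diff_AdmE X : 'd Adm e X = adM X.
Proof.
rewrite -adME; apply/row_matrixP => i; rewrite !rowE -bracketE.
by apply/rowP => j; rewrite -rowE !mxE.
Qed.

Lemma is_diff_Adm : is_diff e Adm adM.
Proof.
by apply: DiffDef; [exact: diff_Adm | apply/funext => X; rewrite -diff_AdmE].
Qed.

Lemma bracket_ad X Y : bracket G X Y = Y *m adM X.
Proof. by rewrite bracketE diff_AdmE. Qed.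

Lemma adM_linear : linear adM.
Proof. by move=> a X Y; rewrite -!diff_AdmE linearP. Qed.

HB.instance Definition _ :=
  GRing.isLinear.Build K lie 'M[K]_n *:%R adM adM_linear.

(** Ad (g x g^-1) = Ad g Ad x Ad g^-1 is differentiated in x at 1; the outcome says that Ad g is an
    automorphism of the Lie algebra. *)
Lemma adm_ad g X : adM (X *m adm g) = adm g^-1%g *m adM X *m adm g.
Proof.
have H : \forall v \near e, Adm (pconj g v) = adm g^-1%g *m Adm v *m adm g.
  have H := pconj_dom g; near=> v.
  by rewrite /Adm /pconj chart_mapK ?admM ?mulmxA//; near: v.
have HA : is_diff (pconj g e) Adm (adM) by rewrite pconj_e; exact: is_diff_Adm.
have := is_diff_near_eq (is_diff_comp (is_diff_pconj g) HA)
  (is_diff_mulmxr (adm g) (is_diff_mulmxl (adm g^-1%g) is_diff_Adm)) H X.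
by rewrite /= Ad_adm.
Unshelve. all: by end_near. Qed.

(* Differentiate [ad (X Ad g) = Ad g^-1 . ad X . Ad g] in g at 1. *)
Lemma jacobi X Y : adM (X *m adM Y) =
  adM X *m adM Y - adM Y *m adM X.
Proof.
have F := is_diff_rV_linear adM (is_diff_mulmxl X is_diff_Adm).
have E : \forall v \near e, Adm v *m adM (X *m Adm v) = adM X *m Adm v.
  by near=> v; rewrite adm_ad !mulmxA admMV mul1mx.
have := is_diff_near_eq (is_diff_mulmx is_diff_Adm F)
  (is_diff_mulmxl (adM X) is_diff_Adm) E Y.
rewrite Adm_e mul1mx mulmx1 => <-.
by rewrite addrK.
Unshelve. all: by end_near. Qed.

(** At 1 this is differentiability in the chart; the product rule of [adm] carries it to every g. *)
Lemma adm_cont : continuous adm.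
Proof.
move=> g.
have H1 : {for 1%g, continuous adm}.
  have E : \forall x \near (1%g : G), Adm (cmap phi x) = adm x.
    have H := cdom_nbhs phi1; near=> x.
    by rewrite /Adm chart_mapK//; near: x.
  have H : (Adm \o cmap phi) @ (1%g : G) --> adm 1%g.
    rewrite (_ : adm 1%g = Adm e); last by rewrite Adm_e adm1.
    apply: (@continuous_comp _ _ _ (cmap phi) Adm); first exact: cmap_cont phi1.
    exact: differentiable_continuous diff_Adm.
  apply: cvg_trans H; apply: near_eq_cvg; exact: E.
have -> : adm = (fun M => M *m adm g) \o (adm \o (fun x => g^-1 * x)%g).
  by apply/funext => x; rewrite /= -admM mulVKg.
apply: continuous_comp.
  apply: continuous_comp; first exact: mulgl_cont.
  by rewrite mulVg.
apply: differentiable_continuous.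
have [] // := is_diff_mulmxr (adm g) (is_diff_id (adm (g^-1 * g)%g)).
Unshelve. all: by end_near. Qed.

End LieBasics.

(** * Differentials of homomorphisms *)

Section LieHom.
Variables (K : numFieldType) (n l : nat).
Variables (G : lieGroupType K n) (L : lieGroupType K l) (f : G -> L).
Hypothesis fh : lie_hom f.
Local Notation phi := (@chart1 K n G).
Local Notation psi := (@chart1 K l L).

Definition hatf (v : 'rV[K]_n) : 'rV[K]_l := cmap psi (f (cinv phi v)).

Lemma lie_hom1 : f 1%g = 1%g.
Proof.
have [fM _ _] := fh.
by have := fM 1%g 1%g; rewrite mulg1 => /esym/eqP; rewrite -[X in _ == X]mulg1 => /eqP/mulgI.
Qed.

Lemma lie_homV x : f x^-1%g = (f x)^-1%g.
Proof.
have [fM _ _] := fh; apply: (@mulIg _ (f x)).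
by rewrite -fM !mulVg lie_hom1.
Qed.

Lemma hatf_e : hatf (id_coord G) = id_coord L.
Proof. by rewrite /hatf cinv_e lie_hom1. Qed.

Lemma near_hom : \forall v \near id_coord G, cdom psi (f (cinv phi v)).
Proof.
have [_ fc _] := fh.
apply: (@near_preim _ _ (f \o cinv phi) (id_coord G) (cdom psi)).
  apply: continuous_comp; [exact: cinv_phi_cont | exact: fc].
by rewrite /= cinv_e lie_hom1; exact: cdom_nbhs (phi1 L).
Qed.

Lemma diff_hatf : differentiable hatf (id_coord G).
Proof.
have [_ _ fs] := fh.
apply: (fs phi psi _ _ [::]); try exact: chart1_atlas.
split; first exact: cran_e.
by rewrite cinv_e lie_hom1; exact: phi1.
Qed.

Lemma is_diff_hatf : is_diff (id_coord G) hatf (dhom f).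
Proof. exact/differentiableP/diff_hatf. Qed.

Fact dmx_sig : {M : 'M[K]_(n, l) | M = lin1_mx ('d hatf (id_coord G))}.
Proof. by eexists. Qed.
Definition dmx : 'M[K]_(n, l) := sval dmx_sig.

Lemma dhom_dmx X : dhom f X = X *m dmx.
Proof. by rewrite /dmx (svalP dmx_sig) mul_rV_lin1. Qed.

(** The compatibility of f with conjugations is differentiated once in the conjugated element;
    [ad_hom] differentiates the result in g. *)
Lemma adm_hom g : adm g *m dmx = dmx *m adm (f g).
Proof.
have [fM _ _] := fh.
apply/row_matrixP => i; rewrite !rowE !mulmxA.
rewrite -(Ad_adm g) -!dhom_dmx -(Ad_adm (f g)).
have H : \forall v \near id_coord G, hatf (pconj g v) = pconj (f g) (hatf v).
  have H1 := pconj_dom g; have H2 := near_hom; near=> v.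
  rewrite /hatf /pconj chart_mapK; last by near: v.
  by rewrite chart_mapK ?fM ?lie_homV//; near: v.
have D1 : is_diff (pconj g (id_coord G)) hatf (dhom f).
  by rewrite pconj_e; exact: is_diff_hatf.
have D2 : is_diff (hatf (id_coord G)) (pconj (f g)) (Ad (f g)).
  by rewrite hatf_e; exact: is_diff_pconj.
exact: (is_diff_near_eq (is_diff_comp (is_diff_pconj g) D1)
  (is_diff_comp is_diff_hatf D2) H).
Unshelve. all: by end_near. Qed.

Lemma ad_hom X : @adM K n G X *m dmx = dmx *m @adM K l L (X *m dmx).
Proof.
have H : \forall v \near id_coord G, dmx *m Adm L (hatf v) = Adm G v *m dmx.
  have H2 := near_hom; near=> v.
  by rewrite /Adm /hatf chart_mapK ?adm_hom//; near: v.
have DA : is_diff (hatf (id_coord G)) (@Adm K l L) (@adM K l L).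
  by rewrite hatf_e; exact: is_diff_Adm.
have := is_diff_near_eq
  (is_diff_mulmxl dmx (is_diff_comp is_diff_hatf DA))
  (is_diff_mulmxr dmx (is_diff_Adm G)) H X.
by rewrite /= dhom_dmx => <-.
Unshelve. all: by end_near. Qed.

End LieHom.

(** * Strict differentiability of the multiplication at the identity *)

Section StrictDiff.
Variable R : realType.
Local Notation C := (R[i] : numFieldType).

Lemma MVT_01 (g dg : R -> R) :
  (forall t : R, 0 <= t <= 1 -> is_derive t (1 : R) g (dg t)) ->
  exists2 t : R, 0 <= t <= 1 & g 1 - g 0 = dg t.
Proof.
move=> H.
have [] := @MVT_segment R g dg 0 1 ler01.
- by move=> x; rewrite in_itv /= => /andP[x0 x1]; apply: H; rewrite !ltW.
- apply: derivable_within_continuous => x; rewrite in_itv /= => x01.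
  by have [] := H x x01.
by move=> c; rewrite in_itv /= => c01; rewrite subr0 mulr1 => E; exists c.
Qed.

(** The mean value theorem is used on the real and the imaginary part of each entry, at two
    different points of the segment; hence the factor 2. *)
Lemma MVT_complex_entry (V : normedModType C) m n (h : V -> 'M[C]_(m, n))
    (x y : V) (c : R) :
  0 <= c ->
  (forall t : R, 0 <= t <= 1 -> differentiable h (y + t%:C%C *: (x - y)) /\
     rn ('d h (y + t%:C%C *: (x - y)) (x - y)) <= c) ->
  rn (h x - h y) <= 2 * c.
Proof.
move=> c0 H; apply: rn_mxle => [|i j]; first by rewrite mulr_ge0.
pose q (t : R) := y + t%:C%C *: (x - y).
have D t : 0 <= t <= 1 -> rderiv (fun t => h (q t) i j : C) t ('d h (q t) (x - y) i j).
  move=> /H[D _].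
  have Dh : differentiable (fun z => h z i j) (q t).
    exact: (differentiable_comp D (differentiable_coord _ i j)).
  rewrite diff_entry//.
  exact: (rderiv_comp (rderiv_affine y (x - y) t) (differentiableP Dh)).
have B t : 0 <= t <= 1 -> rn ('d h (q t) (x - y) i j : C) <= c.
  by move=> /H[_]; apply: le_trans; exact: rn_entry.
have q1 : q 1 = x by rewrite /q scale1r addrC subrK.
have q0 : q 0 = y by rewrite /q scale0r addr0.
have [t1 T1 E1] := @MVT_01 (fun t => complex.Re (h (q t) i j)) (fun t => complex.Re ('d h (q t) (x - y) i j))
  (fun t T => (rderiv_is_derive (D t T)).1).
have [t2 T2 E2] := @MVT_01 (fun t => complex.Im (h (q t) i j)) (fun t => complex.Im ('d h (q t) (x - y) i j))
  (fun t T => (rderiv_is_derive (D t T)).2).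
rewrite q1 q0 in E1 E2.
apply: le_trans (rn_ReIm _) _.
have -> : complex.Re ((h x - h y) i j) = complex.Re (h x i j) - complex.Re (h y i j).
  by rewrite !mxE raddfB.
have -> : complex.Im ((h x - h y) i j) = complex.Im (h x i j) - complex.Im (h y i j).
  by rewrite !mxE raddfB.
rewrite E1 E2.
have := le_trans (rn_Re _) (B _ T1); have := le_trans (rn_Im _) (B _ T2).
lra.
Qed.

(** For f minus its differential at p, the mean value inequality bounds the error by the variation
    of the differential, which is small near p by continuity of the derivatives along [b]. Both x
    and y may vary: products of many factors require this uniformity. *)
Lemma strict_diff (V : normedModType C) m N (f : V -> 'rV[C]_m) (p : V)
    (b : 'I_N -> V) (co : 'I_N -> V -> C) (e : R) :
  (forall v, v = \sum_k co k v *: b k) -> (forall k v, rn (co k v) <= rn v) ->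
  (\forall q \near p, differentiable f q) ->
  (forall k, {for p, continuous (fun q => 'D_(b k) f q)}) -> 0 < e ->
  exists2 d : R, 0 < d & forall x y, rn (x - p) < d -> rn (y - p) < d ->
    rn (f x - f y - 'd f p (x - y)) <= e * rn (x - y).
Proof.
move=> bE coB Df Db e0.
(* The 2 compensates the factor of the mean value inequality; [N + 1] in place of [N] keeps the
   denominator positive. *)
pose e1 := e / (2 * (N%:R + 1)).
have N1 : 0 < N%:R + 1 :> R by rewrite ltr_wpDl.
have e10 : 0 < e1 by rewrite divr_gt0// mulr_gt0.
have Dp : differentiable f p by exact: nbhs_singleton Df.
have : \forall q \near p, differentiable f q /\
    forall k, rn ('D_(b k) f q - 'D_(b k) f p) < e1.
  near=> q; split; first by near: q.
  near: q; apply: filter_forall => k.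
  apply: (@near_preim _ _ (fun q => 'D_(b k) f q) p (fun w => rn (w - 'D_(b k) f p) < e1)) => //.
  by apply: (proj2 (rn_nbhsP _ (fun w => rn (w - 'D_(b k) f p) < e1))); exists e1.
move=> /rn_nbhsP[d d0 H]; exists d => // x y xd yd.
pose L := 'd f p.
have cL : continuous L by exact: diff_continuous.
pose h q := f q - L q.
have Hh q : rn (q - p) < d -> is_diff q h (fun u => 'd f q u - L u).
  move=> /H[Dq _].
  have HL : is_diff q L L.
    by apply: DiffDef; [exact: linear_differentiable | rewrite diff_lin].
  exact: (is_diffB (differentiableP Dq) HL).
have -> : f x - f y - L (x - y) = h x - h y.
  by rewrite /h linearB !opprB addrACA [RHS]addrACA [- f y - _]addrC.
have -> : e * rn (x - y) = 2 * (e / 2 * rn (x - y)) by field.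
apply: MVT_complex_entry => [|t /andP[t0 t1]].
  by rewrite mulr_ge0 ?rn_ge0 ?divr_ge0// ltW.
set q := y + _.
have qd : rn (q - p) < d.
  have -> : q - p = (1 - t)%:C%C *: (y - p) + t%:C%C *: (x - p).
    rewrite /q rmorphB rmorph1 scalerBl scale1r /= -[RHS]addrA [- (_ *: _) + _]addrC -scalerBr.
    by rewrite opprB addrA subrK addrAC.
  apply: le_lt_trans (rnD _ _) _; rewrite !rnZ !rnR.
  rewrite (ger0_norm t0) ger0_norm ?subr_ge0//.
  have [->|t1'] := eqVneq t 0; first by rewrite subr0 mul1r mul0r addr0.
  have tp : 0 < t by rewrite lt_neqAle eq_sym t1'.
  have : (1 - t) * rn (y - p) <= (1 - t) * d by rewrite ler_wpM2l ?subr_ge0// ltW.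
  have : t * rn (x - p) < t * d by rewrite ltr_pM2l.
  lra.
have [Dq Bq] := H q qd; have [Dhq ->] := Hh q qd; split=> //.
have -> : 'd f q (x - y) - L (x - y) =
    \sum_k co k (x - y) *: ('D_(b k) f q - 'D_(b k) f p).
  have TE (T : {linear V -> 'rV[C]_m}) : T (x - y) = \sum_k co k (x - y) *: T (b k).
    by rewrite {1}(bE (x - y)) linear_sum; apply: eq_bigr => k _; rewrite linearZ.
  rewrite (TE ('d f q)) (TE ('d f p)) -sumrB; apply: eq_bigr => k _.
  by rewrite -scalerBr !deriveE.
apply: le_trans (rn_sum _ _) _.
have -> : e / 2 * rn (x - y) = \sum_(k < N) (rn (x - y) * e1) + e1 * rn (x - y).
  rewrite sumr_const card_ord /e1 -mulr_natl; field; exact: lt0r_neq0.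
apply: (@le_trans _ _ (\sum_(k < N) rn (x - y) * e1)).
  by apply: ler_sum => k _; rewrite rnZ ler_pM ?rn_ge0// ltW.
by rewrite lerDl mulr_ge0 ?rn_ge0// ltW.
Unshelve. all: by end_near. Qed.

End StrictDiff.

Section StrictMul.
Variable R : realType.
Local Notation C := (R[i] : numFieldType).
Variables (m : nat) (G : lieGroupType C m).
Local Notation lie := 'rV[C]_m.
Local Notation phi := (@chart1 C m G).
Local Notation e := (id_coord G).
Local Notation pm := (fun p : lie * lie => pmul G p.1 p.2).

Lemma rn_pair (V W : normedModType C) (v : V) (w : W) :
  rn ((v, w) : V * W) = Num.max (rn v) (rn w).
Proof.
apply: (@complexI R); rewrite -rnE prod_normE /= !rnE.
by rewrite /Order.max ltcR; case: (rn v < rn w).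
Qed.

Lemma near_pmul : \forall p \near ((e, e) : lie * lie),
  [/\ cran phi p.1, cran phi p.2 & cdom phi (cinv phi p.1 * cinv phi p.2)%g].
Proof.
have H1 : \forall p \near ((e, e) : lie * lie), cran phi p.1.
  by apply: (@near_preim _ _ fst (e, e) (cran phi)); [exact: cvg_fst | exact: near_cran].
have H2 : \forall p \near ((e, e) : lie * lie), cran phi p.2.
  by apply: (@near_preim _ _ snd (e, e) (cran phi)); [exact: cvg_snd | exact: near_cran].
have H3 : \forall p \near ((e, e) : lie * lie), cdom phi (cinv phi p.1 * cinv phi p.2)%g.
  apply: (@near_preim _ _ (fun p : lie * lie => cinv phi p.1 * cinv phi p.2)%g (e, e) (cdom phi)).
    apply: (@continuous_comp _ _ _ (fun p : lie * lie => (cinv phi p.1, cinv phi p.2)) (fun p => p.1 * p.2)%g); last exact: mulg_cts.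
    apply: cvg_pair.
      apply: (@continuous_comp _ _ _ fst (cinv phi)); [exact: cvg_fst | exact: cinv_phi_cont].
    apply: (@continuous_comp _ _ _ snd (cinv phi)); [exact: cvg_snd | exact: cinv_phi_cont].
  by rewrite /= cinv_e mulg1; exact: cdom_nbhs (phi1 G).
by near=> p; split; near: p.
Unshelve. all: by end_near. Qed.

(** On each of the two axes through (e, e) the multiplication is the identity. *)
Lemma diff_pmul_e (h k : lie) : 'd pm ((e, e) : lie * lie) (h, k) = h + k.
Proof.
have D : differentiable pm ((e, e) : lie * lie).
  have [H1 H2 H3] := nbhs_singleton near_pmul.
  exact: (diff_pmul_iter [::]).
have -> : (h, k) = (h, 0) + (0, k) :> lie * lie.
  by congr (_, _); rewrite /= ?addr0 ?add0r.
rewrite linearD; congr (_ + _).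
- have P : is_diff e (fun v : lie => (v, e)) (fun v : lie => (v, 0)).
    have := is_diff_pair (is_diff_id e) (is_diff_cst e e).
    exact: id.
  have H : \forall v \near e, pmul G v e = v.
    by have H := near_cran G; near=> v; rewrite pmul_e//; near: v.
  exact: (is_diff_near_eq (@is_diff_comp _ _ _ _ _ _ pm _ e P (differentiableP D)) (is_diff_id e) H h).
- have P : is_diff e (fun v : lie => (e, v)) (fun v : lie => (0, v)).
    have := is_diff_pair (is_diff_cst e e) (is_diff_id e).
    exact: id.
  have H : \forall v \near e, pmul G e v = v.
    have H := near_cran G; near=> v; rewrite /pmul cinv_e mul1g cinvK//; near: v.
    exact: H.
  exact: (is_diff_near_eq (@is_diff_comp _ _ _ _ _ _ pm _ e P (differentiableP D)) (is_diff_id e) H k).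
Unshelve. all: by end_near. Qed.

Lemma strict_pmul (eps : R) : 0 < eps ->
  exists2 d : R, 0 < d & forall v w v' w' : lie,
    rn (v - e) < d -> rn (w - e) < d -> rn (v' - e) < d -> rn (w' - e) < d ->
    [/\ cran phi v, cran phi w, cdom phi (cinv phi v * cinv phi w)%g &
      rn (pmul G v w - pmul G v' w' - (v - v') - (w - w')) <=
        eps * (rn (v - v') + rn (w - w'))].
Proof.
move=> e0.
pose b (k : 'I_(m + m)) : lie * lie :=
  match fintype.split k with inl i => (delta_mx 0 i, 0) | inr i => (0, delta_mx 0 i) end.
pose co (k : 'I_(m + m)) (v : lie * lie) : C :=
  match fintype.split k with inl i => v.1 0 i | inr i => v.2 0 i end.
have bE v : v = \sum_k co k v *: b k.
  rewrite big_split_ord /=.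
  under eq_bigr => i _ do rewrite /co /b (unsplitK (inl i)).
  under [X in _ + X]eq_bigr => i _ do rewrite /co /b (unsplitK (inr i)).
  have E1 : \sum_i v.1 0 i *: ((delta_mx 0 i, 0) : lie * lie) = (v.1, 0).
    rewrite [in RHS](row_sum_delta v.1).
    apply/esym/(@big_ind2 lie (lie * lie)%type (fun a b => (a, 0) = b)).
    - exact: erefl.
    - move=> a1 b1 a2 b2 <- <-.
      exact: (congr1 (pair (a1 + a2)) (esym (addr0 (0 : lie)))).
    - by move=> j _; exact: (congr1 (pair _) (esym (scaler0 lie (v.1 0 j)))).
  have E2 : \sum_i v.2 0 i *: ((0, delta_mx 0 i) : lie * lie) = (0, v.2).
    rewrite [in RHS](row_sum_delta v.2).
    apply/esym/(@big_ind2 lie (lie * lie)%type (fun a b => (0, a) = b)).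
    - exact: erefl.
    - move=> a1 b1 a2 b2 <- <-.
      exact: (congr1 (fun z => pair z (a1 + a2)) (esym (addr0 (0 : lie)))).
    - by move=> j _; exact: (congr1 (fun z => pair z _) (esym (scaler0 lie (v.2 0 j)))).
  rewrite E1 E2 [LHS]surjective_pairing.
  by congr (_, _); rewrite /= ?addr0 ?add0r.
have coB k v : rn (co k v) <= rn v.
  rewrite [v]surjective_pairing rn_pair /co; case: fintype.split => i /=.
    by apply: le_trans (rn_entry v.1 0 i) _; rewrite le_max lexx.
  by apply: le_trans (rn_entry v.2 0 i) _; rewrite le_max lexx orbT.
have Df : \forall q \near ((e, e) : lie * lie), differentiable pm q.
  have H := near_pmul; near=> q.
  have [H1 H2 H3] : [/\ cran phi q.1, cran phi q.2 & cdom phi (cinv phi q.1 * cinv phi q.2)%g] by near: q.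
  by rewrite [q]surjective_pairing; exact: (diff_pmul_iter [::]).
have Db k : {for ((e, e) : lie * lie), continuous (fun q => 'D_(b k) pm q)}.
  have [H1 H2 H3] := nbhs_singleton near_pmul.
  apply: differentiable_continuous.
  exact: (diff_pmul_iter [:: b k]).
have [d1 d10 H1] := strict_diff bE coB Df Db e0.
have /rn_nbhsP[d2 d20 H2] := near_pmul.
exists (Num.min d1 d2); first by rewrite lt_min d10.
move=> v w v' w'; rewrite !lt_min => /andP[v1 v2] /andP[w1 w2] /andP[v1' _] /andP[w1' _].
have [] := H2 (v, w).
  by rewrite (_ : (v, w) - (e, e) = (v - e, w - e)) // rn_pair gt_max v2 w2.
move=> /= A1 A2 A3; split=> //.
have := H1 (v, w) (v', w').
rewrite (_ : (v, w) - (e, e) = (v - e, w - e)) // rn_pair gt_max v1 w1.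
rewrite (_ : (v', w') - (e, e) = (v' - e, w' - e)) // rn_pair gt_max v1' w1'.
move=> /(_ erefl erefl).
rewrite (_ : (v, w) - (v', w') = (v - v', w - w')) // rn_pair diff_pmul_e opprD addrA.
move=> H; apply: le_trans H _; apply: ler_wpM2l; first exact: ltW.
by rewrite ge_max lerDl lerDr !rn_ge0.
Unshelve. all: by end_near. Qed.

End StrictMul.

(** * Completeness, and powers of elements near the identity *)

Section Complete.
Variable R : realType.
Local Notation C := (R[i] : numFieldType).

Lemma real_complete (v : nat -> R) :
  (forall e : R, 0 < e -> exists N, forall k l, (N <= k)%N -> (N <= l)%N ->
     `|v k - v l| <= e) ->
  exists l, forall e : R, 0 < e -> exists N, forall k, (N <= k)%N -> `|v k - l| <= e.
Proof.
move=> H.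
have : cauchy (v @ \oo).
  apply/cauchy_ballP => e e0.
  have [|N HN] := H (e / 2); first by rewrite divr_gt0.
  exists ([set v k | k in [set k | (N <= k)%N]], [set v k | k in [set k | (N <= k)%N]]) => /=.
    by split; exists N => // k /= Nk; exists k.
  move=> [a b] /= [[k Nk <-] [l Nl <-]].
  rewrite /ball /=; apply: le_lt_trans (HN k l Nk Nl) _.
  by rewrite ltr_pdivrMr// ltr_pMr// ltr1n.
move=> /cauchy_cvgP/cvg_ex[l Hl]; exists l => e e0.
have /cvgrPdist_le/(_ e e0) [N _ HN] := Hl.
by exists N => k Nk; rewrite distrC; exact: HN.
Qed.

Lemma rn_complete m n (u : nat -> 'M[C]_(m, n)) :
  (forall e : R, 0 < e -> exists N, forall k l, (N <= k)%N -> (N <= l)%N ->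
     rn (u k - u l) <= e) ->
  exists l, forall e : R, 0 < e -> exists N, forall k, (N <= k)%N ->
     rn (u k - l) <= e.
Proof.
move=> H.
have HR i j : exists l, forall e : R, 0 < e -> exists N, forall k, (N <= k)%N ->
    `|complex.Re (u k i j) - l| <= e.
  apply: real_complete => e e0; have [N HN] := H e e0; exists N => k l Nk Nl.
  apply: le_trans (HN k l Nk Nl); apply: le_trans (rn_entry _ i j).
  by apply: le_trans (rn_Re _); rewrite !mxE raddfB.
have HI i j : exists l, forall e : R, 0 < e -> exists N, forall k, (N <= k)%N ->
    `|complex.Im (u k i j) - l| <= e.
  apply: real_complete => e e0; have [N HN] := H e e0; exists N => k l Nk Nl.
  apply: le_trans (HN k l Nk Nl); apply: le_trans (rn_entry _ i j).
  by apply: le_trans (rn_Im _); rewrite !mxE raddfB.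
pose a i j := projT1 (cid (HR i j)); pose b i j := projT1 (cid (HI i j)).
exists (\matrix_(i, j) Complex (a i j) (b i j)) => e e0.
have e2 : 0 < e / 2 by rewrite divr_gt0.
have : \forall k \near \oo, forall ij : 'I_m * 'I_n,
    rn (u k ij.1 ij.2 - Complex (a ij.1 ij.2) (b ij.1 ij.2) : C) <= e.
  apply: filter_forall => -[i j] /=.
  have [N1 H1] := projT2 (cid (HR i j)) _ e2.
  have [N2 H2] := projT2 (cid (HI i j)) _ e2.
  exists (maxn N1 N2) => // k /=; rewrite geq_max => /andP[/H1 h1 /H2 h2].
  apply: le_trans (rn_ReIm _) _; rewrite (splitr e).
  by apply: lerD; rewrite raddfB.
move=> [N _ HN]; exists N => k Nk; apply: rn_mxle; first exact: ltW.
by move=> i j; rewrite !mxE; exact: (HN k Nk (i, j)).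
Qed.
End Complete.

Section LocalPowers.
Variable R : realType.
Local Notation C := (R[i] : numFieldType).
Variables (m : nat) (G : lieGroupType C m).
Local Notation lie := 'rV[C]_m.
Local Notation phi := (@chart1 C m G).
Local Notation e := (id_coord G).

(** Chart coordinates recentred so that 1 corresponds to 0. They agree with logarithm and
    exponential to first order only. *)
Definition clog (g : G) : lie := cmap phi g - e.
Definition cexp (x : lie) : G := cinv phi (e + x).
Definition gball (d : R) (g : G) := cdom phi g /\ rn (clog g) < d.

Lemma clog1 : clog 1%g = 0. Proof. exact: subrr. Qed.

Lemma cexp_lam g : cdom phi g -> cexp (clog g) = g.
Proof. by move=> cg; rewrite /cexp /clog addrC subrK chart_mapK. Qed.

Lemma clog_inj g h : cdom phi g -> cdom phi h -> clog g = clog h -> g = h.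
Proof. by move=> cg ch E; rewrite -(cexp_lam cg) E cexp_lam. Qed.

Lemma gball1 d : 0 < d -> gball d 1%g.
Proof. by move=> d0; split; [exact: phi1 | rewrite clog1 rn0]. Qed.

Lemma gballW d d' g : d <= d' -> gball d g -> gball d' g.
Proof. by move=> dd' [cg lg]; split=> //; exact: lt_le_trans dd'. Qed.

(** Strict differentiability of the product at (1, 1) in the recentred coordinates, where its
    differential is the sum. *)
Definition strict_ball (eps d : R) := forall a b a' b' : G,
  gball d a -> gball d b -> gball d a' -> gball d b' ->
  cdom phi (a * b)%g /\
  rn (clog (a * b)%g - clog (a' * b')%g - (clog a - clog a') - (clog b - clog b')) <=
     eps * (rn (clog a - clog a') + rn (clog b - clog b')).

Lemma strict_clog (eps : R) : 0 < eps -> exists2 d : R, 0 < d & strict_ball eps d.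
Proof.
move=> e0; have [d d0 H] := strict_pmul G e0; exists d => //.
move=> a b a' b' [ca la] [cb lb] [ca' la'] [cb' lb'].
have [_ _ Hc Hr] := H _ _ _ _ la lb la' lb'.
have clogB x y : clog x - clog y = cmap phi x - cmap phi y.
  by rewrite /clog opprB addrA subrK.
move: Hc Hr; rewrite /pmul !chart_mapK// => Hc Hr; split=> //.
by rewrite !clogB.
Qed.

Lemma cexp_ball : exists2 d : R, 0 < d &
  forall x, rn x < d -> cdom phi (cexp x) /\ clog (cexp x) = x.
Proof.
have /rn_nbhsP[d d0 H] := near_cran G.
exists d => // x xd.
have cx : cran phi (e + x) by apply: H; rewrite addrC addKr.
split; first exact: cinv_dom.
by rewrite /clog /cexp cinvK// addrC addKr.
Qed.

Lemma adm_local_bound : exists2 d : R, 0 < d & exists B : R,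
  forall g, gball d g -> rn (adm g) <= B.
Proof.
have [d d0 H] := rn_diff (is_diff_Adm G) ltr01.
have [k k0 Hk] := rn_diff_bound (is_diff_Adm G).
exists d => //; exists (rn (1%:M : 'M[C]_m) + (1 + k) * d) => g [cg lg].
have := H (cmap phi g) lg; rewrite Adm_e /Adm chart_mapK// mul1r => H1.
have H2 := Hk (cmap phi g - e).
have := rn_triS (adm g - 1%:M - adM G (cmap phi g - e)) (- adM G (cmap phi g - e)).
rewrite opprK subrK rnN => H3.
have := rn_triS (adm g) 1%:M; rewrite /clog in lg.
have : (1 + k) * rn (cmap phi g - e) <= (1 + k) * d.
  by rewrite ler_wpM2l ?ltW// addr_gt0.
have := rn_triS (adm g - 1%:M) (adM G (cmap phi g - e)).
lra.
Qed.

Variable d1 : R.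
Hypothesis d10 : 0 < d1.
Hypothesis strict1 : strict_ball 1 d1.

Lemma clog_lip a b a' b' :
  gball d1 a -> gball d1 b -> gball d1 a' -> gball d1 b' ->
  rn (clog (a * b)%g - clog (a' * b')%g) <=
    2 * (rn (clog a - clog a') + rn (clog b - clog b')).
Proof.
move=> ha hb ha' hb'; have [_ H] := strict1 ha hb ha' hb'.
have := rn_triS (clog (a * b)%g - clog (a' * b')%g - (clog a - clog a')) (clog b - clog b').
have := rn_triS (clog (a * b)%g - clog (a' * b')%g) (clog a - clog a').
lra.
Qed.

(** The factor 2 is 1 + 1: the first-order term and the error for [eps = 1]. *)
Lemma clog_grow a b : gball d1 a -> gball d1 b ->
  cdom phi (a * b)%g /\ rn (clog (a * b)%g) <= rn (clog a) + 2 * rn (clog b).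
Proof.
move=> ha hb; have [c H] := strict1 ha hb ha (gball1 d10); split=> //.
move: H; rewrite mulg1 subrr subr0 clog1 rn0 add0r subr0 => H.
have := rn_triS (clog (a * b)%g - clog a) (clog b).
have := rn_triS (clog (a * b)%g) (clog a).
lra.
Qed.

(** Each further factor adds at most 2 h by [clog_grow]; the condition on N keeps the intermediate
    powers in the ball where that applies. *)
Lemma pow_ball x N (h : R) : cdom phi x -> rn (clog x) <= h ->
  2 * N%:R * h < d1 -> forall j, (j <= N)%N ->
  cdom phi (x ^+ j)%g /\ rn (clog (x ^+ j)%g) <= 2 * j%:R * h.
Proof.
move=> cx xh Nh.
have h0 : 0 <= h by apply: le_trans xh; exact: rn_ge0.
elim=> [_|j IH jN].
  by rewrite expg0 clog1 rn0 mulr0 mul0r; split=> //; exact: phi1.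
have [cj hj] := IH (ltnW jN).
have jN' : j.+1%:R <= N%:R :> R by rewrite ler_nat.
have j0 : 0 <= j%:R :> R by [].
have jE : j.+1%:R = j%:R + 1 :> R by rewrite -natr1.
rewrite jE in jN' *.
have A : 2 * (j%:R + 1) * h < d1.
  apply: le_lt_trans Nh; rewrite ler_wpM2r// ler_pM2l//.
have B1 : gball d1 (x ^+ j)%g by split=> //; nra.
have B2 : gball d1 x by split=> //; nra.
have [c H] := clog_grow B1 B2; rewrite expgSr; split=> //.
lra.
Qed.

(** One more factor contributes an error of at most eps h, and these errors add up. *)
Lemma pow_first_order (eps d : R) x N (h : R) :
  strict_ball eps d -> 0 < eps -> 0 < d ->
  cdom phi x -> rn (clog x) <= h -> 2 * N%:R * h < d1 -> 2 * N%:R * h < d ->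
  forall j, (j <= N)%N -> rn (clog (x ^+ j)%g - j%:R *: clog x) <= eps * j%:R * h.
Proof.
move=> Hd e0 d0 cx xh Nh Nd.
have h0 : 0 <= h by apply: le_trans xh; exact: rn_ge0.
elim=> [_|j IH jN].
  by rewrite expg0 clog1 scale0r subr0 rn0 mulr0 mul0r.
have [cj hj] := pow_ball cx xh Nh (ltnW jN).
have jN' : j.+1%:R <= N%:R :> R by rewrite ler_nat.
have j0 : 0 <= j%:R :> R by [].
have jE : j.+1%:R = j%:R + 1 :> R by rewrite -natr1.
rewrite jE in jN' *.
have A : 2 * (j%:R + 1) * h < d.
  apply: le_lt_trans Nd; rewrite ler_wpM2r// ler_pM2l//.
have B1 : gball d (x ^+ j)%g by split=> //; nra.
have B2 : gball d x by split=> //; nra.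
have [_] := Hd _ _ _ _ B1 B2 B1 (gball1 d0).
rewrite mulg1 subrr subr0 clog1 rn0 add0r subr0 -expgSr => H.
have := IH (ltnW jN) => {}IH.
have -> : clog (x ^+ j.+1)%g - j.+1%:R *: clog x =
    (clog (x ^+ j.+1)%g - clog (x ^+ j)%g - clog x) + (clog (x ^+ j)%g - j%:R *: clog x).
  rewrite -natr1 scalerDl scale1r opprD addrA [RHS]addrA.
  by rewrite [X in _ = X + _ - _]addrAC subrK addrAC.
have := rnD (clog (x ^+ j.+1)%g - clog (x ^+ j)%g - clog x) (clog (x ^+ j)%g - j%:R *: clog x).
have : eps * rn (clog x) <= eps * h by rewrite ler_pM2l.
lra.
Qed.

Lemma pow_compare x y N (h : R) : cdom phi x -> cdom phi y ->
  rn (clog x) <= h -> rn (clog y) <= h -> 2 * N%:R * h < d1 ->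
  rn (clog (x ^+ N)%g - clog (y ^+ N)%g) <= 4 * N%:R * rn (clog x - clog y).
Proof.
move=> cx cy xh yh Nh.
have h0 : 0 <= h by apply: le_trans xh; exact: rn_ge0.
(* The factors y are exchanged for x one at a time, through the words x^j y^(N-j). An exchange
   happens inside a word, so [clog_lip] is applied twice: 4 = 2 * 2. *)
suff : forall j, (j <= N)%N ->
    rn (clog (x ^+ j * y ^+ (N - j))%g - clog (y ^+ N)%g) <= 4 * j%:R * rn (clog x - clog y).
  by move=> /(_ N (leqnn N)); rewrite subnn expg0 mulg1.
elim=> [_|j IH jN].
  by rewrite expg0 mul1g subn0 subrr rn0 mulr0 mul0r.
have {}IH := IH (ltnW jN).
have kE : (N - j = (N - j.+1).+1)%N by rewrite subnSK.
set k := (N - j.+1)%N in kE *.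
have [cxj hxj] := pow_ball cx xh Nh (ltnW jN).
have [cxS hxS] := pow_ball cx xh Nh jN.
have kN : (k < N)%N by rewrite /k ltn_subrL (leq_trans _ jN).
have [cyk hyk] := pow_ball cy yh Nh (ltnW kN).
have jN' : j.+1%:R <= N%:R :> R by rewrite ler_nat.
have kN' : k.+1%:R <= N%:R :> R by rewrite ler_nat.
have j0 : 0 <= j%:R :> R by [].
have k0 : 0 <= k%:R :> R by [].
have A : 2 * (j.+1%:R) * h < d1.
  apply: le_lt_trans Nh; rewrite ler_wpM2r// ler_pM2l//.
have A' : 2 * (k.+1%:R) * h < d1.
  apply: le_lt_trans Nh; rewrite ler_wpM2r// ler_pM2l//.
rewrite -natr1 in hxS A A' jN' kN' *; rewrite -natr1 in A'.
have B1 : gball d1 (x ^+ j)%g by split=> //; nra.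
have Bx : gball d1 x by split=> //; nra.
have By : gball d1 y by split=> //; nra.
have Bk : gball d1 (y ^+ k)%g by split=> //; nra.
have BS : gball d1 (x ^+ j * x)%g by rewrite -expgSr; split=> //; nra.
have BS' : gball d1 (x ^+ j * y)%g.
  by have [c g] := clog_grow B1 By; split=> //; nra.
have H1 := clog_lip BS Bk BS' Bk; have H2 := clog_lip B1 Bx B1 By.
rewrite !subrr !rn0 in H1 H2.
rewrite kE in IH.
have -> : (x ^+ j.+1 * y ^+ k = x ^+ j * x * y ^+ k)%g by rewrite expgSr.
have E : (x ^+ j * y ^+ k.+1 = x ^+ j * y * y ^+ k)%g by rewrite expgS mulgA.
rewrite E in IH.
have := rn_triB (clog (x ^+ j * x * y ^+ k)%g) (clog (x ^+ j * y * y ^+ k)%g) (clog (y ^+ N)%g).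
lra.
Qed.

End LocalPowers.

(** * Construction of one-parameter groups *)

Lemma eventually_small (R : realType) (x d : R) : 0 <= x -> 0 < d ->
  exists2 N0, (0 < N0)%N & forall N, (N0 <= N)%N -> x / N%:R < d.
Proof.
move=> x0 dp; exists (Num.truncn (x / d)).+1 => // N Nl.
have N0 : 0 < N%:R :> R by rewrite ltr0n; exact: leq_trans Nl.
rewrite ltr_pdivrMr// mulrC -ltr_pdivrMr//.
apply: lt_le_trans (truncnS_gt _) _.
by rewrite ler_nat.
Qed.

Lemma le_limit (R : realType) (x y : R) : (forall d : R, 0 < d -> x <= y + d) -> x <= y.
Proof. by move=> H; apply/ler_addgt0Pr. Qed.

Section OneParameter.
Variable R : realType.
Local Notation C := (R[i] : numFieldType).
Variables (m : nat) (G : lieGroupType C m).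
Local Notation lie := 'rV[C]_m.
Local Notation phi := (@chart1 C m G).
Local Notation e := (id_coord G).
Variable d1 : R.
Hypothesis d10 : 0 < d1.
Hypothesis cexpK : forall x, rn x < d1 ->
  cdom phi (cexp G x) /\ clog (cexp G x) = x.
Hypothesis strict1 : strict_ball G 1 d1.
Variable Z : lie.

(** For |t| at most [rho] the products met below stay in the ball of radius [d1]: 32 leaves room for
    the factors 2 and 4 lost in the power estimates, and [rn Z + 1] avoids a division by 0. *)
Let rho : R := d1 / (32 * (rn Z + 1)).
Let r (t : C) : R := rn t * rn Z.

Lemma rho_gt0 : 0 < rho.
Proof. by rewrite divr_gt0// mulr_gt0// ltr_wpDl ?rn_ge0. Qed.

Lemma r_ge0 t : 0 <= r t. Proof. by rewrite mulr_ge0 ?rn_ge0. Qed.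

Lemma r_small (t : C) : rn t <= rho -> 32 * r t < d1.
Proof.
move=> tr; have z1 : 0 < rn Z + 1 by rewrite ltr_wpDl ?rn_ge0.
have E : rho * (32 * (rn Z + 1)) = d1.
  by rewrite /rho divfK// lt0r_neq0// mulr_gt0.
have : r t <= rho * rn Z by rewrite ler_wpM2r ?rn_ge0.
have := rho_gt0; rewrite /r; nra.
Qed.

Let xs N (t : C) : G := cexp G ((t / N%:R) *: Z).
Let gam N t : G := (xs N t ^+ N)%g.

Lemma r_div t N : r (t / N%:R) = r t / N%:R.
Proof. by rewrite /r rnM rnV rn_natr mulrAC. Qed.

Lemma rn_div_le (t : C) N : (0 < N)%N -> rn t <= rho -> rn (t / N%:R : C) <= rho.
Proof.
move=> N0 tr; rewrite rnM rnV rn_natr; apply: le_trans tr.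
by apply: ler_piMr; [exact: rn_ge0 | rewrite invf_le1 ?ltr0n// ler1n].
Qed.

Lemma xsP N (t : C) : (0 < N)%N -> rn t <= rho ->
  [/\ cdom phi (xs N t), clog (xs N t) = (t / N%:R) *: Z &
      rn (clog (xs N t)) <= r t / N%:R].
Proof.
move=> N0 tr; have E : rn ((t / N%:R) *: Z) = r t / N%:R.
  by rewrite rnZ -/(r _) r_div.
have [|c l] := cexpK (x := (t / N%:R) *: Z).
  have := r_small (rn_div_le N0 tr); rewrite r_div -E.
  have := rn_ge0 ((t / N%:R) *: Z); lra.
by split=> //; rewrite l E.
Qed.

Lemma mul_div2 N (c : R) : (0 < N)%N -> 2 * N%:R * (c / N%:R) = 2 * c.
Proof. by move=> N0; field; rewrite lt0r_neq0// ltr0n. Qed.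

Lemma gam_bound N (t : C) : (0 < N)%N -> rn t <= rho ->
  cdom phi (gam N t) /\ rn (clog (gam N t)) <= 2 * r t.
Proof.
move=> N0 tr; have [c _ h] := xsP N0 tr; have rs := r_small tr.
have r0 := r_ge0 t.
have [|c' H] := pow_ball d10 strict1 c h _ (leqnn N).
  by rewrite mul_div2//; lra.
by split=> //; apply: le_trans H _; rewrite mul_div2.
Qed.

(** A product of N factors is compared with its refinement into N M factors: the M-th power of a
    fine factor is the coarse one up to eps r / N, and [pow_compare] multiplies this by 4 N. *)
Lemma gam_cauchy (eps : R) : 0 < eps -> exists2 d : R, 0 < d &
  forall (t : C) N M, rn t <= rho -> (0 < N)%N -> (0 < M)%N -> 2 * r t / N%:R < d ->
  rn (clog (gam N t) - clog (gam (N * M) t)) <= 4 * eps * r t.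
Proof.
move=> e0; have [d d0 Hd] := strict_clog G e0; exists d => // t N M tr N0 M0 rd.
have NM0 : (0 < N * M)%N by rewrite muln_gt0 N0.
have r0 := r_ge0 t.
have r4 : 2 * (2 * r t) < d1 by have rs := r_small tr; lra.
have r2 : 2 * r t < d1 by lra.
have NR : 0 < N%:R :> R by rewrite ltr0n.
have MR : 0 < M%:R :> R by rewrite ltr0n.
have [cx lx hx] := xsP N0 tr; have [cy ly hy] := xsP NM0 tr.
have E1 : 2 * M%:R * (r t / (N * M)%:R) = 2 * r t / N%:R.
  by rewrite natrM; field; rewrite !lt0r_neq0.
have E1' : 2 * r t / N%:R <= 2 * r t.
  by apply: ler_piMr; [exact: mulr_ge0 | rewrite invf_le1// ler1n].
have A1 : 2 * M%:R * (r t / (N * M)%:R) < d1 by rewrite E1; exact: le_lt_trans r2.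
have A2 : 2 * M%:R * (r t / (N * M)%:R) < d by rewrite E1.
have FO := pow_first_order d10 strict1 Hd e0 d0 cy hy A1 A2 (leqnn M).
have [cyM hyM] := pow_ball d10 strict1 cy hy A1 (leqnn M).
have E2 : M%:R *: clog (xs (N * M) t) = clog (xs N t).
  rewrite lx ly scalerA; congr (_ *: _); rewrite natrM; field.
  by rewrite !pnatr_eq0 -!lt0n N0 M0.
rewrite E1 in hyM; rewrite E2 in FO.
have hx' : rn (clog (xs N t)) <= 2 * r t / N%:R.
  by apply: le_trans hx _; apply: ler_wpM2r; [rewrite invr_ge0 ltW | lra].
have A3 : 2 * N%:R * (2 * r t / N%:R) < d1 by rewrite mul_div2.
have := pow_compare d10 strict1 cx cyM hx' hyM A3.
rewrite -expgnA (mulnC M N) => H; apply: le_trans H _.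
rewrite rnB; apply: le_trans (ler_wpM2l _ FO) _; first by rewrite mulr_ge0// ltW.
rewrite le_eqVlt; apply/orP; left; apply/eqP.
by rewrite natrM; field; rewrite !lt0r_neq0.
Qed.

Lemma gam_lim (t : C) : rn t <= rho -> exists l, forall eps : R, 0 < eps ->
  exists N0, forall N, (N0 <= N)%N -> rn (clog (gam N t) - l) <= eps.
Proof.
move=> tr; apply: rn_complete => eps e0.
have r0 := r_ge0 t.
have e1 : 0 < eps / (8 * (r t + 1)) by rewrite divr_gt0// mulr_gt0// ltr_wpDl.
have [d d0 H] := gam_cauchy e1.
have r20 : 0 <= 2 * r t by exact: mulr_ge0.
have [N0 N00 HN] := eventually_small r20 d0.
exists N0 => k l Nk Nl.
have k0 : (0 < k)%N := leq_trans N00 Nk.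
have l0 : (0 < l)%N := leq_trans N00 Nl.
(* The subdivisions [k] and [l] are both compared with their common refinement [k * l]. *)
have H1 := H t k l tr k0 l0 (HN k Nk); have H2 := H t l k tr l0 k0 (HN l Nl).
rewrite mulnC in H2.
have := rn_triB (clog (gam k t)) (clog (gam (k * l) t)) (clog (gam l t)).
rewrite [X in _ <= _ + X]rnB.
have E : 4 * (eps / (8 * (r t + 1))) * r t + 4 * (eps / (8 * (r t + 1))) * r t <= eps.
  have -> : 4 * (eps / (8 * (r t + 1))) * r t + 4 * (eps / (8 * (r t + 1))) * r t
      = eps * (r t / (r t + 1)) by field; rewrite lt0r_neq0// ltr_wpDl.
  apply: ler_piMr; first exact: ltW.
  by rewrite ler_pdivrMr ?ltr_wpDl// mul1r lerDl.
lra.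
Qed.

Lemma local_one_param : exists gamma : C -> G,
  (forall t : C, rn t <= rho ->
    [/\ cdom phi (gamma t), rn (clog (gamma t)) <= 2 * r t &
      forall eps : R, 0 < eps -> exists N0, forall N, (N0 <= N)%N ->
        rn (clog (gam N t) - clog (gamma t)) <= eps]) /\
  (forall eps : R, 0 < eps -> exists2 d : R, 0 < d & forall t : C, rn t <= rho ->
     r t < d -> rn (clog (gamma t) - t *: Z) <= eps * r t).
Proof.
have /choice[ell Hell] : forall t : C, exists l, rn t <= rho -> forall eps : R, 0 < eps ->
    exists N0, forall N, (N0 <= N)%N -> rn (clog (gam N t) - l) <= eps.
  move=> t; have [tr|tr] := boolP (rn t <= rho).
    by have [l Hl] := gam_lim tr; exists l.
  by exists 0.
have ellB (t : C) : rn t <= rho -> rn (ell t) <= 2 * r t.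
  move=> tr; apply: le_limit => d d0; have [N0 HN] := Hell t tr d d0.
  have [_ H2] := gam_bound (ltn0Sn N0) tr.
  have := HN N0.+1 (leqnSn _); rewrite rnB => H1.
  have := rn_triS (ell t) (clog (gam N0.+1 t)); lra.
have clogE (t : C) : rn t <= rho -> cdom phi (cexp G (ell t)) /\ clog (cexp G (ell t)) = ell t.
  move=> tr; apply: cexpK; apply: le_lt_trans (ellB t tr) _.
  have := r_small tr; have := r_ge0 t; lra.
exists (fun t => cexp G (ell t)); split.
  move=> t tr; have [c l] := clogE t tr; rewrite l; split=> //.
    exact: ellB.
  exact: Hell.
move=> eps e0; have e4 : 0 < eps / 4 by rewrite divr_gt0.
have [d d0 H] := gam_cauchy e4; exists (d / 2); first by rewrite divr_gt0.
move=> t tr rd; have [c l] := clogE t tr; rewrite l.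
apply: le_limit => k k0; have [N0 HN] := Hell t tr k k0.
have H1 := HN N0.+1 (leqnSn _).
(* For N = 1 the approximation has coordinates exactly [t *: Z]; this yields the first-order
   behaviour of the limit. *)
have := H t 1%N N0.+1 tr isT isT; rewrite mul1n divr1 => H2.
have {}H2 : rn (clog (gam 1 t) - clog (gam N0.+1 t)) <= 4 * (eps / 4) * r t by apply: H2; lra.
have E : clog (gam 1 t) = t *: Z.
  by have [_ lx _] := xsP (ltnSn 0) tr; rewrite /gam expg1 lx divr1.
rewrite E rnB in H2; rewrite rnB in H1.
have := rn_triB (ell t) (clog (gam N0.+1 t)) (t *: Z); lra.
Qed.

Variable gamma : C -> G.
Hypothesis gammaP : forall t : C, rn t <= rho ->
    [/\ cdom phi (gamma t), rn (clog (gamma t)) <= 2 * r t &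
      forall eps : R, 0 < eps -> exists N0, forall N, (N0 <= N)%N ->
        rn (clog (gam N t) - clog (gamma t)) <= eps].
Hypothesis gamma1 : forall eps : R, 0 < eps -> exists2 d : R, 0 < d &
  forall t : C, rn t <= rho -> r t < d -> rn (clog (gamma t) - t *: Z) <= eps * r t.

Lemma clog_close_eq (g h : G) : cdom phi g -> cdom phi h ->
  (forall eps : R, 0 < eps -> rn (clog g - clog h) <= eps) -> g = h.
Proof.
move=> cg ch H; apply: clog_inj => //; apply/eqP; rewrite -subr_eq0; apply/eqP.
by apply: rn_eq0; apply: le_limit => d /H; rewrite add0r.
Qed.

(** The characterization by which conjugates and products are identified: [pow_compare] turns
    closeness o(1/N) of N-th roots into closeness of their N-th powers. *)
Lemma gamma_of_roots (t : C) g : rn t <= rho ->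
  (forall eps : R, 0 < eps -> exists N0, forall N, (N0 <= N)%N -> (0 < N)%N ->
     exists y : G, [/\ (y ^+ N)%g = g, cdom phi y &
       rn (clog y - (t / N%:R) *: Z) <= eps / N%:R]) ->
  g = gamma t.
Proof.
move=> tr H; have [cg _ Hg] := gammaP tr.
have rs := r_small tr; have r0 := r_ge0 t.
have key : forall eps : R, 0 < eps -> eps <= d1 / 32 ->
    exists N0, forall N, (N0 <= N)%N -> (0 < N)%N ->
      cdom phi g /\ rn (clog g - clog (gam N t)) <= 4 * eps.
  move=> eps e0 ed; have [N0 HN] := H eps e0; exists N0 => N Nl N0'.
  have [y [yN cy ly]] := HN N Nl N0'; have [cx lx hx] := xsP N0' tr.
  have NR : 0 < N%:R :> R by rewrite ltr0n.
  have hy : rn (clog y) <= (r t + eps) / N%:R.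
    have := rn_triS (clog y) ((t / N%:R) *: Z); rewrite -lx mulrDl in ly *; lra.
  have hx' : rn (clog (xs N t)) <= (r t + eps) / N%:R.
    by apply: le_trans hx _; apply: ler_wpM2r; [rewrite invr_ge0 ltW | lra].
  have A : 2 * N%:R * ((r t + eps) / N%:R) < d1 by rewrite mul_div2//; lra.
  have [] := pow_ball d10 strict1 cy hy A (leqnn N); rewrite yN => cg' _; split=> //.
  have := pow_compare d10 strict1 cy cx hy hx' A; rewrite yN => P.
  apply: le_trans P _; rewrite lx; apply: le_trans (ler_wpM2l _ ly) _.
    by rewrite mulr_ge0// ltW.
  rewrite le_eqVlt; apply/orP; left; apply/eqP; field; exact: lt0r_neq0.
have cg' : cdom phi g.
  have d320 : 0 < d1 / 32 by rewrite divr_gt0.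
  have [N0 HN] := key _ d320 (lexx _).
  by have [] := HN N0.+1 (leqnSn _) isT.
apply: clog_close_eq => // eps e0.
pose eps' := Num.min (eps / 8) (d1 / 32).
have e'0 : 0 < eps' by rewrite lt_min !divr_gt0.
have e'1 : eps' <= eps / 8 by rewrite ge_min lexx.
have e'2 : eps' <= d1 / 32 by rewrite ge_min lexx orbT.
have [N1 H1] := key _ e'0 e'2.
have e20 : 0 < eps / 2 by rewrite divr_gt0.
have [N2 H2] := Hg _ e20.
have [_ P1] := H1 (N1 + N2).+1 (leqW (leq_addr _ _)) isT.
have P2 := H2 (N1 + N2).+1 (leqW (leq_addl _ _)).
have := rn_triB (clog g) (clog (gam (N1 + N2).+1 t)) (clog (gamma t)); lra.
Qed.

(** For the approximations this is exact: the M-th power of [gam k (t / M)] is [gam (k * M) t]. *)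
Lemma gamma_root (t : C) M : (0 < M)%N -> rn t <= rho ->
  (gamma (t / M%:R) ^+ M)%g = gamma t.
Proof.
move=> M0 tr; have tr' := rn_div_le M0 tr.
have rs := r_small tr; have r0 := r_ge0 t.
have MR : 0 < M%:R :> R by rewrite ltr0n.
have [cg' hg' Hg'] := gammaP tr'; have [cg hg Hg] := gammaP tr.
rewrite r_div mulrA in hg'.
have A : 2 * M%:R * (2 * r t / M%:R) < d1 by rewrite mul_div2//; lra.
have [cgM _] := pow_ball d10 strict1 cg' hg' A (leqnn M).
apply: clog_close_eq => // eps e0.
have e1 : 0 < eps / (8 * M%:R) by rewrite divr_gt0// mulr_gt0.
have e2 : 0 < eps / 2 by rewrite divr_gt0.
have [N1 H1] := Hg' _ e1; have [N2 H2] := Hg _ e2.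
pose k := (N1 + N2).+1.
have P1 := H1 k (leqW (leq_addr _ _)).
have P2 := H2 (k * M)%N (leq_trans (leqW (leq_addl _ _)) (leq_pmulr k M0)).
have [ck hk] := gam_bound (isT : (0 < k)%N) tr'.
rewrite r_div mulrA in hk.
have P3 := pow_compare d10 strict1 cg' ck hg' hk A.
have E : (gam k (t / M%:R) ^+ M)%g = gam (k * M) t.
  rewrite /gam -expgnA; congr (cexp G (_ *: Z) ^+ _)%g.
  by rewrite natrM -mulrA -invfM [(M%:R * k%:R : C)]mulrC.
rewrite E rnB in P3.
have P4 : 4 * M%:R * rn (clog (gamma (t / M%:R)) - clog (gam k (t / M%:R))) <= eps / 2.
  rewrite rnB; apply: le_trans (ler_wpM2l _ P1) _; first by rewrite mulr_ge0// ltW.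
  rewrite le_eqVlt; apply/orP; left; apply/eqP; field; exact: lt0r_neq0.
have := rn_triB (clog (gamma (t / M%:R) ^+ M)%g) (clog (gam (k * M) t)) (clog (gamma t)).
rewrite [X in _ <= X + _]rnB; lra.
Qed.

Lemma gamma_pow_ball (t : C) N j : (0 < N)%N -> (j <= N)%N -> rn t <= rho ->
  gball d1 (gamma (t / N%:R) ^+ j)%g.
Proof.
move=> N0 jN tr; have r0 := r_ge0 t.
have r4 : 2 * (2 * r t) < d1 by have rs := r_small tr; lra.
have [cg hg _] := gammaP (rn_div_le N0 tr); rewrite r_div mulrA in hg.
have A : 2 * N%:R * (2 * r t / N%:R) < d1 by rewrite mul_div2.
have [c h] := pow_ball d10 strict1 cg hg A jN; split=> //.
apply: le_lt_trans h _; apply: le_lt_trans A.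
rewrite ler_wpM2r ?ler_pM2l ?ler_nat//.
by rewrite divr_ge0// mulr_ge0.
Qed.

Variable B : R.
Hypothesis admB : forall g : G, gball d1 g -> rn (adm g) <= B.
Hypothesis Zc : Z *m adM G Z = 0.

Lemma gdom (t : C) : rn t <= rho -> cdom phi (gamma t).
Proof. by move=> /gammaP[]. Qed.

Lemma rn_divn (t : C) N : rn (t / N%:R : C) = rn t / N%:R.
Proof. by rewrite rnM rnV rn_natr. Qed.

Lemma rn_divn_le (t : C) N (d : R) : (0 < N)%N -> rn t <= d -> rn (t / N%:R : C) <= d.
Proof.
move=> N0; apply: le_trans; rewrite rn_divn.
by apply: ler_piMr; [exact: rn_ge0 | rewrite invf_le1 ?ltr0n// ler1n].
Qed.

(** Shrinks [eps] so as to absorb a constant [c] that may be 0. *)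
Lemma scale_small (eps c : R) : 0 < eps -> 0 <= c ->
  0 < eps / (c + 1) /\ forall x, 0 <= x -> eps / (c + 1) * (c * x) <= eps * x.
Proof.
move=> e0 c0; have c1 : 0 < c + 1 by rewrite ltr_wpDl.
split=> [|x x0]; first exact: divr_gt0.
have -> : eps / (c + 1) * (c * x) = eps * x * (c / (c + 1)).
  by field; exact: lt0r_neq0.
apply: ler_piMr; first by rewrite mulr_ge0// ltW.
by rewrite ler_pdivrMr// mul1r lerDl.
Qed.

Lemma gder (eps : R) : 0 < eps -> exists2 d : R, 0 < d & forall t : C, rn t <= rho ->
  rn t < d -> rn (clog (gamma t) - t *: Z) <= eps * rn t.
Proof.
move=> e0; have [e1 He] := scale_small e0 (rn_ge0 Z).
have [d d0 H] := gamma1 e1; have z1 : 0 < rn Z + 1 by rewrite ltr_wpDl ?rn_ge0.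
exists (d / (rn Z + 1)) => [|t tr]; first exact: divr_gt0.
rewrite ltr_pdivlMr// => td; apply: le_trans (H t tr _) _.
  by apply: le_lt_trans td; rewrite ler_wpM2l ?rn_ge0// lerDl.
by rewrite /r [rn t * _]mulrC; exact: He (rn_ge0 t).
Qed.

Lemma gder_size (eps d0 : R) : 0 < eps -> 0 < d0 -> exists2 d : R, 0 < d &
  forall t : C, rn t <= rho -> rn t < d ->
  [/\ rn (clog (gamma t) - t *: Z) <= eps * rn t,
      rn (clog (gamma t)) <= (1 + rn Z) * rn t & rn (clog (gamma t)) < d0].
Proof.
move=> e0 d00; have [da da0 H1] := gder e0; have [d2 d20 H2] := gder ltr01.
have z1 : 0 < 1 + rn Z by rewrite ltr_wpDr ?rn_ge0.
exists (Num.min (Num.min da d2) (d0 / (1 + rn Z))).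
  by rewrite !lt_min da0 d20 divr_gt0.
move=> t tr; rewrite !lt_min => /andP[/andP[t1 t2] t3].
have A : rn (clog (gamma t)) <= (1 + rn Z) * rn t.
  apply: le_trans (rn_triS _ (t *: Z)) _; rewrite rnZ mulrDl.
  by rewrite lerD ?(mulrC (rn t))//; exact: H2.
split=> //; first exact: H1.
by apply: le_lt_trans A _; rewrite mulrC -ltr_pdivlMr.
Qed.

(** The first-order term of the displacement of Z is [t Z, Z] = 0, so an o(t) remains. *)
Lemma Ad_gamma_near (eta : R) : 0 < eta -> exists2 d : R, 0 < d &
  forall t : C, rn t <= rho -> rn t < d -> rn (Z *m adm (gamma t) - Z) <= eta * rn t.
Proof.
move=> eta0; have D := is_diff_mulmxl Z (is_diff_Adm G).
have [k k0 Hk] := rn_diff_bound D.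
have z1 : 0 < 1 + rn Z by rewrite ltr_wpDr ?rn_ge0.
have e1 : 0 < eta / (2 * (1 + rn Z)) by rewrite divr_gt0// mulr_gt0.
have e2 : 0 < eta / (2 * k) by rewrite divr_gt0// mulr_gt0.
have [da da0 H1] := rn_diff D e1.
have [d d0 H] := gder_size e2 da0; exists d => // t tr td.
have [A1 A2 A3] := H t tr td.
have := H1 (cmap phi (gamma t)) A3.
rewrite Adm_e mulmx1 {1}/Adm chart_mapK; last exact: gdom.
rewrite -/(clog (gamma t)) => P1.
have E : Z *m adM G (clog (gamma t)) = Z *m adM G (clog (gamma t) - t *: Z).
  have -> : adM G (clog (gamma t) - t *: Z) = adM G (clog (gamma t)) - t *: adM G Z.
    by rewrite [LHS]linearB [X in _ - X]linearZ.
  by rewrite mulmxBr -scalemxAr Zc scaler0 subr0.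
have P2 := Hk (clog (gamma t) - t *: Z); rewrite -E in P2.
have := rn_triS (Z *m adm (gamma t) - Z) (Z *m adM G (clog (gamma t))).
have Q1 : eta / (2 * (1 + rn Z)) * rn (clog (gamma t)) <= eta / 2 * rn t.
  apply: le_trans (ler_wpM2l (ltW e1) A2) _.
  by rewrite le_eqVlt; apply/orP; left; apply/eqP; field; rewrite lt0r_neq0.
have Q2 : k * rn (clog (gamma t) - t *: Z) <= eta / 2 * rn t.
  apply: le_trans (ler_wpM2l (ltW k0) A1) _.
  by rewrite le_eqVlt; apply/orP; left; apply/eqP; field; rewrite lt0r_neq0.
move=> T; apply: le_trans T _; rewrite (splitr eta) mulrDl; apply: lerD.
  exact: le_trans P1 Q1.
exact: le_trans P2 Q2.
Qed.

(** [gamma s] is the N-th power of [gamma (s / N)]. Each factor displaces Z by o(1/N), the other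
    powers distort this by a bounded amount, and the N displacements add up to o(1). *)
Lemma Ad_gamma_fix (s : C) : rn s <= rho -> Z *m adm (gamma s) = Z.
Proof.
move=> sr; apply/eqP; rewrite -subr_eq0; apply/eqP/rn_eq0.
have B0 : 0 <= B by apply: le_trans (admB (gball1 G d10)); exact: rn_ge0.
pose K := m%:R * B * rn s + 1.
have K0 : 0 < K by rewrite ltr_wpDl// !mulr_ge0 ?rn_ge0.
apply: le_limit => eps e0; rewrite add0r.
have eta0 : 0 < eps / K by exact: divr_gt0.
have [d d0 H] := Ad_gamma_near eta0.
have [N N0 HN] := eventually_small (rn_ge0 s) d0.
have P := H (s / N%:R) (rn_divn_le N0 sr).
rewrite rn_divn in P; have {}P := P (HN N (leqnn N)).
have T : forall j, (j <= N)%N ->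
    rn (Z *m adm (gamma (s / N%:R)%R ^+ j)%g - Z) <= j%:R * (m%:R * (eps / K * (rn s / N%:R) * B)).
  elim=> [_|j IH jN]; first by rewrite expg0 adm1 mulmx1 subrr rn0 mul0r.
  have {}IH := IH (ltnW jN).
  rewrite expgSr admM mulmxA.
  have -> : Z *m adm (gamma (s / N%:R)) *m adm (gamma (s / N%:R)%R ^+ j)%g - Z =
    (Z *m adm (gamma (s / N%:R)) - Z) *m adm (gamma (s / N%:R)%R ^+ j)%g +
    (Z *m adm (gamma (s / N%:R)%R ^+ j)%g - Z).
    by rewrite mulmxBl addrA subrK.
  apply: le_trans (rnD _ _) _; rewrite -natr1 addrC mulrDl mul1r; apply: lerD => //.
  apply: le_trans (rn_mulmx _ _) _; apply: ler_wpM2l => //.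
  by apply: ler_pM; rewrite ?rn_ge0//; apply: admB; exact: gamma_pow_ball (ltnW jN) sr.
have := T N (leqnn N); rewrite gamma_root// => Q; apply: le_trans Q _.
have NR : 0 < N%:R :> R by rewrite ltr0n.
have -> : N%:R * (m%:R * (eps / K * (rn s / N%:R) * B)) = eps * (m%:R * B * rn s / K).
  by field; rewrite !lt0r_neq0.
apply: ler_piMr; first exact: ltW.
by rewrite ler_pdivrMr// mul1r lerDl.
Qed.

Lemma conjg_pow (a b : G) N : ((a * b * a^-1) ^+ N = a * b ^+ N * a^-1)%g.
Proof.
elim: N => [|N IH]; first by rewrite !expg0 mulg1 mulgV.
by rewrite !expgS IH !mulgA mulgVK.
Qed.

Lemma conj_gamma_near (g : G) (eta : R) : Z *m adm g = Z -> 0 < eta ->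
  exists2 d : R, 0 < d & forall t : C, rn t <= rho -> rn t < d ->
    cdom phi (g * gamma t * g^-1)%g /\
    rn (clog (g * gamma t * g^-1)%g - t *: Z) <= eta * rn t.
Proof.
move=> gZ eta0; have D := is_diff_pconj g.
have z1 : 0 < 1 + rn Z by rewrite ltr_wpDr ?rn_ge0.
pose k := m%:R * rn (adm g) + 1.
have k0 : 0 < k by rewrite ltr_wpDl// mulr_ge0 ?rn_ge0.
have e1 : 0 < eta / (2 * (1 + rn Z)) by rewrite divr_gt0// mulr_gt0.
have e2 : 0 < eta / (2 * k) by rewrite divr_gt0// mulr_gt0.
have [da da0 H1] := rn_diff D e1.
have /rn_nbhsP[d2 d20 H2] := pconj_dom g.
have d120 : 0 < Num.min da d2 by rewrite lt_min da0.
have [d d0 H] := gder_size e2 d120; exists d => // t tr td.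
have [A1 A2] := H t tr td; rewrite lt_min => /andP[A3 A4].
have := H2 (cmap phi (gamma t)) A4; rewrite chart_mapK; last exact: gdom.
move=> c; split=> //.
have := H1 (cmap phi (gamma t)) A3.
rewrite pconj_e {1}/pconj chart_mapK; last exact: gdom.
rewrite -/(clog (gamma t)) -/(clog _) Ad_adm => P1.
have E : clog (g * gamma t * g^-1)%g - t *: Z =
   (clog (g * gamma t * g^-1)%g - clog (gamma t) *m adm g) + (clog (gamma t) - t *: Z) *m adm g.
  by rewrite [X in _ = _ + X]mulmxBl -scalemxAl gZ addrA subrK.
rewrite E; apply: le_trans (rnD _ _) _; rewrite (splitr eta) mulrDl; apply: lerD.
  apply: le_trans P1 _; apply: le_trans (ler_wpM2l (ltW e1) A2) _.
  by rewrite le_eqVlt; apply/orP; left; apply/eqP; field; rewrite lt0r_neq0.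
apply: le_trans (rn_mulmx _ _) _.
have -> : m%:R * (rn (clog (gamma t) - t *: Z) * rn (adm g)) =
    m%:R * rn (adm g) * rn (clog (gamma t) - t *: Z) by ring.
apply: (@le_trans _ _ (k * rn (clog (gamma t) - t *: Z))).
  by rewrite ler_wpM2r ?rn_ge0// lerDl.
apply: le_trans (ler_wpM2l (ltW k0) A1) _.
by rewrite le_eqVlt; apply/orP; left; apply/eqP; field; rewrite lt0r_neq0.
Qed.

(** Conjugation by [gamma s] keeps the first-order term of the roots [gamma (t / N)], as Ad (gamma
    s) fixes Z; hence the conjugate of [gamma t] has roots that characterize [gamma t]. *)
Lemma gamma_comm (s t : C) : rn s <= rho -> rn t <= rho ->
  commute (gamma s) (gamma t).
Proof.
move=> sr tr; suff E : (gamma s * gamma t * (gamma s)^-1)%g = gamma t.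
  by rewrite /commute -{2}E mulgVK.
apply: gamma_of_roots => // eps e0.
have [e1 Hs] := scale_small e0 (rn_ge0 t).
have [d d0 H] := conj_gamma_near (Ad_gamma_fix sr) e1.
have [N0 _ HN] := eventually_small (rn_ge0 t) d0.
exists N0 => N Nl Np; exists (gamma s * gamma (t / N%:R)%R * (gamma s)^-1)%g.
have := H (t / N%:R) (rn_divn_le Np tr); rewrite rn_divn => /(_ (HN N Nl)) [c h].
split=> //; first by rewrite conjg_pow gamma_root.
apply: le_trans h _; apply: Hs; by rewrite invr_ge0.
Qed.

(** By commutation, the product of [gamma (s / N)] and [gamma (t / N)] is an N-th root of
    [gamma s * gamma t]; its coordinates are (s + t) Z / N up to o(1/N). *)
Lemma gamma_add (s t : C) : rn s <= rho -> rn t <= rho -> rn (s + t) <= rho ->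
  gamma (s + t) = (gamma s * gamma t)%g.
Proof.
move=> sr tr str; apply/esym/gamma_of_roots => // eps e0.
have e2 : 0 < eps / 2 by rewrite divr_gt0.
have [e3 H3] := scale_small e2 (addr_ge0 (rn_ge0 s) (rn_ge0 t)).
set k := rn s + rn t in e3 H3.
have z0 : 0 <= 1 + rn Z by rewrite addr_ge0 ?rn_ge0.
have [e4 H4] := scale_small e3 z0.
have [da da0 H1] := strict_clog G e4.
have [d d0 H] := gder_size e3 da0.
have [N1 _ HN1] := eventually_small (rn_ge0 s) d0.
have [N2 _ HN2] := eventually_small (rn_ge0 t) d0.
exists (maxn N1 N2) => N; rewrite geq_max => /andP[/HN1 A1 /HN2 A2] Np.
exists (gamma (s / N%:R)%R * gamma (t / N%:R)%R)%g.
have sr' := rn_divn_le Np sr; have tr' := rn_divn_le Np tr.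
have [|S1 S2 S3] := H _ sr'; first by rewrite rn_divn.
have [|T1 T2 T3] := H _ tr'; first by rewrite rn_divn.
have [||||c P] := H1 (gamma (s / N%:R)) (gamma (t / N%:R)) 1%g 1%g.
- by split=> //; exact: gdom.
- by split=> //; exact: gdom.
- exact: gball1.
- exact: gball1.
split=> //.
  by rewrite expgMn ?gamma_root//; exact: gamma_comm.
rewrite mulg1 clog1 !subr0 in P.
have E : clog (gamma (s / N%:R)%R * gamma (t / N%:R)%R)%g - ((s + t) / N%:R) *: Z =
   (clog (gamma (s / N%:R)%R * gamma (t / N%:R)%R)%g - clog (gamma (s / N%:R)) - clog (gamma (t / N%:R))) +
   ((clog (gamma (s / N%:R)) - (s / N%:R) *: Z) + (clog (gamma (t / N%:R)) - (t / N%:R) *: Z)).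
  have zmod (V : zmodType) (x a b u v : V) :
      x - (u + v) = (x - a - b) + ((a - u) + (b - v)).
    by rewrite [X in _ = _ + X]addrACA -opprD addrA -[x - a - b]addrA -[- a - b]opprD subrK.
  by rewrite mulrDl scalerDl; exact: zmod.
rewrite E; apply: le_trans (rnD _ _) _; rewrite (splitr eps) mulrDl; apply: lerD.
  apply: le_trans P _.
  have Q : rn (clog (gamma (s / N%:R))) + rn (clog (gamma (t / N%:R))) <= (1 + rn Z) * (k / N%:R).
    apply: le_trans (lerD S2 T2) _; rewrite -mulrDr !rn_divn -mulrDl; exact: lexx.
  apply: le_trans (ler_wpM2l (ltW e4) Q) _.
  have kN : 0 <= k / N%:R by rewrite divr_ge0// addr_ge0 ?rn_ge0.
  apply: le_trans (H4 _ kN) _.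
  by have := H3 (N%:R)^-1; rewrite invr_ge0 => /(_ (ler0n _ _)).
apply: le_trans (rnD _ _) _; apply: le_trans (lerD S1 T1) _.
rewrite -mulrDr !rn_divn -mulrDl.
by have := H3 (N%:R)^-1; rewrite invr_ge0 => /(_ (ler0n _ _)).
Qed.

Lemma gamma_bignum (t : C) : exists2 N, (0 < N)%N & rn (t / N%:R : C) <= rho.
Proof.
have [N N0 HN] := eventually_small (rn_ge0 t) rho_gt0; exists N => //.
by rewrite rn_divn ltW// HN.
Qed.

Let Nf (t : C) : nat := projT1 (cid2 (gamma_bignum t)).

(** Extension to all parameters by powers of small elements; [gamma_extE] removes the dependence on
    the chosen integer by a common refinement. *)
Definition gamma_ext (t : C) : G := (gamma (t / (Nf t)%:R)%R ^+ Nf t)%g.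

Lemma gamma_extE (t : C) N : (0 < N)%N -> rn (t / N%:R : C) <= rho ->
  gamma_ext t = (gamma (t / N%:R)%R ^+ N)%g.
Proof.
move=> N0 tN; rewrite /gamma_ext; have [] := projT2 (cid2 (gamma_bignum t)).
rewrite -/(Nf t); move: (Nf t) => M M0 tM.
rewrite -(gamma_root N0 tM) -(gamma_root M0 tN) -!expgnA mulnC.
by congr (gamma _ ^+ _)%g; rewrite mulrAC.
Qed.

Lemma gamma_ext_small (t : C) : rn t <= rho -> gamma_ext t = gamma t.
Proof.
by move=> tr; rewrite (@gamma_extE t 1)// ?divr1// expg1.
Qed.

Lemma gamma_extD (s t : C) : gamma_ext (s + t) = (gamma_ext s * gamma_ext t)%g.
Proof.
have [N N0 HN] := eventually_small (addr_ge0 (rn_ge0 s) (rn_ge0 t)) rho_gt0.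
have {}HN := HN N (leqnn N); have NR : 0 < N%:R :> R by rewrite ltr0n.
have sN : rn (s / N%:R : C) <= rho.
  rewrite rn_divn; apply/ltW; apply: le_lt_trans HN.
  by rewrite ler_pM2r ?invr_gt0// lerDl rn_ge0.
have tN : rn (t / N%:R : C) <= rho.
  rewrite rn_divn; apply/ltW; apply: le_lt_trans HN.
  by rewrite ler_pM2r ?invr_gt0// lerDr rn_ge0.
have stN : rn ((s + t) / N%:R : C) <= rho.
  rewrite rn_divn; apply/ltW; apply: le_lt_trans HN.
  by rewrite ler_pM2r ?invr_gt0// rnD.
rewrite (gamma_extE N0 sN) (gamma_extE N0 tN) (gamma_extE N0 stN).
rewrite -expgMn; last exact: gamma_comm.
by rewrite mulrDl gamma_add// -mulrDl.
Qed.

Lemma gamma_ext0 : gamma_ext 0 = 1%g.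
Proof.
have := gamma_extD 0 0; rewrite addr0 => /eqP.
by rewrite -[X in X == _]mulg1 => /eqP/mulgI.
Qed.

Lemma gamma_ext_cont : continuous gamma_ext.
Proof.
have c0 : forall P, nbhs (1%g : G) P -> exists2 d : R, 0 < d &
    forall t : C, rn t < d -> P (gamma_ext t).
  move=> P nP.
  have nP1 : nbhs (cinv phi e) P by rewrite cinv_e.
  have [da da0 H1] := proj1 (rn_nbhsP e (P \o cinv phi)) (near_preim (cinv_phi_cont (G := G)) nP1).
  have [d d0 H] := gder_size ltr01 da0.
  exists (Num.min d rho); first by rewrite lt_min d0 rho_gt0.
  move=> t; rewrite lt_min => /andP[td /ltW tr].
  have [_ _ A] := H t tr td.
  have := H1 _ A; rewrite /= chart_mapK; last exact: gdom.
  by rewrite gamma_ext_small.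
move=> s P nP.
have : nbhs (1%g : G) (fun x => P (gamma_ext s * x)%g).
  by apply: (mulgl_cont (g := gamma_ext s)); rewrite mulg1.
move=> /c0[d d0 H]; apply: (proj2 (rn_nbhsP (s : C) (fun t => P (gamma_ext t)))).
exists d => // t /H; by rewrite -gamma_extD addrC subrK.
Qed.

Let scaleZ (t : C) : lie := t *: Z.
Fact scaleZ_linear : linear scaleZ.
Proof. by move=> a x y; rewrite /scaleZ scalerDl scalerA. Qed.
HB.instance Definition _ :=
  GRing.isLinear.Build C C lie *:%R scaleZ scaleZ_linear.

Lemma gamma_ext_one_param : one_param Z gamma_ext.
Proof.
split; [exact: gamma_extD | exact: gamma_ext_cont |].
have D : is_diff (0 : C) (fun t => cmap phi (gamma_ext t)) scaleZ.
  apply: eps_is_diff; first exact: scalel_continuous.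
  move=> eps e0; have epsE : eps = (complex.Re eps)%:C%C by rewrite RRe_real ?gtr0_real.
  have e0' : 0 < complex.Re eps by rewrite -ltcR -epsE.
  have [d d0 H] := gder e0'.
  apply: (proj2 (rn_nbhsP (0 : C) _)); exists (Num.min d rho); first by rewrite lt_min d0 rho_gt0.
  move=> t; rewrite subr0 lt_min => /andP[td /ltW tr].
  rewrite epsE !rnE -rmorphM lecR gamma_ext0 gamma_ext_small//.
  exact: H.
have [D1 D2] := D; apply: DeriveDef; first exact: diff_derivable.
by rewrite deriveE// D2 /scaleZ scale1r.
Qed.

End OneParameter.

(* For [|t|] small, [gamma t] is the limit of the powers [cexp (t Z / N) ^+ N];
   [Z] being fixed by [Ad (gamma s)], these commute, which makes [gamma] additive. *)
Lemma one_param_exists (R : realType) (m : nat) (G : lieGroupType (R[i] : numFieldType) m)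
    (Z : 'rV[R[i] : numFieldType]_m) :
  Z *m adM G Z = 0 -> exists gamma : (R[i] : numFieldType) -> G, one_param Z gamma.
Proof.
move=> Zc; have [da da0 HK] := cexp_ball G; have [db db0 HS] := strict_clog G (ltr01 : 0 < (1 : R)).
have [dc dc0 [B HB]] := adm_local_bound G.
pose d1 := Num.min da (Num.min db dc).
have d10 : 0 < d1 by rewrite !lt_min da0 db0.
have le1 : d1 <= da by rewrite ge_min lexx.
have le2 : d1 <= db by rewrite !ge_min lexx !orbT.
have le3 : d1 <= dc by rewrite !ge_min lexx !orbT.
have cexpK x : rn x < d1 -> cdom chart1 (cexp G x) /\ clog (cexp G x) = x.
  by move=> /lt_le_trans/(_ le1)/HK.
have strict1 : strict_ball G 1 d1 by move=> *; apply: HS; exact: (gballW le2).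
have admB (g : G) : gball d1 g -> rn (adm g) <= B by move=> Hg; apply: HB; exact: (gballW le3).
have [gamma [gP g1]] := local_one_param d10 cexpK strict1 Z.
by eexists; exact: (gamma_ext_one_param d10 cexpK strict1 gP g1 admB Zc).
Qed.

(** * The map into the complexification and its differential *)

Section RealCurves.
Variable R : realType.
Local Notation C := (R[i] : numFieldType).
Local Notation rc := (@real_complex R).

Lemma real_entry m n (M : 'M[R]_(m, n)) i j : `|M i j| <= `|M|.
Proof.
rewrite [leRHS]/Num.norm /= mx_normE -[leLHS]nngE num_le.
exact: (le_bigmax _ (fun ij : 'I_m * 'I_n => `|M ij.1 ij.2|%:nng) (i, j)).
Qed.

Lemma rderiv_near (V : normedModType C) (f g : R -> V) (l : V) (d0 : R) :
  0 < d0 -> (forall t, `|t| < d0 -> f t = g t) -> rderiv f 0 l -> rderiv g 0 l.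
Proof.
move=> d00 fg H eps e0; have [d d1 Hd] := H eps e0.
exists (Num.min d d0); first by rewrite lt_min d1.
move=> t; rewrite lt_min subr0 => /andP[td td0].
by have := Hd t; rewrite subr0 -(fg t td0) -(fg 0) ?normr0//; apply.
Qed.

Lemma diff_line (V W : normedModType R) (f df : V -> W) (x X : V) (eps : R) :
  is_diff x f df -> 0 < eps -> exists2 d : R, 0 < d & forall t : R, `|t| < d ->
    `|f (x + t *: X) - f x - t *: df X| <= eps * `|t|.
Proof.
move=> [D <-] e0; have X1 : 0 < `|X| + 1 by rewrite ltr_wpDl.
have e1 : 0 < eps / (`|X| + 1) by exact: divr_gt0.
have /nbhs_normP[d /= d0 H] := diff_eps D e1.
exists (d / (`|X| + 1)); first exact: divr_gt0.
move=> t td.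
have E : x + t *: X - x = t *: X by rewrite addrC addKr.
have := H (x + t *: X); rewrite /= distrC E linearZ normrZ => P.
apply: le_trans (P _) _.
  rewrite ltr_pdivlMr// in td; apply: le_lt_trans td.
  by rewrite ler_wpM2l// lerDl.
have -> : eps / (`|X| + 1) * (`|t| * `|X|) = eps * `|t| * (`|X| / (`|X| + 1)).
  by field; exact: lt0r_neq0.
apply: ler_piMr; first by rewrite mulr_ge0// ltW.
by rewrite ler_pdivrMr// mul1r lerDl.
Qed.

Lemma line_nbhs (V : normedModType R) (x X : V) (P : set V) : nbhs x P ->
  exists2 d : R, 0 < d & forall t : R, `|t| < d -> P (x + t *: X).
Proof.
move=> /nbhs_normP[d /= d0 H]; have X1 : 0 < `|X| + 1 by rewrite ltr_wpDl.
exists (d / (`|X| + 1)); first exact: divr_gt0.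
move=> t td; apply: H; rewrite /= opprD addNKr normrN normrZ.
rewrite ltr_pdivlMr// in td; apply: le_lt_trans td.
by rewrite ler_wpM2l// lerDl.
Qed.

Lemma ReB_scale (z w : C) (t a b : R) :
  complex.Re (z - w - t%:C%C * Complex a b) = complex.Re z - complex.Re w - t * a.
Proof. by case: z => ? ?; case: w => ? ?; rewrite /real_complex_def /=; simpc. Qed.

Lemma ImB_scale (z w : C) (t a b : R) :
  complex.Im (z - w - t%:C%C * Complex a b) = complex.Im z - complex.Im w - t * b.
Proof. by case: z => ? ?; case: w => ? ?; rewrite /real_complex_def /=; simpc. Qed.

Lemma rderiv_reim n m (f : 'rV[R]_n -> 'rV[C]_m) (dre dim : 'rV[R]_n -> 'rV[R]_m)
    (x X : 'rV[R]_n) :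
  is_diff x (fun v => re_mx (f v)) dre -> is_diff x (fun v => im_mx (f v)) dim ->
  rderiv (fun t : R => f (x + t *: X)) 0 (\row_j Complex (dre X 0 j) (dim X 0 j)).
Proof.
move=> Hre Him eps e0; have e2 : 0 < eps / 2 by rewrite divr_gt0.
have [d1 d10 H1] := diff_line X Hre e2.
have [d2 d20 H2] := diff_line X Him e2.
exists (Num.min d1 d2); first by rewrite lt_min d10.
move=> t; rewrite subr0 lt_min => /andP[/H1 t1 /H2 t2].
apply: rn_mxle => [|i j]; first by rewrite mulr_ge0// ltW.
apply: le_trans (rn_ReIm _) _; rewrite (splitr eps) mulrDl scale0r addr0.
apply: lerD.
  apply: le_trans t1; apply: le_trans (real_entry _ 0 j).
  by rewrite !mxE (ord1 i) ReB_scale.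
by apply: le_trans t2; apply: le_trans (real_entry _ 0 j); rewrite !mxE (ord1 i) ImB_scale.
Qed.

Lemma rderiv_map n p q (f df : 'rV[R]_n -> 'M[R]_(p, q)) (x X : 'rV[R]_n) :
  is_diff x f df ->
  rderiv (fun t : R => map_mx rc (f (x + t *: X)) : 'M[C]_(p, q)) 0 (map_mx rc (df X)).
Proof.
move=> H eps e0; have [d d0 Hd] := diff_line X H e0.
exists d => // t; rewrite subr0 => /Hd P.
apply: rn_mxle => [|i j]; first by rewrite mulr_ge0// ltW.
rewrite scale0r addr0; apply: le_trans P; apply: le_trans (real_entry _ i j).
by rewrite !mxE -!rmorphM -!rmorphB rnR.
Qed.

End RealCurves.

Section Complexification.
Variable R : realType.
Local Notation C := (R[i] : numFieldType).
Local Notation rc := (@real_complex R).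
Variables (n m : nat) (G : lieGroupType R n) (GC : lieGroupType C m) (eta : G -> GC).
Hypothesis eta_hom : rc_hom eta.
Local Notation e := (id_coord G).
Local Notation phi := (@chart1 R n G).
Local Notation psi := (@chart1 C m GC).

Let F (v : 'rV[R]_n) : 'rV[C]_m := cmap psi (eta (cinv phi v)).

Lemma rc_hom1 : eta 1%g = 1%g.
Proof.
have [fM _ _] := eta_hom.
by have := fM 1%g 1%g; rewrite mulg1 => /esym/eqP; rewrite -[X in _ == X]mulg1 => /eqP/mulgI.
Qed.

Lemma rc_homV x : eta x^-1%g = (eta x)^-1%g.
Proof.
have [fM _ _] := eta_hom; apply: (@mulIg _ (eta x)).
by rewrite -fM !mulVg rc_hom1.
Qed.

Lemma rcF_e : F e = id_coord GC.
Proof. by rewrite /F cinv_e rc_hom1. Qed.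

Lemma near_rc_hom : \forall v \near e, cdom psi (eta (cinv phi v)).
Proof.
have [_ fc _] := eta_hom.
apply: (@near_preim _ _ (eta \o cinv phi) e (cdom psi)).
  by apply: continuous_comp; [exact: cinv_phi_cont | exact: fc].
by rewrite /= cinv_e rc_hom1; exact: cdom_nbhs (phi1 GC).
Qed.

Lemma is_diff_rcF : exists dre dim : 'rV[R]_n -> 'rV[R]_m,
  [/\ is_diff e (fun v => re_mx (F v)) dre, is_diff e (fun v => im_mx (F v)) dim,
      linear dre, linear dim &
      forall X, rc_dhom eta X = \row_j Complex (dre X 0 j) (dim X 0 j)].
Proof.
have [_ _ fs] := eta_hom.
have [H1 H2] := fs phi psi (chart1_atlas (s := G)) (chart1_atlas (s := GC)).
have U : cran phi e /\ cdom psi (eta (cinv phi e)).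
  by split; [exact: cran_e | rewrite cinv_e rc_hom1; exact: phi1].
have D1 := H1 [::] e U; have D2 := H2 [::] e U.
exists ('d (fun v => re_mx (F v)) e), ('d (fun v => im_mx (F v)) e); split.
- exact: (differentiableP D1).
- exact: (differentiableP D2).
- exact: linearP.
- exact: linearP.
- by [].
Qed.

Fact rcE_sig : {E : 'M[C]_(n, m) | E = \matrix_i rc_dhom eta (delta_mx 0 i)}.
Proof. by eexists. Qed.
Definition rcE : 'M[C]_(n, m) := sval rcE_sig.

Lemma rc_dhomE X : rc_dhom eta X = map_mx rc X *m rcE.
Proof.
rewrite /rcE (svalP rcE_sig).
have [dre [dim [_ _ L1 L2 E]]] := is_diff_rcF.
have lin (f : 'rV[R]_n -> 'rV[R]_m) : linear f -> forall j, f X 0 j = \sum_k X 0 k * f (delta_mx 0 k) 0 j.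
  move=> L j; pose f' : {linear 'rV[R]_n -> 'rV[R]_m} := HB.pack f (GRing.isLinear.Build _ _ _ _ _ L).
  rewrite -[f]/(f' : _ -> _) {1}(row_sum_delta X) linear_sum summxE.
  by apply: eq_bigr => k _; rewrite linearZ !mxE.
apply/rowP => j; rewrite E !mxE.
rewrite (lin _ L1) (lin _ L2).
have -> : Complex (\sum_k X 0 k * dre (delta_mx 0 k) 0 j) (\sum_k X 0 k * dim (delta_mx 0 k) 0 j)
   = \sum_k Complex (X 0 k * dre (delta_mx 0 k) 0 j) (X 0 k * dim (delta_mx 0 k) 0 j) :> C.
  by elim/big_rec3: _ => // k a b c _ <-.
apply: eq_bigr => k _; rewrite [X in _ = _ * X]mxE E !mxE.
by rewrite /real_complex_def; simpc.
Qed.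

Lemma rderiv_rcF X : rderiv (fun t : R => F (e + t *: X)) 0 (rc_dhom eta X).
Proof.
have [dre [dim [H1 H2 _ _ E]]] := is_diff_rcF.
by rewrite E; exact: rderiv_reim.
Qed.

Lemma rderiv_rcF_comp (f df : 'rV[R]_n -> 'rV[R]_n) X : is_diff e f df -> f e = e ->
  rderiv (fun t : R => F (f (e + t *: X))) 0 (rc_dhom eta (df X)).
Proof.
move=> D fe; have [dre [dim [H1 H2 _ _ E]]] := is_diff_rcF.
have H1' : is_diff (f e) (fun v => re_mx (F v)) dre by rewrite fe.
have H2' : is_diff (f e) (fun v => im_mx (F v)) dim by rewrite fe.
rewrite E; apply: (rderiv_reim X (is_diff_comp D H1') (is_diff_comp D H2')).
Qed.

(** The two sides are differentials over different fields. Both are computed as the velocity of one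
    curve with real parameter, and [rderiv_unique] equates them. *)
Lemma adm_rc g : map_mx rc (adm g) *m rcE = rcE *m adm (eta g).
Proof.
have [fM _ _] := eta_hom.
apply/row_matrixP => i; rewrite !row_mul.
have -> : row i (map_mx rc (adm g)) *m rcE = rc_dhom eta (Ad g (delta_mx 0 i)).
  by rewrite rc_dhomE Ad_adm -rowE map_row.
have -> : row i rcE = rc_dhom eta (delta_mx 0 i).
  by rewrite rc_dhomE map_delta_mx -rowE.
rewrite -Ad_adm; set X := delta_mx 0 i.
have P1 := rderiv_rcF_comp X (is_diff_pconj g) (pconj_e g).
have D : is_diff (F (e + (0 : R) *: X)) (pconj (eta g)) (Ad (eta g)).
  by rewrite scale0r addr0 rcF_e; exact: is_diff_pconj.
have P2 := rderiv_comp (rderiv_rcF X) D.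
have H : \forall v \near e, F (pconj g v) = pconj (eta g) (F v).
  have H1 := pconj_dom g; have H2 := near_rc_hom; near=> v.
  rewrite /F /pconj chart_mapK; last by near: v.
  by rewrite chart_mapK ?fM ?rc_homV//; near: v.
have [d d0 Hd] := line_nbhs X H.
exact: (rderiv_unique (rderiv_near d0 Hd P1) P2).
Unshelve. all: by end_near. Qed.

Lemma adM_rc X : map_mx rc (adM G X) *m rcE = rcE *m adM GC (rc_dhom eta X).
Proof.
have P1 := rderiv_comp (rderiv_map X (is_diff_Adm G)) (is_diff_mulmxr rcE (is_diff_id _)).
have D : is_diff (F (e + (0 : R) *: X)) (fun v => rcE *m Adm GC v) (fun u => rcE *m adM GC u).
  by rewrite scale0r addr0 rcF_e; exact: (is_diff_mulmxl rcE (is_diff_Adm GC)).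
have P2 := rderiv_comp (rderiv_rcF X) D.
have H : \forall v \near e, map_mx rc (Adm G v) *m rcE = rcE *m Adm GC (F v).
  have H2 := near_rc_hom; near=> v.
  by rewrite /Adm /F chart_mapK ?adm_rc//; near: v.
have [d d0 Hd] := line_nbhs X H.
exact: (rderiv_unique (rderiv_near d0 Hd P1) P2).
Unshelve. all: by end_near. Qed.

Lemma dmx_rc (tau : G -> G) (tauC : GC -> GC) : lie_hom tau -> lie_hom tauC ->
  (forall x, tauC (eta x) = eta (tau x)) ->
  map_mx rc (dmx tau) *m rcE = rcE *m dmx tauC.
Proof.
move=> Ht HtC E.
apply/row_matrixP => i; rewrite !row_mul.
have -> : row i (map_mx rc (dmx tau)) *m rcE = rc_dhom eta (dhom tau (delta_mx 0 i)).
  by rewrite rc_dhomE dhom_dmx -rowE map_row.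
have -> : row i rcE = rc_dhom eta (delta_mx 0 i).
  by rewrite rc_dhomE map_delta_mx -rowE.
rewrite -dhom_dmx; set X := delta_mx 0 i.
have P1 := rderiv_rcF_comp X (is_diff_hatf Ht) (hatf_e Ht).
have D : is_diff (F (e + (0 : R) *: X)) (hatf tauC) (dhom tauC).
  by rewrite scale0r addr0 rcF_e; exact: is_diff_hatf.
have P2 := rderiv_comp (rderiv_rcF X) D.
have H : \forall v \near e, F (hatf tau v) = hatf tauC (F v).
  have H1 := near_hom Ht; have H2 := near_rc_hom; near=> v.
  rewrite /F /hatf chart_mapK; last by near: v.
  by rewrite chart_mapK ?E//; near: v.
have [d d0 Hd] := line_nbhs X H.
exact: (rderiv_unique (rderiv_near d0 Hd P1) P2).
Unshelve. all: by end_near. Qed.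

(** Existence of the decompositions X + iY makes the rows of [rcE] span; uniqueness for the vector 0
    makes its kernel trivial. *)
Lemma complexification_split : lie_complexification eta ->
  exists E' : 'M[C]_(m, n), rcE *m E' = 1%:M /\ E' *m rcE = 1%:M.
Proof.
move=> H.
have ui X Y : rc_dhom eta X + 'i%C *: rc_dhom eta Y = (map_mx rc X + 'i%C *: map_mx rc Y) *m rcE.
  by rewrite !rc_dhomE mulmxDl -scalemxAl.
have /choice[u Hu] : forall j : 'I_m, exists u : 'rV[C]_n, u *m rcE = delta_mx 0 j.
  move=> j; have [[X Y] [/= E _]] := H (delta_mx 0 j).
  by exists (map_mx rc X + 'i%C *: map_mx rc Y); rewrite -ui -E.
pose E' : 'M[C]_(m, n) := \matrix_j u j.
have E1 : E' *m rcE = 1%:M.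
  by apply/row_matrixP => j; rewrite row_mul rowK Hu rowE mulmx1.
exists E'; split=> //.
apply/eqP; rewrite -subr_eq0; apply/eqP; apply/row_matrixP => i; rewrite row0.
set w := row i _.
have w0 : w *m rcE = 0.
  by rewrite /w -row_mul mulmxBl -mulmxA E1 mulmx1 mul1mx subrr row0.
have [XY [_ U]] := H 0.
have wE : w = map_mx rc (re_mx w) + 'i%C *: map_mx rc (im_mx w).
  by apply/rowP => j; rewrite !mxE [LHS]complexE.
have A : XY = (re_mx w, im_mx w) by apply: U; rewrite /= ui -wE w0.
have B : XY = (0, 0) by apply: U; rewrite /= ui !map_mx0 scaler0 addr0 mul0mx.
move: A; rewrite B => -[R0 I0].
by rewrite wE -R0 -I0 !map_mx0 scaler0 addr0.
Qed.

End Complexification.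

Local Open Scope sesquilinear_scope.

(** * Hermitian matrices and positive square roots *)

Section Hermitian.
Variable C : numClosedFieldType.

Lemma ctM m n p (A : 'M[C]_(m, n)) (B : 'M[C]_(n, p)) :
  (A *m B)^t* = B^t* *m A^t*.
Proof. by rewrite trmx_mul map_mxM. Qed.

Lemma ctD m n (A B : 'M[C]_(m, n)) : (A + B)^t* = A^t* + B^t*.
Proof. by rewrite linearD map_mxD. Qed.

Lemma ctB m n (A B : 'M[C]_(m, n)) : (A - B)^t* = A^t* - B^t*.
Proof. by rewrite linearB map_mxB. Qed.

Lemma ct1 n : (1%:M : 'M[C]_n)^t* = 1%:M.
Proof. by rewrite trmx1 map_mx1. Qed.

Lemma ctE m n (A : 'M[C]_(m, n)) i j : A^t* i j = (A j i)^*.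
Proof. by rewrite !mxE. Qed.

Definition qf n (M : 'M[C]_n) (u : 'rV[C]_n) : C := (u *m M *m u^t*) 0 0.

Lemma qfD n (M N : 'M[C]_n) u : qf (M + N) u = qf M u + qf N u.
Proof. by rewrite /qf mulmxDr mulmxDl mxE. Qed.

Lemma qfB n (M N : 'M[C]_n) u : qf (M - N) u = qf M u - qf N u.
Proof. by rewrite /qf mulmxBr mulmxBl mxE [X in _ + X]mxE. Qed.

Lemma qf_conj n (M B : 'M[C]_n) u : qf (B *m M *m B^t*) u = qf M (u *m B).
Proof. by rewrite /qf ctM !mulmxA. Qed.

Lemma qf1 n (u : 'rV[C]_n) : qf 1%:M u = \sum_k `|u 0 k| ^+ 2.
Proof.
by rewrite /qf mulmx1 mxE; apply: eq_bigr => k _; rewrite ctE normCK.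
Qed.

Lemma qf1_ge0 n (u : 'rV[C]_n) : 0 <= qf 1%:M u.
Proof. by rewrite qf1; apply: sumr_ge0 => k _; exact: exprn_ge0. Qed.

Lemma qf1_eq0 n (u : 'rV[C]_n) : qf 1%:M u = 0 -> u = 0.
Proof.
move=> /eqP; rewrite qf1 psumr_eq0 => [/allP H|k _]; last exact: exprn_ge0.
apply/rowP => k; have := H k (mem_index_enum k); rewrite /= expf_eq0 /= normr_eq0.
by move=> /eqP ->; rewrite mxE.
Qed.

Lemma adj_mul_eq0 n (E : 'M[C]_n) : E *m E^t* = 0 -> E = 0.
Proof.
move=> H; apply/row_matrixP => i; rewrite row0 rowE; apply: qf1_eq0.
by rewrite -qf_conj mulmx1 H /qf mulmx0 mul0mx mxE.
Qed.

Lemma herm_spectral n (A : 'M[C]_n) : A^t* = A -> exists (U : 'M[C]_n) (d : 'rV[C]_n),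
  [/\ U *m U^t* = 1%:M, U^t* *m U = 1%:M, A = U^t* *m diag_mx d *m U &
      forall k, d 0 k \is Num.real].
Proof.
move=> hA.
have herm : A \is hermsymmx by apply/is_hermitianmxP; rewrite expr0 scale1r hA.
have nA : A \is normalmx by exact: hermitian_normalmx.
have := orthomx_spectralP nA; have U := spectral_unitarymx A.
set S := spectralmx A in U *; rewrite invmx_unitary// => E.
exists S, (spectral_diag A); split=> //.
- exact/unitarymxP.
- by apply: mulmx1C; exact/unitarymxP.
- move=> k; have /mxOverP := hermitian_spectral_diag_real herm; exact.
Qed.

Lemma qf_spectral n (U : 'M[C]_n) (d : 'rV[C]_n) u :
  qf (U^t* *m diag_mx d *m U) u = \sum_k d 0 k * `|(u *m U^t*) 0 k| ^+ 2.
Proof.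
have -> : U^t* *m diag_mx d *m U = U^t* *m diag_mx d *m (U^t*)^t* by rewrite trmxCK.
rewrite qf_conj /qf mul_mx_diag mxE; apply: eq_bigr => k _.
by rewrite mxE ctE mulrAC -normCK mulrC.
Qed.

Lemma spectral_qf n (U : 'M[C]_n) (d : 'rV[C]_n) k : U *m U^t* = 1%:M ->
  qf (U^t* *m diag_mx d *m U) (row k U) = d 0 k.
Proof.
move=> UU; rewrite qf_spectral -row_mul UU (bigD1 k)//= !mxE eqxx normr1 expr1n mulr1.
rewrite big1 ?addr0// => j jk; rewrite !mxE eq_sym (negPf jk) normr0 expr0n mulr0//.
Qed.

(* [f] will be the adjoint representation: the square root of an automorphism is
   again one, because on eigenvectors this is a statement on eigenvalues. *)
Lemma herm_sqrt n (A : 'M[C]_n) : A \in unitmx -> exists M : 'M[C]_n,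
  [/\ M^t* = M, M *m M = A *m A^t*,
      exists2 c : C, 0 < c & forall u, c * qf 1%:M u <= qf M u &
      forall f : {linear 'rV[C]_n -> 'M[C]_n},
        (forall u, A *m A^t* *m f (u *m (A *m A^t*)) = f u *m (A *m A^t*)) ->
        forall u, M *m f (u *m M) = f u *m M].
Proof.
move=> uA; set Q := A *m A^t*.
have hQ : Q^t* = Q by rewrite /Q ctM trmxCK.
have [U [d [UU UU' QE dR]]] := herm_spectral hQ.
have d0 k : 0 < d 0 k.
  have dE : d 0 k = qf 1%:M (row k U *m A).
    by rewrite -(spectral_qf _ k UU) -QE -qf_conj mulmx1.
  rewrite lt_neqAle dE qf1_ge0 andbT eq_sym; apply/negP => /eqP/qf1_eq0 E.
  have : row k U = 0 by rewrite -[row k U]mulmx1 -(mulmxV uA) mulmxA E mul0mx.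
  move/(congr1 (mulmx^~ (U^t*))); rewrite -row_mul UU mul0mx.
  by move/rowP/(_ k); rewrite !mxE eqxx => /eqP; rewrite oner_eq0.
have [s s0 ss] : exists2 s : 'rV[C]_n, forall k, 0 < s 0 k &
    forall k, s 0 k ^+ 2 = d 0 k.
  by exists (\row_k sqrtC (d 0 k)) => k; rewrite mxE ?sqrtC_gt0 ?sqrtCK.
pose M := U^t* *m diag_mx s *m U.
have conj_diag (x y : 'rV[C]_n) : U^t* *m diag_mx x *m U *m (U^t* *m diag_mx y *m U) =
    U^t* *m (diag_mx x *m diag_mx y) *m U.
  by rewrite !mulmxA -[X in X *m diag_mx y]mulmxA UU mulmx1.
have hM : M^t* = M.
  rewrite /M !ctM trmxCK mulmxA; congr (_ *m _ *m _).
  rewrite tr_diag_mx map_diag_mx; congr diag_mx; apply/rowP => k.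
  by rewrite [LHS]mxE; apply: conj_Creal; rewrite gtr0_real.
have MM : M *m M = Q.
  rewrite conj_diag QE mulmx_diag; congr (_ *m diag_mx _ *m _).
  by apply/rowP => k; rewrite mxE -expr2 ss.
exists M; split=> //.
(* A product of numbers in (0, 1] is at most each factor: one lower bound for all the eigenvalues,
   which also makes sense for n = 0. *)
- pose c := \prod_k (Num.min 1 (s 0 k)).
  have m0 k : 0 < Num.min 1 (s 0 k).
    by rewrite /Order.min; case: ifP.
  have m1 k : Num.min 1 (s 0 k) <= 1.
    rewrite /Order.min; case: ifPn => // h.
    have sR : s 0 k \is Num.real by rewrite gtr0_real.
    by rewrite real_leNgt ?real1.
  have ms k : Num.min 1 (s 0 k) <= s 0 k.
    by rewrite /Order.min; case: ifPn => // h; exact: ltW.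
  have c0 : 0 < c by exact: prodr_gt0.
  have cs k : c <= s 0 k.
    rewrite /c (bigD1 k)//=; apply: le_trans (ms k).
    rewrite ger_pMr//; apply: prodr_ile1 => j _; rewrite m1 andbT.
    exact: ltW.
  exists c => // u.
  have -> : qf 1%:M u = qf 1%:M (u *m U^t*).
    by rewrite -qf_conj mulmx1 trmxCK UU'.
  rewrite qf_spectral qf1 mulr_sumr; apply: ler_sum => k _.
  by rewrite ler_wpM2r// exprn_ge0.
- move=> f Hf u.
  have Hk k : M *m f (row k U *m M) = f (row k U) *m M.
    have Uk (x : 'rV[C]_n) : row k U *m (U^t* *m diag_mx x *m U) = x 0 k *: row k U.
      rewrite !mulmxA -row_mul UU row1 -rowE row_diag_mx -scalemxAl -rowE.
      by [].
    have := Hf (row k U); rewrite /M QE !Uk !linearZ /= -?scalemxAr.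
    set X := f (row k U) => HX.
    have [Y XE] : exists Y, X = U^t* *m Y *m U.
      by exists (U *m X *m U^t*); rewrite !mulmxA UU' mul1mx -mulmxA UU' mulmx1.
    have L1 x : U^t* *m diag_mx x *m U *m X = U^t* *m (diag_mx x *m Y) *m U.
      by rewrite {1}XE !mulmxA -[U^t* *m diag_mx x *m U *m U^t*]mulmxA UU mulmx1.
    have R1 x : X *m (U^t* *m diag_mx x *m U) = U^t* *m (Y *m diag_mx x) *m U.
      by rewrite {1}XE !mulmxA -[U^t* *m Y *m U *m U^t*]mulmxA UU mulmx1.
    have inj (A1 B1 : 'M[C]_n) : U^t* *m A1 *m U = U^t* *m B1 *m U -> A1 = B1.
      move=> /(congr1 (fun M => U *m M *m U^t*)); rewrite !mulmxA UU !mul1mx.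
      by rewrite -!mulmxA UU !mulmx1.
    rewrite L1 R1; rewrite L1 R1 in HX.
    have {}HX : d 0 k *: (diag_mx d *m Y) = Y *m diag_mx d.
      by apply: inj; rewrite -scalemxAr -scalemxAl.
    suff -> : Y *m diag_mx s = s 0 k *: (diag_mx s *m Y) by rewrite -scalemxAr -scalemxAl.
    rewrite mul_mx_diag mul_diag_mx; apply/matrixP => i j.
    move/matrixP/(_ i j): HX; rewrite mul_mx_diag mul_diag_mx 4!mxE => HX.
    rewrite !mxE; have [->|Y0] := eqVneq (Y i j) 0; first by rewrite mul0r !mulr0.
    (* Where [Y i j] is nonzero, [HX] reads d_j = d_k d_i, and positive numbers have unique positive
       square roots. *)
    suff -> : s 0 j = s 0 k * s 0 i by ring.
    apply/eqP; have ki : 0 <= s 0 k * s 0 i by rewrite mulr_ge0 ?ltW.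
    rewrite -(eqrXn2 (ltn0Sn 1) (ltW (s0 j)) ki) exprMn !ss.
    by apply/eqP/(mulIf Y0); rewrite -mulrA HX mulrC.
  have uE : u = \sum_k (u *m U^t*) 0 k *: row k U.
    by rewrite -mulmx_sum_row -mulmxA UU' mulmx1.
  rewrite uE mulmx_suml !linear_sum ?mulmx_sumr mulmx_suml; apply: eq_bigr => k _.
  by rewrite -scalemxAl !linearZ -?scalemxAr -scalemxAl /= Hk.
Qed.

End Hermitian.

(** * Gradings by -1, 0, 1 and determinants of blocks *)

Section Grading.
Variables (K : numFieldType) (n : nat) (L : 'M[K]_n).
Hypothesis LLL : L *m L *m L = L.

(** Lagrange interpolation: since L^3 = L, these polynomials in L are the projections onto its
    eigenspaces for 1 and -1. *)
Definition proj_pos : 'M[K]_n := 2^-1 *: (L *m L + L).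
Definition proj_neg : 'M[K]_n := 2^-1 *: (L *m L - L).

Lemma scale2 (X : 'M[K]_n) : X + X = (2 : K) *: X.
Proof. by rewrite scaler_nat mulr2n. Qed.

Lemma half_double (X : 'M[K]_n) : 2^-1 *: (X + X) = X.
Proof. by rewrite scale2 scalerA mulVf ?pnatr_eq0// scale1r. Qed.

Lemma proj_pos_L : proj_pos *m L = proj_pos.
Proof. by rewrite /proj_pos -scalemxAl mulmxDl LLL addrC. Qed.

Lemma proj_neg_L : proj_neg *m L = - proj_neg.
Proof. by rewrite /proj_neg -scalemxAl mulmxBl LLL -scalerN opprB. Qed.

Lemma L_proj_neg : L *m proj_neg = - proj_neg.
Proof. by rewrite /proj_neg -scalemxAr mulmxBr mulmxA LLL -scalerN opprB. Qed.

Lemma proj_pos_idem : proj_pos *m proj_pos = proj_pos.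
Proof.
rewrite {2}/proj_pos -scalemxAr mulmxDr mulmxA !proj_pos_L.
exact: half_double.
Qed.

Lemma proj_neg_idem : proj_neg *m proj_neg = proj_neg.
Proof.
rewrite {2}/proj_neg -scalemxAr mulmxBr mulmxA proj_neg_L mulNmx proj_neg_L opprK.
exact: half_double.
Qed.

Lemma proj_negB : proj_neg - proj_pos = - L.
Proof.
rewrite /proj_neg /proj_pos -scalerBr opprD addrACA subrr add0r -opprD scalerN.
by rewrite half_double.
Qed.

Lemma proj_pos_comm (T : 'M[K]_n) : T *m L = L *m T -> T *m proj_pos = proj_pos *m T.
Proof.
move=> H; rewrite /proj_pos -scalemxAr -scalemxAl mulmxDr mulmxDl H; congr (_ *: (_ + _)).
by rewrite mulmxA H -[L *m T *m L]mulmxA H mulmxA.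
Qed.

Lemma proj_neg_comm (T : 'M[K]_n) : T *m L = L *m T -> T *m proj_neg = proj_neg *m T.
Proof.
move=> H; rewrite /proj_neg -scalemxAr -scalemxAl mulmxBr mulmxBl H; congr (_ *: (_ - _)).
by rewrite mulmxA H -[L *m T *m L]mulmxA H mulmxA.
Qed.

Lemma comm_blocks (T : 'M[K]_n) : T *m L = L *m T ->
  (1%:M - proj_neg) *m T *m proj_neg = 0 /\ proj_pos *m T *m (1%:M - proj_pos) = 0.
Proof.
move=> TL; split.
  rewrite -mulmxA proj_neg_comm// mulmxA mulmxBl mul1mx proj_neg_idem subrr.
  exact: mul0mx.
rewrite -[proj_pos *m T]proj_pos_comm// -mulmxA mulmxBr mulmx1 proj_pos_idem subrr.
exact: mulmx0.
Qed.

(** T shifts the eigenvalues of L by 1, so its products with the extreme projections would belong to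
    the eigenvalues 2 and -2. *)
Lemma raising_blocks (T : 'M[K]_n) : T *m L - L *m T = T ->
  (1%:M - proj_neg) *m T *m proj_neg = 0 /\ proj_pos *m T *m (1%:M - proj_pos) = 0.
Proof.
move=> TL; have LT : L *m T = T *m L - T by rewrite -{3}TL opprB addrC subrK.
(* An eigenvalue 2 or -2 together with L^3 = L gives 8 X = 2 X. *)
have six (X : 'M[K]_n) : 6%:R *: X = 0 -> X = 0.
  by move=> /eqP; rewrite scaler_eq0 pnatr_eq0 => /eqP.
have TN : T *m proj_neg = 0.
  have E1 : L *m (T *m proj_neg) = - 2 *: (T *m proj_neg).
    rewrite mulmxA LT mulmxBl -mulmxA L_proj_neg mulmxN -opprD scale2.
    by rewrite scaleNr.
  have E3 : L *m L *m L *m (T *m proj_neg) = (- 2) ^+ 3 *: (T *m proj_neg).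
    move: (T *m proj_neg) E1 => X E1.
    by rewrite -!mulmxA !(E1, =^~ scalemxAr) !scalerA !exprS expr0 mulr1 mulrA.
  apply: six; move: E3; rewrite LLL E1 => /eqP; rewrite -subr_eq0 -scalerBl => /eqP <-.
  by congr (_ *: _); ring.
have PT : proj_pos *m T = 0.
  have E1 : proj_pos *m T *m L = 2 *: (proj_pos *m T).
    have -> : proj_pos *m T *m L = proj_pos *m (L *m T + T) by rewrite LT subrK mulmxA.
    by rewrite mulmxDr mulmxA proj_pos_L scale2.
  have E3 : proj_pos *m T *m (L *m L *m L) = 2 ^+ 3 *: (proj_pos *m T).
    move: (proj_pos *m T) E1 => X E1.
    by rewrite !mulmxA !(E1, =^~ scalemxAl) !scalerA !exprS expr0 mulr1 mulrA.
  apply: six; move: E3; rewrite LLL E1 => /eqP; rewrite eq_sym -subr_eq0 -scalerBl => /eqP <-.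
  by congr (_ *: _); ring.
by rewrite PT mul0mx -mulmxA TN mulmx0.
Qed.

End Grading.

Section BlockDeterminant.
Variables (K : comNzRingType) (n : nat).
Implicit Types P Q A B T : 'M[K]_n.

(* The determinant of the compression of [T] to the range of the idempotent [P]. *)
Definition pdet P T : K := \det (P *m T *m P + (1%:M - P)).

Lemma compl_idem P : P *m P = P -> [/\ P *m (1%:M - P) = 0, (1%:M - P) *m P = 0
  & (1%:M - P) *m (1%:M - P) = 1%:M - P].
Proof.
move=> PP; have PQ : P *m (1%:M - P) = 0 by rewrite mulmxBr mulmx1 PP subrr.
by split; [|rewrite mulmxBl mul1mx PP subrr|rewrite mulmxBl mul1mx PQ subr0].
Qed.

(** Compressing a product to P loses only the term P A (1 - P) B P, so one vanishing off-diagonal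
    block is enough. *)
Lemma pdetM P A B : P *m P = P ->
  P *m A *m (1%:M - P) = 0 \/ (1%:M - P) *m B *m P = 0 ->
  pdet P (A *m B) = pdet P A * pdet P B.
Proof.
move=> PP H; have [PQ QP QQ] := compl_idem PP.
rewrite /pdet -det_mulmx; congr (\det _).
have AB : P *m A *m (1%:M - P) *m B *m P = 0.
  case: H => [->|H]; first by rewrite !mul0mx.
  by rewrite -!mulmxA [(1%:M - P) *m _]mulmxA H !mulmx0.
have E1 : P *m A *m P *m (P *m B *m P) = P *m (A *m B) *m P.
  have -> : P *m (A *m B) *m P = P *m A *m P *m B *m P + P *m A *m (1%:M - P) *m B *m P.
    by rewrite [P *m A *m (1%:M - P)]mulmxBr mulmx1 !mulmxBl addrC subrK mulmxA.
  by rewrite AB addr0 !mulmxA -[P *m A *m P *m P]mulmxA PP.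
have E2 : P *m A *m P *m (1%:M - P) = 0 by rewrite -mulmxA PQ mulmx0.
have E3 : (1%:M - P) *m (P *m B *m P) = 0 by rewrite !mulmxA QP !mul0mx.
move: (1%:M - P) QQ E2 E3 => Q QQ E2 E3.
by rewrite mulmxDl !mulmxDr QQ E1 E2 E3 addr0 add0r.
Qed.

Lemma pdet1 P : P *m P = P -> pdet P 1%:M = 1.
Proof. by move=> PP; rewrite /pdet mulmx1 PP addrC subrK det1. Qed.

End BlockDeterminant.

Lemma pdet_conj (K : fieldType) n m (P T : 'M[K]_m) (Q : 'M[K]_(n, m)) (Q' : 'M[K]_(m, n)) :
  Q *m Q' = 1%:M -> Q' *m Q = 1%:M -> pdet (Q *m P *m Q') (Q *m T *m Q') = pdet P T.
Proof.
move=> QQ' Q'Q.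
have nm : n = m.
  by apply/eqP; rewrite eqn_leq (mulmx1_min QQ') (mulmx1_min Q'Q).
subst n.
have E X Y : Q *m X *m Q' *m (Q *m Y *m Q') = Q *m (X *m Y) *m Q'.
  by rewrite !mulmxA -[Q *m X *m Q' *m Q]mulmxA Q'Q mulmx1.
rewrite /pdet !E; have -> : 1%:M - Q *m P *m Q' = Q *m (1%:M - P) *m Q'.
  by rewrite mulmxBr mulmx1 mulmxBl QQ'.
by rewrite -mulmxDl -mulmxDr !det_mulmx mulrAC -det_mulmx QQ' det1 mul1r.
Qed.


(** * Polar decomposition of automorphisms *)

Section Polar.
Variable C : numClosedFieldType.
Variable n : nat.
Implicit Types (A B E L M N P Q T W X Y : 'M[C]_n) (u v : 'rV[C]_n).

Lemma qf_ge0_trace N X : (forall u, 0 <= qf N u) -> 0 <= \tr (X *m N *m X^t*).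
Proof.
move=> H; rewrite /mxtrace; apply: sumr_ge0 => i _.
have -> : (X *m N *m X^t*) i i = qf N (row i X); last exact: H.
by rewrite /qf -!row_mul !mxE; apply: eq_bigr => k _; rewrite !mxE.
Qed.

(** With E = M - N, M^2 - N^2 = M E + E N, and the traces of E M E and E N E are bounded below. This
    gives both uniqueness and, quantitatively, continuity of the positive square root. *)
Lemma sqrt_gap M N (c : C) : M^t* = M -> N^t* = N ->
  (forall u, 0 <= qf M u) -> (forall u, c * qf 1%:M u <= qf N u) ->
  c * \tr ((M - N) *m (M - N)^t*) <= \tr ((M - N) *m (M *m M - N *m N)).
Proof.
move=> hM hN pM pN; set E := M - N.
have hE : E^t* = E by rewrite /E ctB hM hN.
have -> : M *m M - N *m N = M *m E + E *m N.
  by rewrite /E mulmxBr mulmxBl addrA subrK.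
clearbody E.
rewrite mulmxDr mxtraceD mulmxA [X in _ + X]mxtrace_mulC.
have H1 := qf_ge0_trace E pM; rewrite hE in H1.
have pN' u : 0 <= qf (N - c%:M) u.
  rewrite qfB subr_ge0; have -> : qf c%:M u = c * qf 1%:M u; last exact: pN.
  by rewrite /qf mulmx1 mul_mx_scalar -scalemxAl mxE.
have := qf_ge0_trace E pN'; rewrite hE mulmxBr mulmxBl raddfB /= subr_ge0.
rewrite mul_mx_scalar -scalemxAl mxtraceZ => H2.
by rewrite -[leLHS]add0r; apply: lerD.
Qed.

Lemma sqrt_unique M N (c : C) : 0 < c -> M^t* = M -> N^t* = N ->
  (forall u, 0 <= qf M u) -> (forall u, c * qf 1%:M u <= qf N u) ->
  M *m M = N *m N -> M = N.
Proof.
move=> c0 hM hN pM pN MN.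
have := sqrt_gap hM hN pM pN; rewrite MN subrr mulmx0 linear0 => H.
have p1 : forall u, 0 <= qf (1%:M : 'M[C]_n) u by exact: qf1_ge0.
have := qf_ge0_trace (M - N) p1; rewrite mulmx1 => H'.
rewrite pmulr_rle0// in H; apply/eqP; rewrite -subr_eq0; apply/eqP.
apply/row_matrixP => i; rewrite row0; apply: qf1_eq0; apply: le_anti.
rewrite qf1_ge0 andbT; apply: le_trans H.
rewrite /mxtrace (bigD1 i)//=.
have E k : ((M - N) *m (M - N)^t*) k k = qf 1%:M (row k (M - N)).
  by rewrite /qf mulmx1 -!row_mul !mxE; apply: eq_bigr => j _; rewrite !mxE.
rewrite E lerDl; apply: sumr_ge0 => k _; rewrite E; exact: qf1_ge0.
Qed.

Variable f : {linear 'rV[C]_n -> 'M[C]_n}.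

(* [A] is an automorphism of the Lie algebra with adjoint representation [f]. *)
Definition isaut A := forall u, A *m f (u *m A) = f u *m A.

Lemma isaut_mul A B : isaut A -> isaut B -> isaut (A *m B).
Proof. by move=> hA hB u; rewrite !mulmxA -mulmxA hB mulmxA hA. Qed.

Lemma isaut_inv A B : A *m B = 1%:M -> isaut A -> isaut B.
Proof.
move=> AB hA u; have BA := mulmx1C AB.
have := hA (u *m B); rewrite -mulmxA BA mulmx1 => H.
by rewrite -[f (u *m B)]mulmx1 -AB mulmxA mulmxA -[B *m _ *m A]mulmxA -H !mulmxA BA mul1mx.
Qed.

(** [Th] and [L] stand for theta and ad Z0, and [f] for the adjoint representation, in coordinates
    orthonormal for the Cartan inner product, where [Th] and [L] are Hermitian. *)
Variables (Th L : 'M[C]_n) (z0 : 'rV[C]_n).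
Hypothesis ThH : Th^t* = Th.
Hypothesis Th2 : Th *m Th = 1%:M.
Hypothesis Tha : isaut Th.
Hypothesis LH : L^t* = L.
Hypothesis ThL : Th = 1%:M - 2 *: (L *m L).
Hypothesis fz0 : f z0 = L.
Hypothesis z0L : z0 *m L = 0.
Hypothesis fjac : forall u v, f (u *m f v) = f u *m f v - f v *m f u.

Lemma L_sqE : L *m L = 2^-1 *: (1%:M - Th).
Proof. by rewrite ThL opprB addrC subrK scalerA mulVf ?pnatr_eq0// scale1r. Qed.

Lemma L_sq_idem : L *m L *m (L *m L) = L *m L.
Proof.
have XX : (1%:M - Th) *m (1%:M - Th) = 2 *: (1%:M - Th).
  by rewrite mulmxBl mul1mx mulmxBr Th2 mulmx1 opprB scaler_nat mulr2n.
rewrite L_sqE -scalemxAl -scalemxAr XX !scalerA; congr (_ *: _).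
by field.
Qed.

(** L^3 - L is Hermitian, and its square vanishes because L^2 is idempotent. *)
Lemma L_cube : L *m L *m L = L.
Proof.
apply/eqP; rewrite -subr_eq0; apply/eqP/adj_mul_eq0.
rewrite ctB !ctM LH mulmxBl !mulmxBr !mulmxA.
have L4 : L *m L *m L *m L = L *m L by rewrite -[RHS]L_sq_idem mulmxA.
by rewrite !L4 !subrr.
Qed.

Lemma z0Th : z0 *m Th = z0.
Proof. by rewrite ThL mulmxBr mulmx1 -scalemxAr mulmxA z0L mul0mx scaler0 subr0. Qed.

Section PolarDecomposition.
Variables A M : 'M[C]_n.
Hypothesis uA : A \in unitmx.
Hypothesis ATh : A *m Th *m A^t* = Th.
Hypothesis Aa : isaut A.
Hypothesis MH : M^t* = M.
Hypothesis MM : M *m M = A *m A^t*.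
Hypothesis Mpos : exists2 c : C, 0 < c & forall u, c * qf 1%:M u <= qf M u.
Hypothesis Maut : isaut (A *m A^t*) -> isaut M.

Let N : 'M[C]_n := Th *m M *m Th.
Definition polarU : 'M[C]_n := N *m A.

Lemma invA_adj : A *m (Th *m A^t* *m Th) = 1%:M.
Proof. by rewrite !mulmxA ATh Th2. Qed.

Lemma adj_invA : (Th *m A^t* *m Th) *m A = 1%:M.
Proof. exact: mulmx1C invA_adj. Qed.

Lemma adjA_aut : isaut (A^t*).
Proof.
have h := isaut_inv invA_adj Aa.
have -> : A^t* = Th *m (Th *m A^t* *m Th) *m Th.
  by rewrite !mulmxA Th2 mul1mx -mulmxA Th2 mulmx1.
by apply: isaut_mul Tha; apply: isaut_mul h.
Qed.

Lemma polarM_aut : isaut M.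
Proof. by apply: Maut; exact: isaut_mul adjA_aut. Qed.

Lemma Mpsd u : 0 <= qf M u.
Proof.
have [c c0 H] := Mpos; apply: le_trans (H u).
by rewrite mulr_ge0 ?qf1_ge0// ltW.
Qed.

Lemma polar_ThM : M *m N = 1%:M.
Proof.
have uM : M \in unitmx.
  have : M *m M \in unitmx by rewrite MM unitmx_mul uA/= map_unitmx unitmx_tr.
  by rewrite unitmx_mul => /andP[].
have [c c0 H] := Mpos.
have iH : (invmx M)^t* = invmx M.
  by rewrite trmx_inv map_invmx MH.
suff -> : N = invmx M by rewrite mulmxV.
apply/esym; apply: (sqrt_unique c0) => //.
- by rewrite /N !ctM ThH MH mulmxA.
- move=> u; have -> : invmx M = invmx M *m M *m (invmx M)^t*.
    by rewrite iH -mulmxA mulmxV// mulmx1.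
  by rewrite qf_conj; exact: Mpsd.
- move=> u; rewrite /N -{2}ThH qf_conj; apply: le_trans (H _).
  by rewrite -qf_conj mulmx1 ThH Th2.
- have E1 : N *m N = Th *m (M *m M) *m Th.
    by rewrite /N !mulmxA -[Th *m M *m Th *m Th]mulmxA Th2 mulmx1.
  have E2 : M *m M *m (N *m N) = 1%:M.
    rewrite E1 MM.
    have -> : A *m A^t* *m (Th *m (A *m A^t*) *m Th) =
       A *m Th *m ((Th *m A^t* *m Th) *m A) *m A^t* *m Th.
      by rewrite !mulmxA -[A *m Th *m Th]mulmxA Th2 mulmx1.
    by rewrite adj_invA mulmx1 ATh Th2.
  have := congr1 (mulmx (invmx M *m invmx M)) E2.
  by rewrite mulmx1 !mulmxA mulmxKV// mulVmx// mul1mx.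
Qed.

Lemma polar_NM : N *m M = 1%:M. Proof. exact: mulmx1C polar_ThM. Qed.

Lemma polarE : A = M *m polarU.
Proof. by rewrite /polarU mulmxA polar_ThM mul1mx. Qed.

Lemma polarU_unitary : polarU *m polarU^t* = 1%:M.
Proof.
have NH : N^t* = N by rewrite /N !ctM ThH MH mulmxA.
have E : polarU *m A^t* = M by rewrite /polarU -mulmxA -MM mulmxA polar_NM mul1mx.
by rewrite {2}/polarU ctM NH mulmxA E polar_ThM.
Qed.

(** Th A Th is the inverse of the adjoint of A, and M times that inverse is again the unitary
    factor. *)
Lemma polarU_Th : polarU *m Th = Th *m polarU.
Proof.
have key X : X *m A^t* = 1%:M -> M *m X = polarU.
  move=> XA; have AX := mulmx1C XA.
  have H : M *m X *m A^t* = polarU *m A^t*.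
    by rewrite -mulmxA XA mulmx1 /polarU -mulmxA -MM mulmxA polar_NM mul1mx.
  by rewrite -[M *m X]mulmx1 -AX mulmxA H -mulmxA AX mulmx1.
have E : M *m (Th *m A *m Th) = polarU.
  by apply: key; rewrite -!mulmxA [A *m (Th *m _)]mulmxA ATh Th2.
rewrite -{1}E /polarU /N !mulmxA Th2 mul1mx.
by rewrite -[M *m Th *m A *m Th *m Th]mulmxA Th2 mulmx1.
Qed.

Lemma polarU_aut : isaut polarU.
Proof.
apply: isaut_mul Aa; exact: isaut_inv polar_ThM polarM_aut.
Qed.

Lemma polarUE : polarU = Th *m M *m Th *m A. Proof. by []. Qed.

End PolarDecomposition.

Section Intertwine.
Variable W : 'M[C]_n.
Hypothesis WW : W *m W^t* = 1%:M.
Hypothesis WTh : W *m Th = Th *m W.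
Hypothesis Wa : isaut W.
Let L' := W^t* *m L *m W.

(** [z0 *m W] is fixed by [Th], hence killed by L; by the Jacobi identity its ad, which is the
    rotated L, commutes with L. *)
Lemma rotL_comm : L' *m L = L *m L'.
Proof.
have WW' := mulmx1C WW.
have fW : f (z0 *m W) = L'.
  have := Wa z0; rewrite fz0 => /(congr1 (mulmx (W^t*))).
  by rewrite !mulmxA WW' mul1mx.
have zWL : z0 *m W *m L = 0.
  have H : z0 *m W *m (L *m L) = 0.
    by rewrite L_sqE -scalemxAr mulmxBr mulmx1 -mulmxA WTh mulmxA z0Th subrr scaler0.
  by rewrite -{1}L_cube mulmxA H mul0mx.
have := fjac (z0 *m W) z0; rewrite fz0 zWL linear0 fW => /esym/eqP.
by rewrite subr_eq0 => /eqP.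
Qed.

Lemma rotL_sq : L' *m L' = L *m L.
Proof.
have WW' := mulmx1C WW.
have -> : L' *m L' = W^t* *m (L *m L) *m W.
  by rewrite /L' !mulmxA -[W^t* *m L *m W *m W^t*]mulmxA WW mulmx1.
rewrite L_sqE -scalemxAr -scalemxAl; congr (_ *: _).
by rewrite mulmxBr mulmx1 mulmxBl WW' -mulmxA -WTh mulmxA WW' mul1mx.
Qed.

Lemma rotL_adj : L'^t* = L'.
Proof. by rewrite /L' !ctM trmxCK LH mulmxA. Qed.

End Intertwine.

(** The trace of an orthogonal projection counts its eigenvalues 1. *)
Lemma idem_trace P : P^t* = P -> P *m P = P ->
  exists k : nat, \tr P = k%:R /\ (k = 0%N -> P = 0).
Proof.
move=> PH PP; have [U [d [UU UU' PE _]]] := herm_spectral PH.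
have dd k : d 0 k * d 0 k = d 0 k.
  have : U *m (P *m P) *m U^t* = U *m P *m U^t* by rewrite PP.
  rewrite PE !mulmxA UU mul1mx -[diag_mx d *m U *m U^t*]mulmxA UU mulmx1.
  rewrite -[diag_mx d *m diag_mx d *m U *m U^t*]mulmxA UU mulmx1 mulmx_diag.
  by move/matrixP/(_ k k); rewrite !mxE eqxx !mulr1n.
have d01 k : d 0 k = (d 0 k != 0)%:R.
  have [->|d0] := eqVneq (d 0 k) 0; first by [].
  by apply: (mulIf d0); rewrite dd mul1r.
exists (\sum_k nat_of_bool (d 0%R k != 0%R))%N; split.
  rewrite PE mxtrace_mulC mulmxA UU mul1mx mxtrace_diag natr_sum.
  by apply: eq_bigr => k _; exact: d01.
move=> /eqP; rewrite sum_nat_eq0 => /forallP H.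
have d0 : d = 0.
  apply/rowP => k; have := H k; rewrite /= eqb0 negbK => /eqP ->.
  by rewrite mxE.
by rewrite PE d0 linear0 mulmx0 mul0mx.
Qed.

(** (L - L')/2 is Hermitian and its square is the orthogonal projection (L^2 - L L')/2; [k] is the
    trace of that projection, and if it is 0 then so is the difference. *)
Lemma rot_trace (L' : 'M[C]_n) : L'^t* = L' -> L' *m L = L *m L' ->
  L' *m L' = L *m L -> exists k : nat,
  \tr (L *m L') = \tr (L *m L) - 2 * k%:R /\ (k = 0%N -> L' = L).
Proof.
move=> L'H cL sL.
pose P := 2^-1 *: (L *m L - L *m L'); pose E := 2^-1 *: (L - L').
have c2 : (2^-1 : C)^* = 2^-1 by rewrite fmorphV rmorph_nat.
have EH : E^t* = E by rewrite /E linearZ map_mxZ ctB LH L'H; congr (_ *: _).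
have EE : E *m E = P.
  rewrite /E -scalemxAl -scalemxAr scalerA mulmxBl !mulmxBr cL sL.
  rewrite opprB scale2 scalerA /P.
  by congr (_ *: _); field.
have H1 : L *m L *m (L *m L') = L *m L' by rewrite mulmxA L_cube.
have H2 : L *m L' *m (L *m L) = L *m L'.
  by rewrite -mulmxA [L' *m _]mulmxA cL -mulmxA cL !mulmxA L_cube.
have H3 : L *m L' *m (L *m L') = L *m L.
  by rewrite -mulmxA [L' *m (L *m L')]mulmxA cL -[L *m L' *m L']mulmxA sL mulmxA L_sq_idem.
have PP : P *m P = P.
  rewrite /P -scalemxAl -scalemxAr scalerA mulmxBl !mulmxBr L_sq_idem H1 H2 H3.
  rewrite opprB scale2 scalerA.
  by congr (_ *: _); field.
have PH : P^t* = P by rewrite -EE ctM EH.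
have [k [trk k0]] := idem_trace PH PP; exists k; split.
  have : \tr P = 2^-1 * (\tr (L *m L) - \tr (L *m L')) by rewrite /P mxtraceZ raddfB.
  by rewrite trk => ->; field.
move=> /k0 P0; have : E *m E^t* = 0 by rewrite EH EE.
move/adj_mul_eq0/(congr1 (fun M => 2 *: M)); rewrite /E scalerA mulfV ?pnatr_eq0//.
by rewrite scale1r scaler0 => /eqP; rewrite subr_eq0 => /eqP ->.
Qed.

Section Projector.

Local Notation Pm := (proj_neg L).
Let Pm_idem := proj_neg_idem L_cube.
Let compl_Pm : (1%:M - Pm) *m Pm = 0. Proof. by have [] := compl_idem Pm_idem. Qed.
Let compl_Pm_idem : (1%:M - Pm) *m (1%:M - Pm) = 1%:M - Pm.
Proof. by have [] := compl_idem Pm_idem. Qed.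

Lemma proj_neg_herm : Pm^t* = Pm.
Proof.
have c2 : (2^-1 : C)^* = 2^-1 by rewrite fmorphV rmorph_nat.
by rewrite /proj_neg linearZ map_mxZ ctB ctM LH; congr (_ *: _).
Qed.

Lemma proj_neg_Th : Pm *m Th = - Pm.
Proof.
rewrite ThL mulmxBr mulmx1 -scalemxAr mulmxA (proj_neg_L L_cube) mulNmx (proj_neg_L L_cube) opprK.
by rewrite -scale2 opprD addrA subrr sub0r.
Qed.

Lemma qf_block M u : M^t* = M ->
  qf (Pm *m M *m Pm + (1%:M - Pm)) u = qf M (u *m Pm) + qf 1%:M (u *m (1%:M - Pm)).
Proof.
move=> MH; rewrite qfD -{2}proj_neg_herm qf_conj; congr (_ + _).
have cH : (1%:M - Pm)^t* = 1%:M - Pm by rewrite ctB ct1 proj_neg_herm.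
by rewrite -[in LHS]compl_Pm_idem -{2}cH -[X in X *m _]mulmx1 qf_conj.
Qed.

(** For v in the range of [Pm], [Th] sends v to -v, so M and its inverse N have the same value at v.
    As (M - 1) N (M - 1) = M + N - 2 is positive semidefinite, this value is at least |v|^2, and all
    eigenvalues of the completed block are at least 1. *)
Lemma block_det_ge1 M : M^t* = M -> (forall u, 0 <= qf M u) ->
  M *m (Th *m M *m Th) = 1%:M -> 1 <= pdet Pm M.
Proof.
move=> MH Mp MN.
have Mge1 u : qf 1%:M (u *m Pm) <= qf M (u *m Pm).
  pose v := u *m Pm.
  have vTh : v *m Th = - v by rewrite /v -mulmxA proj_neg_Th mulmxN.
  have E1 : qf (Th *m M *m Th) v = qf M v.
    rewrite -{2}ThH qf_conj vTh /qf mulNmx linearN map_mxN mulmxN mulNmx opprK//.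
  pose N := Th *m M *m Th; have NM := mulmx1C MN.
  have H : 0 <= qf ((M - 1%:M) *m N *m (M - 1%:M)^t*) v.
    rewrite qf_conj /N -{2}ThH qf_conj; exact: Mp.
  have E2 : (M - 1%:M) *m N *m (M - 1%:M)^t* = M + N - 1%:M - 1%:M.
    rewrite ctB ct1 MH mulmxBl mul1mx MN mulmxBl mul1mx mulmxBr mulmx1 NM.
    by rewrite opprB addrACA addrA.
  move: H; rewrite E2 !qfB qfD E1 -/v => H.
  have {}H : 0 <= 2 * (qf M v - qf 1%:M v) by rewrite (_ : 2 * _ = qf M v + qf M v - qf 1%:M v - qf 1%:M v)//; ring.
  by rewrite -subr_ge0; rewrite pmulr_rge0 in H.
pose B := Pm *m M *m Pm + (1%:M - Pm).
have BH : B^t* = B by rewrite /B ctD ctB ct1 !ctM proj_neg_herm MH mulmxA.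
have [U [d [UU UU' BE dR]]] := herm_spectral BH.
have d1 k : 1 <= d 0 k.
  rewrite -(spectral_qf d k UU) -BE /B qf_block//.
  set w := row k U.
  have w1 : qf 1%:M w = 1.
    rewrite /qf mulmx1 /w; have -> : 1 = (1%:M : 'M[C]_n) k k by rewrite mxE eqxx.
    by rewrite -UU !mxE; apply: eq_bigr => j _; rewrite !mxE.
  have w2 : qf 1%:M (w *m Pm) + qf 1%:M (w *m (1%:M - Pm)) = 1.
    rewrite -!qf_conj !mulmx1 proj_neg_herm Pm_idem.
    have -> : (1%:M - Pm)^t* = 1%:M - Pm by rewrite ctB ct1 proj_neg_herm.
    by rewrite compl_Pm_idem -qfD addrC subrK.
  by rewrite -[leLHS]w2 lerD2r.
rewrite /pdet -/B BE !det_mulmx mulrAC -det_mulmx UU' det1 mul1r det_diag.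
by elim/big_rec: _ => // k x _ x1; rewrite mulr_ege1.
Qed.

(** W commutes with the spectral projection, so its compression, completed by the identity, is
    unitary. *)
Lemma pdet_unitary W : W *m W^t* = 1%:M -> W *m L = L *m W -> `|pdet Pm W| = 1.
Proof.
move=> WW WL.
have WP : W *m Pm = Pm *m W by exact: proj_neg_comm.
have E : (Pm *m W *m Pm + (1%:M - Pm)) *m (Pm *m W *m Pm + (1%:M - Pm))^t* = 1%:M.
  have -> : Pm *m W *m Pm = Pm *m W by rewrite -mulmxA WP mulmxA Pm_idem.
  have cH : (1%:M - Pm)^t* = 1%:M - Pm by rewrite ctB ct1 proj_neg_herm.
  have fourfold (X Y Q : 'M[C]_n) : (X + Q) *m (Y + Q) = X *m Y + X *m Q + (Q *m Y + Q *m Q).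
    by rewrite mulmxDl !mulmxDr.
  rewrite ctD ctM proj_neg_herm cH fourfold compl_Pm_idem.
  have -> : Pm *m W *m (W^t* *m Pm) = Pm.
    by rewrite mulmxA -[Pm *m W *m W^t*]mulmxA WW mulmx1 Pm_idem.
  have -> : Pm *m W *m (1%:M - Pm) = 0.
    by rewrite mulmxBr mulmx1 -mulmxA WP mulmxA Pm_idem subrr.
  have -> : (1%:M - Pm) *m (W^t* *m Pm) = 0.
    have WP' : W^t* *m Pm = Pm *m W^t*.
      by have := congr1 (fun M => M^t*) WP; rewrite !ctM proj_neg_herm => ->.
    by rewrite WP' mulmxA compl_Pm mul0mx.
  by rewrite addr0 add0r addrC subrK.
have := congr1 determinant E; rewrite det_mulmx det1 det_map_mx det_tr -normCK => /eqP.
by rewrite sqrp_eq1// => /eqP.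
Qed.

End Projector.

End Polar.

(** * Continuity of the polar decomposition and the bound on a connected group *)

Section ContinuousMatrices.
Variable R : realType.
Local Notation C := (R[i] : numFieldType).
Variable T : topologicalType.

Lemma cont_mulmx m n p (A : T -> 'M[C]_(m, n)) (B : T -> 'M[C]_(n, p)) x :
  {for x, continuous A} -> {for x, continuous B} ->
  {for x, continuous (fun y => A y *m B y)}.
Proof.
move=> cA cB.
have D1 : is_diff (A x, B x) (fun q : 'M[C]_(m, n) * 'M[C]_(n, p) => q.1) fst.
  have c1 : continuous (fst : 'M[C]_(m, n) * 'M[C]_(n, p) -> _) by move=> q; exact: cvg_fst.
  by apply: DiffDef; [exact: (linear_differentiable (f := fst)) | exact: (diff_lin (f := fst))].
have D2 : is_diff (A x, B x) (fun q : 'M[C]_(m, n) * 'M[C]_(n, p) => q.2) snd.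
  have c2 : continuous (snd : 'M[C]_(m, n) * 'M[C]_(n, p) -> _) by move=> q; exact: cvg_snd.
  by apply: DiffDef; [exact: (linear_differentiable (f := snd)) | exact: (diff_lin (f := snd))].
have [D _] := is_diff_mulmx D1 D2.
apply: (@continuous_comp _ _ _ (fun y => (A y, B y))
   (fun q : 'M[C]_(m, n) * 'M[C]_(n, p) => q.1 *m q.2)).
  exact: (cvg_pair cA cB).
exact: differentiable_continuous D.
Qed.

Lemma cont_ct m n (A : T -> 'M[C]_(m, n)) x :
  {for x, continuous A} -> {for x, continuous (fun y => (A y)^t*)}.
Proof.
move=> cA.
apply: (@continuous_comp _ _ _ A (fun M : 'M[C]_(m, n) => M^t*)) => // P.
move=> /rn_nbhsP[d d0 H]; apply: (proj2 (rn_nbhsP (A x) (fun M => P (M^t*)))).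
exists d => // y yd; apply: H; apply: le_lt_trans yd.
apply: rn_mxle => [|i j]; first exact: rn_ge0.
rewrite -ctB ctE; apply: le_trans (rn_entry _ j i).
by rewrite /rn norm_conjC.
Qed.

Lemma rn_trace n (M : 'M[C]_n) : rn (\tr M : C) <= n%:R * rn M.
Proof.
apply: le_trans (@rn_sum R C _ _ _) _.
have -> : n%:R * rn M = \sum_(i < n) rn M by rewrite sumr_const card_ord mulr_natl.
by apply: ler_sum => i _; exact: rn_entry.
Qed.

Lemma cont_trace n (A : T -> 'M[C]_n) x :
  {for x, continuous A} -> {for x, continuous (fun y => \tr (A y) : C)}.
Proof.
move=> cA.
have cT : {for A x, continuous (fun M : 'M[C]_n => \tr M : C)}.
  move=> P /rn_nbhsP[d d0 H]; apply: (proj2 (rn_nbhsP (A x) (fun M => P (\tr M)))).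
  have n1 : 0 < n%:R + 1 :> R by rewrite ltr_wpDl.
  exists (d / (n%:R + 1)); first exact: divr_gt0.
  move=> y yd; apply: H; rewrite -raddfB /=; apply: le_lt_trans (rn_trace _) _.
  rewrite ltr_pdivlMr// mulrC in yd; apply: le_lt_trans yd.
  by rewrite ler_wpM2r ?rn_ge0// lerDl.
by move=> P /cT; exact: cA.
Qed.

(** Distinct values of F are at distance at least 2, so [k] is locally constant. *)
Lemma connected_nat_const (F : T -> C) (c : C) (k : T -> nat) :
  connected [set: T] -> continuous F -> (forall x, F x = c - 2 * (k x)%:R) ->
  forall x y, k x = k y.
Proof.
move=> cT cF FE x y.
have loc z : \forall w \near z, k w = k z.
  have N1 : nbhs (F z) (fun w => rn (w - F z : C) < 1).
    by apply: (proj2 (rn_nbhsP (F z : C) (fun w => rn (w - F z : C) < 1))); exists 1.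
  have N2 : \forall w \near z, rn (F w - F z : C) < 1 := cF z _ N1.
  near=> w.
  have H : rn ((2 : C) * ((k z)%:R - (k w)%:R)) < 1.
    rewrite (_ : 2 * _ = F w - F z); first by near: w.
    by rewrite !FE; ring.
  rewrite rnM rn_natr in H.
  apply/eqP; apply/contraT => kwz.
  have : 1 <= rn ((k z)%:R - (k w)%:R : C).
    have [lt|lt|E] := ltngtP (k z) (k w); last by rewrite E eqxx in kwz.
      by rewrite rnB -natrB ?(ltnW lt)// rn_natr (ler_nat _ 1) subn_gt0.
    by rewrite -natrB ?(ltnW lt)// rn_natr (ler_nat _ 1) subn_gt0.
  lra.
have S : [set w | k w = k x] = [set: T].
  apply: cT.
  - by exists x.
  - exists [set w | k w = k x]; last by rewrite setTI.
    rewrite openE => w /= wx; have := loc w; rewrite wx; exact: id.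
  - exists [set w | k w = k x]; last by rewrite setTI.
    rewrite -[X in closed X]setCK; apply: open_closedC.
    rewrite openE => w /= wx; have := loc w; apply: filterS => z /= ->.
    exact: wx.
by have : [set: T] y by []; rewrite -S /= => ->.
Unshelve. all: by end_near. Qed.

(** Each squared entry of M - N is at most the trace on the left of [sqrt_gap], and [rn] is the
    largest entry. The factor n * n comes from bounding the trace of a product by entries. *)
Lemma sqrt_gap_rn n (M N : 'M[C]_n) (c : R) : 0 < c ->
  M^t* = M -> N^t* = N -> (forall u, 0 <= qf M u) ->
  (forall u, c%:C%C * qf 1%:M u <= qf N u) ->
  c * rn (M - N) <= n%:R * n%:R * rn (M *m M - N *m N).
Proof.
move=> c0 hM hN pM pN.
have := sqrt_gap hM hN pM pN.
set E := M - N; set D := M *m M - N *m N => H.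
have tr_ge i j : (rn (E i j : C) ^+ 2)%:C%C <= \tr (E *m E^t*).
  have t k : (E *m E^t*) k k = \sum_l `|E k l| ^+ 2.
    by rewrite mxE; apply: eq_bigr => l _; rewrite ctE normCK.
  rewrite rmorphXn /= -rnE /mxtrace (bigD1 i)//= t (bigD1 j)//= -addrA lerDl.
  apply: addr_ge0; apply: sumr_ge0 => k _; first exact: exprn_ge0.
  by rewrite t; apply: sumr_ge0 => l _; exact: exprn_ge0.
have B : rn (\tr (E *m D) : C) <= n%:R * (n%:R * (rn E * rn D)).
  by apply: le_trans (rn_trace _) _; rewrite ler_wpM2l// rn_mulmx.
have K i j : c * rn (E i j : C) ^+ 2 <= n%:R * n%:R * rn D * rn E.
  rewrite (_ : n%:R * n%:R * rn D * rn E = n%:R * (n%:R * (rn E * rn D))); last by ring.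
  apply: le_trans B.
  have t0 : 0 <= \tr (E *m D).
    apply: le_trans H; apply: mulr_ge0; first by rewrite ler0c; exact: ltW.
    by have := qf_ge0_trace E (@qf1_ge0 _ _); rewrite mulmx1.
  rewrite -lecR -rnE ger0_norm//; apply: le_trans H.
  by rewrite rmorphM /= ler_wpM2l ?tr_ge// ler0c ltW.
have [E0|E0] := leP (rn E) 0.
  rewrite (_ : rn E = 0) ?mulr0; last by apply/le_anti; rewrite E0 rn_ge0.
  by rewrite !mulr_ge0 ?rn_ge0.
suff Q : c * rn E ^+ 2 <= n%:R * n%:R * rn D * rn E.
  by rewrite -(ler_pM2r E0) -[leLHS]mulrA -expr2.
have K0 : 0 <= n%:R * n%:R * rn D * rn E / c.
  by rewrite divr_ge0 ?mulr_ge0 ?rn_ge0// ltW.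
have : rn E <= Num.sqrt (n%:R * n%:R * rn D * rn E / c).
  apply: rn_mxle => [|i j]; first exact: sqrtr_ge0.
  rewrite -[leLHS]ger0_norm ?rn_ge0// -sqrtr_sqr ler_wsqrtr//.
  by rewrite ler_pdivlMr// mulrC.
rewrite -ler_sqr ?nnegrE ?rn_ge0 ?sqrtr_ge0// sqr_sqrtr// ler_pdivlMr// mulrC.
exact: id.
Qed.

End ContinuousMatrices.

Section ConnectedGroup.
Variable R : realType.
Local Notation C := (R[i] : numClosedFieldType).
Variables (T : topologicalType) (n : nat).
Variable f : {linear 'rV[C]_n -> 'M[C]_n}.
Variables (Th L : 'M[C]_n) (z0 : 'rV[C]_n).
Hypothesis ThH : Th^t* = Th.
Hypothesis Th2 : Th *m Th = 1%:M.
Hypothesis Tha : isaut f Th.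
Hypothesis LH : L^t* = L.
Hypothesis ThL : Th = 1%:M - 2 *: (L *m L).
Hypothesis fz0 : f z0 = L.
Hypothesis z0L : z0 *m L = 0.
Hypothesis fjac : forall u v, f (u *m f v) = f u *m f v - f v *m f u.
Variable A : T -> 'M[C]_n.
Hypothesis cT : connected [set: T].
Hypothesis cA : forall x, {for x, continuous (A : T -> 'M[(R[i] : numFieldType)]_n)}.
Hypothesis uA : forall x, A x \in unitmx.
Hypothesis ATh : forall x, A x *m Th *m (A x)^t* = Th.
Hypothesis Aa : forall x, isaut f (A x).
Variable x0 : T.
Hypothesis Ax0 : A x0 = 1%:M.

(* The unitary part [W x] of the polar decomposition of [A x] commutes with [L]:
   [tr (L W^* L W)] is continuous in [x], takes values in [tr (L^2) - 2 nat], and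
   equals [tr (L^2)] only if [W^* L W = L]. *)
Lemma pdet_ge1 x : 1 <= `|pdet (proj_neg L) (A x)|.
Proof.
have /choice[M HM] := fun x => herm_sqrt (uA x).
have MH y : (M y)^t* = M y by have [] := HM y.
have MM y : M y *m M y = A y *m (A y)^t* by have [] := HM y.
have Mpos y : exists2 c : C, 0 < c & forall u, c * qf 1%:M u <= qf (M y) u by have [] := HM y.
have Ma y : isaut f (A y *m (A y)^t*) -> isaut f (M y).
  by have [_ _ _ H] := HM y; exact: H.
have Mp y u : 0 <= qf (M y) u by exact: Mpsd (Mpos y) u.
(* Continuity of the root at y takes the lower bound [c] from [M y] alone; the nearby roots enter as
   positive semidefinite matrices, so no uniform bound is required. *)
have cM y : {for y, continuous (M : T -> 'M[(R[i] : numFieldType)]_n)}.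
  have [c c0 Hc] := Mpos y.
  have cE : c = (complex.Re c)%:C%C by rewrite RRe_real ?gtr0_real.
  set c' := complex.Re c in cE; have c'0 : 0 < c' by rewrite -ltcR -cE.
  have Hc' u : c'%:C%C * qf 1%:M u <= qf (M y) u by rewrite -cE.
  have K0 : 0 < (n%:R * n%:R + 1) :> R by rewrite ltr_wpDl// mulr_ge0.
  move=> P /rn_nbhsP[d d0 H].
  have cQ := @cont_mulmx R T _ _ _ A (fun z => (A z)^t*) y (@cA y) (@cont_ct R T _ _ A y (@cA y)).
  have e0 : 0 < d * c' / (n%:R * n%:R + 1) by rewrite divr_gt0 ?mulr_gt0.
  set e := d * c' / (n%:R * n%:R + 1) in e0.
  have : \forall z \near y, rn (A z *m (A z)^t* - A y *m (A y)^t*) < e.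
    have Nb : nbhs (A y *m (A y)^t*) (fun Q => rn (Q - A y *m (A y)^t*) < e).
      apply: (proj2 (rn_nbhsP (A y *m (A y)^t*) (fun Q => rn (Q - A y *m (A y)^t*) < e))).
      by exists e.
    exact: (cQ _ Nb).
  apply: filterS => z /= Hz; apply: H.
  have := sqrt_gap_rn c'0 (MH z) (MH y) (Mp z) Hc'; rewrite !MM => G.
  rewrite -(ltr_pM2l c'0); apply: le_lt_trans G _.
  rewrite ltr_pdivlMr// in Hz; rewrite (mulrC c').
  apply: le_lt_trans Hz; rewrite mulrC ler_wpM2l ?rn_ge0// lerDl//.
pose W y := polarU Th (A y) (M y).
have WW y : W y *m (W y)^t* = 1%:M.
  exact: (polarU_unitary ThH Th2 (uA y) (ATh y) (MH y) (MM y) (Mpos y)).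
have WTh y : W y *m Th = Th *m W y.
  exact: (polarU_Th ThH Th2 (uA y) (ATh y) (MH y) (MM y) (Mpos y)).
have Wa y : isaut f (W y).
  exact: (polarU_aut ThH Th2 Tha (uA y) (ATh y) (Aa y) (MH y) (MM y) (Mpos y) (Ma y)).
have MN y : M y *m (Th *m M y *m Th) = 1%:M.
  exact: (polar_ThM ThH Th2 (uA y) (ATh y) (MH y) (MM y) (Mpos y)).
have rot y : exists k : nat, \tr (L *m ((W y)^t* *m L *m W y)) = \tr (L *m L) - 2 * k%:R /\
    (k = 0%N -> (W y)^t* *m L *m W y = L).
  apply: (rot_trace Th2 LH ThL).
  - exact: rotL_adj.
  - exact: (rotL_comm Th2 LH ThL fz0 z0L fjac (WW y) (WTh y) (Wa y)).
  - exact: (rotL_sq ThL (WW y) (WTh y)).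
have /choice[k Hk] := rot.
have cW y : {for y, continuous (W : T -> 'M[(R[i] : numFieldType)]_n)}.
  apply: cont_mulmx (@cA y); apply: cont_mulmx; last exact: cst_continuous.
  by apply: cont_mulmx (cM y); exact: cst_continuous.
have kconst : forall y z, k y = k z.
  apply: (@connected_nat_const R T (fun y => \tr (L *m ((W y)^t* *m L *m W y)))
   (\tr (L *m L)) k cT); last by move=> y; exact: (Hk y).1.
  move=> y.
  have c1 := @cont_mulmx R T _ _ _ (fun z => (W z)^t*) (fun=> L) y
    (@cont_ct R T _ _ W y (cW y)) (@cst_continuous T _ L y).
  have c2 := @cont_mulmx R T _ _ _ _ W y c1 (cW y).
  have c3 := @cont_mulmx R T _ _ _ (fun=> L) _ y (@cst_continuous T _ L y) c2.
  exact: (@cont_trace R T n _ y c3).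
have W0 : W x0 = 1%:M.
  have [c c0 Hc] := Mpos x0.
  have M1 : 1%:M = M x0.
    apply: (sqrt_unique c0 (ct1 _ _) (MH x0) (@qf1_ge0 _ _) Hc).
    by rewrite MM Ax0 ct1.
  by rewrite /W polarUE -M1 Ax0 !mulmx1.
have k0 : k x = 0%N.
  rewrite (kconst x x0); have := (Hk x0).1.
  rewrite W0 ct1 mul1mx mulmx1 => /eqP.
  rewrite -subr_eq0 opprB addrC subrK mulf_eq0 !pnatr_eq0 /= => /eqP; exact: id.
have WL : W x *m L = L *m W x.
  have /(congr1 (mulmx (W x))) := (Hk x).2 k0.
  by rewrite !mulmxA WW mul1mx => ->.
have AE : A x = M x *m W x.
  exact: (polarE ThH Th2 (uA x) (ATh x) (MH x) (MM x) (Mpos x)).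
have WP : (1%:M - proj_neg L) *m W x *m proj_neg L = 0.
  have [_ QP _] := compl_idem (proj_neg_idem (L_cube Th2 LH ThL)).
  by rewrite -mulmxA (proj_neg_comm WL) mulmxA QP mul0mx.
rewrite AE (pdetM (proj_neg_idem (L_cube Th2 LH ThL))); last by right.
have := pdet_unitary Th2 LH ThL (WW x) WL.
move: (pdet (proj_neg L) (W x)) => d d1; rewrite normrM d1 mulr1.
have B := block_det_ge1 ThH Th2 LH ThL (MH x) (Mp x) (MN x).
by rewrite ger0_norm// (le_trans ler01 B).
Qed.

End ConnectedGroup.

(** * Determinants of blocks of an exponential *)

Section DetFactorization.
Variables (C : closedFieldType) (n : nat).

Lemma horner_char_poly (M : 'M[C]_n) a : (char_poly M).[a] = \det (a%:M - M).
Proof.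
rewrite -[_.[_]]/(horner_eval a _) -det_map_mx; congr (\det _).
by apply/matrixP => i j; rewrite !mxE /= /horner_eval; case: (i == j); rewrite ?mulr1n ?mulr0n !hornerE.
Qed.

(** For x nonzero the determinant is (-x)^n times the characteristic polynomial at -1/x; [r] lists
    the roots with multiplicity. *)
Lemma det_1D_factor (M : 'M[C]_n) : exists r : seq C,
  \tr M = \sum_(z <- r) z /\ forall x, \det (1%:M + x *: M) = \prod_(z <- r) (1 + x * z).
Proof.
have [r Hr] := closed_field_poly_normal (char_poly M).
rewrite (monicP (char_poly_monic M)) scale1r in Hr.
have sr : size r = n.
  by have := size_char_poly M; rewrite Hr size_prod_XsubC => -[].
exists r; split.
  have [n0|n0] := posnP n.
    have r0 : r = [::] by apply: size0nil; rewrite sr n0.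
    by rewrite r0 big_nil /mxtrace big1// => i _; have := ltn_ord i; rewrite [X in (_ < X)%N]n0.
  apply: oppr_inj; rewrite -char_poly_trace// Hr -sr coefPn_prod_XsubC// sr.
  by rewrite -lt0n.
move=> x; have [->|x0] := eqVneq x 0.
  by rewrite scale0r addr0 det1 big1_seq// => z _; rewrite mul0r addr0.
have -> : 1%:M + x *: M = (- x) *: ((- x^-1)%:M - M).
  by rewrite scalerBr scale_scalar_mx mulrNN mulfV// scaleNr opprK.
have pw (s : seq C) : (- x) ^+ size s = \prod_(z <- s) - x.
  by elim: s => [|z s IH]; rewrite ?big_nil// big_cons exprS IH.
rewrite detZ -horner_char_poly Hr horner_prod -sr pw.
rewrite -big_split /=; apply: eq_bigr => z _.
by rewrite !hornerE mulrDr mulrNN mulfV// mulNr mulrN opprK.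
Qed.

End DetFactorization.

Section PowerLimit.
Variables (R : realType) (n : nat).
Local Notation C := (R[i] : numFieldType).
Implicit Types (M N X Y : 'M[C]_n).

Definition mxpow X k : 'M[C]_n := iter k (mulmx X) 1%:M.

Lemma mxpowSr X k : mxpow X k.+1 = mxpow X k *m X.
Proof.
elim: k => [|k IH]; first by rewrite /mxpow /= mulmx1 mul1mx.
by rewrite -[LHS]/(X *m mxpow X k.+1) {1}IH mulmxA.
Qed.

Lemma rn_id : rn (1%:M : 'M[C]_n) <= 1.
Proof.
apply: rn_mxle => // i j; rewrite mxE; have := rn_natr R (i == j); rewrite /= => ->.
by case: (i == j).
Qed.

(** [rn] is the largest entry and not an operator norm, whence the factor n. *)
Lemma rn_mul_near1 X Y (c : R) : rn (Y - 1%:M) <= c -> rn (X *m Y) <= (1 + n%:R * c) * rn X.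
Proof.
move=> Yc; have -> : X *m Y = X + X *m (Y - 1%:M) by rewrite mulmxBr mulmx1 addrC subrK.
apply: le_trans (rnD _ _) _; rewrite mulrDl mul1r lerD2l.
apply: le_trans (rn_mulmx _ _) _; rewrite -mulrA ler_wpM2l// mulrC ler_wpM2r ?rn_ge0//.
Qed.

Lemma rn_mxpow Y (c : R) k : 0 <= c -> rn (Y - 1%:M) <= c ->
  rn (mxpow Y k) <= (1 + n%:R * c) ^+ k.
Proof.
move=> c0 Yc; elim: k => [|k IH]; first by rewrite expr0; exact: rn_id.
rewrite mxpowSr exprS; apply: le_trans (rn_mul_near1 _ Yc) _.
by rewrite ler_wpM2l// addr_ge0// mulr_ge0.
Qed.

Lemma rn_mxpowB X Y (c : R) k : 0 <= c -> rn (X - 1%:M) <= c -> rn (Y - 1%:M) <= c ->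
  rn (mxpow X k - mxpow Y k) <= k%:R * (1 + n%:R * c) ^+ k * (n%:R * rn (X - Y)).
Proof.
move=> c0 Xc Yc; elim: k => [|k IH]; first by rewrite subrr rn0 !mul0r.
have a1 : 1 <= 1 + n%:R * c by rewrite lerDl mulr_ge0.
have a0 : 0 <= 1 + n%:R * c by exact: le_trans a1.
have -> : mxpow X k.+1 - mxpow Y k.+1 = (mxpow X k - mxpow Y k) *m X + mxpow Y k *m (X - Y).
  by rewrite !mxpowSr mulmxBl mulmxBr addrA subrK.
apply: le_trans (rnD _ _) _.
have r0 : 0 <= n%:R * rn (X - Y) by rewrite mulr_ge0 ?rn_ge0.
have H1 : rn ((mxpow X k - mxpow Y k) *m X) <=
    (1 + n%:R * c) * (k%:R * (1 + n%:R * c) ^+ k * (n%:R * rn (X - Y))).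
  by apply: le_trans (rn_mul_near1 _ Xc) _; rewrite ler_wpM2l.
have H2 : rn (mxpow Y k *m (X - Y)) <= (1 + n%:R * c) ^+ k.+1 * (n%:R * rn (X - Y)).
  apply: le_trans (rn_mulmx _ _) _; rewrite mulrCA ler_wpM2r//.
  apply: le_trans (rn_mxpow _ c0 Yc) _; rewrite exprS; exact: ler_peMl (exprn_ge0 _ a0) a1.
apply: le_trans (lerD H1 H2) _.
rewrite -[in leRHS]natr1 exprS le_eqVlt; apply/orP; left; apply/eqP; ring.
Qed.

Variables (N : 'M[C]_n) (X : C -> 'M[C]_n).
Hypothesis XN : forall e : R, 0 < e -> exists2 d : R, 0 < d &
  forall t : C, rn t < d -> rn (X t - 1%:M - t *: N) <= e * rn t.

(** Both powers approximate the exponential of N: their difference is at most k times the distance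
    of the bases, which is o(1/k), times a factor bounded through exp (n b). *)
Lemma mxpow_limit (e : R) : 0 < e -> exists K : nat, forall k, (K <= k)%N ->
  rn (mxpow (X k.+1%:R^-1) k.+1 - mxpow (1%:M + k.+1%:R^-1 *: N) k.+1) <= e.
Proof.
move=> e0; pose b := rn N + 1.
have b0 : 0 <= b by rewrite addr_ge0 ?rn_ge0.
pose D := expR (n%:R * b) * n%:R + 1.
have D0 : 0 < D by rewrite ltr_wpDl// mulr_ge0// expR_ge0.
have e'0 : 0 < Num.min 1 (e / D) by rewrite lt_min ltr01 divr_gt0.
have [d d0 H] := XN e'0.
have [K HK] : exists K : nat, d^-1 < K%:R.
  by exists (Num.bound d^-1); apply: archi_boundP; rewrite invr_ge0 ltW.
exists K => k Kk; set j := k.+1.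
have j0 : 0 < j%:R :> R by rewrite ltr0n.
have rj : rn (j%:R^-1 : C) = j%:R^-1 by rewrite rnV rn_natr.
have jd : rn (j%:R^-1 : C) < d.
  rewrite rj -[ltRHS]invrK ltf_pV2 ?posrE ?invr_gt0//; apply: lt_le_trans HK _.
  by rewrite ler_nat /j leqW.
have {}H := H _ jd; rewrite rj in H.
have m1 : Num.min 1 (e / D) <= 1 by rewrite ge_min lexx.
have m2 : Num.min 1 (e / D) <= e / D by rewrite ge_min lexx orbT.
set T := X _ in H *; set Y := 1%:M + _.
have TY : rn (T - Y) <= Num.min 1 (e / D) * j%:R^-1 by rewrite /Y opprD addrA.
have iV : 0 <= j%:R^-1 :> R by rewrite invr_ge0 ltW.
have Yc : rn (Y - 1%:M) <= b / j%:R.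
  by rewrite /Y addrC addKr rnZ rj mulrC ler_wpM2r// /b lerDl.
have Tc : rn (T - 1%:M) <= b / j%:R.
  apply: le_trans (rn_triB _ Y _) _.
  rewrite /b mulrDl mul1r addrC; apply: lerD.
    by rewrite /Y addrC addKr rnZ rj mulrC.
  by apply: le_trans TY _; rewrite ler_piMl.
have c0 : 0 <= b / j%:R by rewrite divr_ge0// ltW.
apply: le_trans (rn_mxpowB j c0 Tc Yc) _.
have E : (1 + n%:R * (b / j%:R)) ^+ j <= expR (n%:R * b).
  have -> : n%:R * b = j%:R * (n%:R * (b / j%:R)) by field; rewrite pnatr_eq0.
  rewrite expRM_natl; apply: lerXn2r; rewrite ?nnegrE ?expR_ge0 ?expR_ge1Dx//.
  by rewrite addr_ge0// mulr_ge0.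
have -> : j%:R * (1 + n%:R * (b / j%:R)) ^+ j * (n%:R * rn (T - Y)) =
   ((1 + n%:R * (b / j%:R)) ^+ j * n%:R) * (j%:R * rn (T - Y)) by ring.
have H1 : (1 + n%:R * (b / j%:R)) ^+ j * n%:R <= D.
  by apply: le_trans (_ : expR (n%:R * b) * n%:R <= _); [rewrite ler_wpM2r|rewrite lerDl].
have H2 : j%:R * rn (T - Y) <= e / D.
  rewrite mulrC -ler_pdivlMr//; apply: le_trans TY _; exact: ler_wpM2r.
apply: le_trans (ler_pM _ _ H1 H2) _.
- by rewrite mulr_ge0// exprn_ge0// addr_ge0// mulr_ge0.
- by rewrite mulr_ge0 ?rn_ge0.
by rewrite mulrC divfK// gt_eqF.
Qed.

End PowerLimit.

Section ExponentialDeterminant.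
Variables (R : realType) (n : nat).
Local Notation C := (R[i] : numFieldType).

Lemma cvg_rn (u : nat -> C) (l : C) :
  (forall e : R, 0 < e -> exists K : nat, forall k, (K <= k)%N -> rn (u k - l) <= e) ->
  u k @[k --> \oo] --> l.
Proof.
move=> H P /rn_nbhsP[d d0 HP]; have [K HK] := H (d / 2) (divr_gt0 d0 (ltr0Sn R 1)).
exists K => // k /= Kk; apply: HP; apply: le_lt_trans (HK _ Kk) _.
by rewrite ltr_pdivrMr// ltr_pMr// (ltr_nat _ 1).
Qed.

Lemma cvg_det (M : nat -> 'M[C]_n) (L : 'M[C]_n) :
  (forall i j, M k i j @[k --> \oo] --> L i j) -> \det (M k) @[k --> \oo] --> \det L.
Proof.
move=> H; apply: cvg_big => [x|s _]; first exact: add_continuous.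
apply: cvgM; first exact: cvg_cst.
by apply: cvg_big => [x|i _]; [exact: mul_continuous | exact: H].
Qed.

(** |1 + w|^2 = 1 + 2 Re w + |w|^2, and 1 + y is at most exp y. *)
Lemma rn_1D (w : C) : rn (1 + w) <= expR (complex.Re w + rn w ^+ 2 / 2).
Proof.
have sq (z : C) : rn z ^+ 2 = complex.Re z ^+ 2 + complex.Im z ^+ 2.
  rewrite /rn normc_def /= sqr_sqrtr ?addr_ge0 ?sqr_ge0//.
rewrite -(@ler_pXn2r _ 2)// ?nnegrE ?rn_ge0 ?expR_ge0//.
rewrite -expRM_natl; apply: le_trans (expR_ge1Dx _).
by rewrite !sq; case: w => a b /=; rewrite le_eqVlt; apply/orP; left; apply/eqP; field.
Qed.

Lemma rn_prod_1D (x : R) (r : seq C) : rn (\prod_(z <- r) (1 + x%:C%C * z) : C) <=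
  expR (x * complex.Re (\sum_(z <- r) z) + x ^+ 2 * (\sum_(z <- r) rn z ^+ 2 / 2)).
Proof.
elim: r => [|z r IH].
  by rewrite !big_nil /= !mulr0 addr0 expR0; have := rn_natr R 1; rewrite mulr1n => ->.
rewrite !big_cons rnM; apply: le_trans (ler_pM (rn_ge0 _) (rn_ge0 _) (rn_1D _) IH) _.
rewrite -expRD ler_expR rnM rnR raddfD /= exprMn real_normK ?num_real//.
have -> : complex.Re (x%:C%C * z) = x * complex.Re z by case: z => a b /=; rewrite mul0r subr0.
by rewrite le_eqVlt; apply/orP; left; apply/eqP; ring.
Qed.

Lemma cvg_expR_le (u : nat -> C) (l : C) (s S : R) : 0 <= S ->
  u k @[k --> \oo] --> l ->
  (forall k, rn (u k) <= expR (s + k.+1%:R^-1 * S)) -> rn l <= expR s.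
Proof.
move=> S0 cv bound.
rewrite leNgt; apply/negP => lt; set D := rn _ in lt.
have D0 : 0 < D by apply: lt_trans lt; exact: expR_gt0.
have sD : s < ln D by rewrite -ltr_expR lnK.
pose de := (ln D - s) / 2; have de0 : 0 < de by rewrite divr_gt0 ?subr_gt0.
have gap : 0 < D - expR (s + de).
  by rewrite subr_gt0 -[ltRHS](lnK D0) ltr_expR /de; lra.
have N1 : \forall k \near \oo, rn (u k - l) < D - expR (s + de).
  have Nb : nbhs (l) (fun z => rn (z - l : C) < D - expR (s + de)).
    apply: (proj2 (rn_nbhsP l (fun z => rn (z - l : C) < D - expR (s + de)))).
    by exists (D - expR (s + de)).
  exact: (cv _ Nb).
have [K _ HK] := N1.
pose k := (K + Num.bound (S / de))%N.
have kK : (K <= k)%N by rewrite leq_addr.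
have := HK _ kK; rewrite /= rnB => H1.
have := rn_triS (l) (u k); rewrite -/D => H2.
have H3 : expR (s + k.+1%:R^-1 * S) <= expR (s + de).
  rewrite ler_expR lerD2l mulrC ler_pdivrMr// mulrC -ler_pdivrMr//.
  apply: ltW; apply: lt_le_trans (archi_boundP _) _; first by rewrite divr_ge0// ltW.
  by rewrite ler_nat /k leqW// leq_addl.
by have := le_lt_trans H2 (ltr_leD H1 (le_trans (bound k) H3)); rewrite subrK ltxx.
Qed.

(** [X] will be Ad along a one-parameter group, [N] its derivative at 0 and [T] its value at 1; so T
    is the exponential of N. *)
Variables (N : 'M[C]_n) (X : C -> 'M[C]_n) (T : 'M[C]_n).
Hypothesis XN : forall e : R, 0 < e -> exists2 d : R, 0 < d &
  forall t : C, rn t < d -> rn (X t - 1%:M - t *: N) <= e * rn t.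
Hypothesis XT : forall k, mxpow (X k.+1%:R^-1) k.+1 = T.

Let Y k : 'M[C]_n := mxpow (1%:M + k.+1%:R^-1 *: N) k.+1.

Lemma rn_mulmx3 (A B D : 'M[C]_n) : rn (A *m B *m D) <= (n%:R * n%:R * rn A * rn D) * rn B.
Proof.
apply: le_trans (rn_mulmx _ _) _.
have -> : n%:R * n%:R * rn A * rn D * rn B = n%:R * ((n%:R * (rn A * rn B)) * rn D) by ring.
by rewrite ler_wpM2l// ler_wpM2r ?rn_ge0// rn_mulmx.
Qed.

Lemma mxpow_cvg (A B : 'M[C]_n) i j : (A *m Y k *m B) i j @[k --> \oo] --> (A *m T *m B) i j.
Proof.
apply: cvg_rn => e e0; pose c := n%:R * n%:R * rn A * rn B + 1.
have c0 : 0 < c by rewrite ltr_wpDl// !mulr_ge0 ?rn_ge0.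
have [K HK] := mxpow_limit XN (divr_gt0 e0 c0); exists K => k Kk.
have := HK _ Kk; rewrite XT -/(Y k) rnB => H.
have -> : (A *m Y k *m B) i j - (A *m T *m B) i j = (A *m (Y k - T) *m B) i j.
  by rewrite mulmxBr mulmxBl !mxE.
apply: le_trans (rn_entry _ _ _) _; apply: le_trans (rn_mulmx3 _ _ _) _.
have H1 : n%:R * n%:R * rn A * rn B <= c by rewrite lerDl.
apply: le_trans (ler_pM _ (rn_ge0 _) H1 H) _; first by rewrite !mulr_ge0 ?rn_ge0.
by rewrite mulrC divfK// gt_eqF.
Qed.

Lemma mxpow_block_limit (P Q : 'M[C]_n) : P *m P = P -> P *m Q = 0 ->
   P + Q = 1%:M -> P *m N *m Q = 0 -> P *m T *m Q = 0.
Proof.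
move=> PP PQ PQ1 PNQ.
have Yk k : P *m Y k *m Q = 0.
  have PY (x : C) j : P *m mxpow (1%:M + x *: N) j *m Q = 0.
    elim: j => [|j IH]; first by rewrite /mxpow /= mulmx1.
    rewrite mxpowSr mulmxA; move: (P *m mxpow _ j) IH => A AQ.
    have AP : A *m P = A by rewrite -[RHS]mulmx1 -PQ1 mulmxDr AQ addr0.
    rewrite mulmxDr mulmx1 mulmxDl AQ add0r -scalemxAr -scalemxAl.
    have -> : A *m N *m Q = A *m (P *m N *m Q) by rewrite !mulmxA AP.
    by rewrite PNQ mulmx0 scaler0.
  exact: PY.
apply/matrixP => i j; rewrite [RHS]mxE.
have H := @mxpow_cvg P Q i j.
have H0 : (0 : C) @[k --> \oo] --> (P *m T *m Q) i j.
  by move: H; under eq_fun do rewrite Yk mxE.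
by apply: (@cvg_unique _ (norm_hausdorff (V := C)) _ _ _ _ H0 (@cvg_cst _ _ _ _ _)).
Qed.

(** An inequality version of det exp = exp tr for a triangular block. The k-th approximation has as
    determinant the k-th power of the product of the 1 + z/k, z running over the eigenvalues of P N
    P; the quadratic terms of [rn_prod_1D] leave S/k, which tends to 0. *)
Lemma pdet_exp_le (P : 'M[C]_n) : P *m P = P ->
  P *m N *m (1%:M - P) = 0 \/ (1%:M - P) *m N *m P = 0 ->
  rn (pdet P T) <= expR (complex.Re (\tr (P *m N))).
Proof.
move=> PP H; have [PQ QP QQ] := compl_idem PP.
have [r [trr Hr]] := det_1D_factor (P *m N *m P : 'M[R[i]]_n).
have trP : \tr (P *m N) = \sum_(z <- r) z by rewrite -trr [in RHS]mxtrace_mulC mulmxA PP.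
rewrite trP; set s := complex.Re _.
have p1 (x : C) : pdet P (1%:M + x *: N) = \det (1%:M + x *: (P *m N *m P)).
  congr (\det _); rewrite mulmxDr mulmx1 mulmxDl PP -scalemxAr -scalemxAl.
  by rewrite addrAC [P + (_ - _)]addrC subrK.
have pk (x : C) k : pdet P (mxpow (1%:M + x *: N) k) = pdet P (1%:M + x *: N) ^+ k.
  elim: k => [|k IH]; first by rewrite expr0 /mxpow /= pdet1.
  have E (Z Z' : 'M[C]_n) : Z *m Z' = 0 -> Z *m 1%:M *m Z' = 0 by rewrite mulmx1.
  (* The power is unrolled on the side where 1 + x N is the factor whose vanishing block [pdetM]
     asks for. *)
  case: H => H.
    rewrite /mxpow /= pdetM//; first by rewrite -/(mxpow _ k) IH exprS.
    by left; rewrite [P *m (_ + _ *: N)]mulmxDr mulmxDl E// -scalemxAr -scalemxAl H scaler0 addr0.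
  rewrite mxpowSr pdetM//; first by rewrite IH exprSr.
  by right; rewrite [_ *m (_ + _ *: N)]mulmxDr mulmxDl E// -scalemxAr -scalemxAl H scaler0 addr0.
have cv : pdet P (Y k) @[k --> \oo] --> pdet P T.
  apply: cvg_det => i j; rewrite [X in _ --> X]mxE.
  under eq_fun do rewrite mxE.
  by apply: cvgD; [exact: mxpow_cvg | exact: cvg_cst].
pose S := \sum_(z <- r) rn (z : C) ^+ 2 / 2.
have S0 : 0 <= S by apply: sumr_ge0 => z _; rewrite divr_ge0 ?exprn_ge0 ?rn_ge0.
have bound k : rn (pdet P (Y k)) <= expR (s + k.+1%:R^-1 * S).
  have jE : k.+1%:R^-1 = (k.+1%:R^-1 : R)%:C%C :> C by rewrite fmorphV rmorph_nat.
  rewrite /Y pk p1 Hr jE.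
  have -> : s + k.+1%:R^-1 * S = k.+1%:R * (k.+1%:R^-1 * s + k.+1%:R^-1 ^+ 2 * S).
    by rewrite mulrDr expr2 !mulrA mulfV ?pnatr_eq0// !mul1r.
  have rX (z : C) j : rn (z ^+ j) = rn z ^+ j.
    by elim: j => [|j IH]; [have := rn_natr R 1; rewrite mulr1n => ->|rewrite !exprS rnM IH].
  rewrite rX expRM_natl; apply: lerXn2r; rewrite ?nnegrE ?rn_ge0 ?expR_ge0//.
  exact: rn_prod_1D.
exact: (cvg_expR_le S0 cv bound).
Qed.

End ExponentialDeterminant.

(** * Block determinants along one-parameter groups *)

Section OneParameter.
Variables (R : realType) (m : nat).
Local Notation C := (R[i] : numFieldType).
Variable G : lieGroupType C m.
Local Notation phi := (@chart1 C m G).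

Lemma one_param0 (Y : 'rV[C]_m) (gamma : C -> G) : one_param Y gamma -> gamma 0 = 1%g.
Proof.
move=> [gD _ _]; apply: (@mulgI _ (gamma 0)); by rewrite -gD addr0 mulg1.
Qed.

Lemma one_param_is_diff (Y : 'rV[C]_m) (gamma : C -> G) : one_param Y gamma ->
  is_diff (0 : C) (fun t => cmap phi (gamma t)) (fun t => t *: Y).
Proof.
move=> [_ _ [dv vE]].
have df : differentiable (fun t => cmap phi (gamma t)) (0 : C) by apply/derivable1_diffP.
apply: DiffDef => //; apply/funext => t.
by rewrite -[t in LHS]mulr1 -[t * 1]/(t *: 1) linearZ /= -deriveE// vE.
Qed.

Lemma one_param_adm (Y : 'rV[C]_m) (gamma : C -> G) : one_param Y gamma ->
  forall e : R, 0 < e -> exists2 d : R, 0 < d &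
  forall t : C, rn t < d -> rn (adm (gamma t) - 1%:M - t *: adM G Y) <= e * rn t.
Proof.
move=> gY; have g0 := one_param0 gY; have D1 := one_param_is_diff gY; have [gD gc gd] := gY.
have e0 : cmap phi (gamma 0) = id_coord G by rewrite g0.
have D2 : is_diff (cmap phi (gamma 0)) (Adm G) (adM G) by rewrite e0; exact: is_diff_Adm.
have D := is_diff_comp D1 D2.
have ND : \forall t \near (0 : C), cdom phi (gamma t).
  apply: (@near_preim _ _ gamma 0 (cdom phi)); first exact: gc.
  by rewrite g0; apply: cdom_nbhs; exact: chart1_dom.
move=> e e_gt0; have [d d0 H] := rn_diff D e_gt0.
have [d' d'0 H'] := proj1 (rn_nbhsP _ _) ND.
exists (Num.min d d') => [|t]; first by rewrite lt_min d0.
rewrite lt_min => /andP[td td']; have := H t; have := H' t.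
rewrite subr0 => /(_ td') dt /(_ td).
by rewrite /= /Adm e0 cinv_e chart_mapK// adm1 linearZ.
Qed.

Lemma one_param_mxpow (Y : 'rV[C]_m) (gamma : C -> G) : one_param Y gamma ->
  forall k, mxpow (adm (gamma k.+1%:R^-1)) k.+1 = adm (gamma 1).
Proof.
move=> gY k; have g0 := one_param0 gY; have [gD _ _] := gY.
have H (x : C) j : mxpow (adm (gamma x)) j = adm (gamma (j%:R * x)).
  elim: j => [|j IH]; first by rewrite mul0r g0 adm1.
  by rewrite mxpowSr IH -admM -gD -natr1 mulrDl mul1r addrC.
by rewrite H mulfV// pnatr_eq0.
Qed.

Lemma one_paramN (Y : 'rV[C]_m) (gamma : C -> G) : one_param Y gamma ->
  one_param (- Y) (fun t => gamma (- t)).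
Proof.
move=> gY; have D1 := one_param_is_diff gY; have [gD gc _] := gY; split.
- by move=> s t; rewrite opprD gD.
- by move=> t; apply: (@continuous_comp _ _ _ -%R gamma); [exact: opp_continuous | exact: gc].
have N1 : is_diff (0 : C) (fun t : C => - t) (fun t => - t) := is_diffN (is_diff_id (0 : C)).
have {}D1 : is_diff (- 0 : C) (fun t => cmap phi (gamma t)) (fun t => t *: Y) by rewrite oppr0.
have [D2 E2] := is_diff_comp N1 D1; apply: DeriveDef; first exact: diff_derivable.
by rewrite deriveE// E2 /= scaleN1r.
Qed.

Lemma one_paramV (Y : 'rV[C]_m) (gamma : C -> G) : one_param Y gamma ->
  (gamma 1%R)^-1%g = gamma (- 1).
Proof.
move=> gY; have g0 := one_param0 gY; have [gD _ _] := gY.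
by apply: (@mulgI _ (gamma 1)); rewrite mulgV -gD subrr g0.
Qed.

Variables Pm Pp : 'M[C]_m.
Hypothesis PmI : Pm *m Pm = Pm.
Hypothesis PpI : Pp *m Pp = Pp.

(* [Pm] and [Pp] will project onto the eigenspaces of [ad Z0] for -1 and 1. Up to
   the blocks that vanish, the product is [|c_-(Ad x) / c_+(Ad x)|]. *)
Definition block_bound (x : G) (r : R) : Prop :=
  [/\ (1%:M - Pm) *m adm x *m Pm = 0, Pp *m adm (x^-1)%g *m (1%:M - Pp) = 0
    & rn (pdet Pm (adm x)) * rn (pdet Pp (adm (x^-1)%g)) <= r].

Lemma block_bound_mul x y r s : block_bound x r -> block_bound y s ->
  block_bound (x * y)%g (r * s).
Proof.
move=> [x1 x2 x3] [y1 y2 y3].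
have H (P Q A B : 'M[C]_m) : P + Q = 1%:M -> P *m A *m Q = 0 -> P *m B *m Q = 0 ->
    P *m (A *m B) *m Q = 0.
  move=> PQ PA PB; rewrite mulmxA -[P *m A]mulmx1 -PQ mulmxDr PA addr0.
  by rewrite -!mulmxA [P *m (B *m Q)]mulmxA PB !mulmx0.
split.
- by rewrite admM; apply: H => //; rewrite subrK.
- by rewrite invgM admM; apply: H => //; rewrite addrC subrK.
rewrite invgM !admM.
have -> := pdetM PmI (or_intror x1 : Pm *m adm y *m (1%:M - Pm) = 0 \/ _).
have -> := pdetM PpI (or_introl x2 : _ \/ (1%:M - Pp) *m adm (y^-1)%g *m Pp = 0).
move: x3 y3; move: (pdet Pm (adm x)) (pdet Pp (adm (x^-1)%g)) => a d ad.
move: (pdet Pm (adm y)) (pdet Pp (adm (y^-1)%g)) => b c bc.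
rewrite !rnM; have -> : rn b * rn a * (rn d * rn c) = (rn a * rn d) * (rn b * rn c) by ring.
by apply: ler_pM => //; rewrite mulr_ge0 ?rn_ge0.
Qed.

(** The block of Ad (exp Y) contributes tr (Pm ad Y) to the exponent, and that of the inverse, whose
    velocity is -Y, contributes - tr (Pp ad Y). *)
Lemma block_bound_one_param Y gamma s : one_param Y gamma ->
  (1%:M - Pm) *m adM G Y *m Pm = 0 -> Pp *m adM G Y *m (1%:M - Pp) = 0 ->
  complex.Re (\tr ((Pm - Pp) *m adM G Y)) = s -> block_bound (gamma 1) (expR s).
Proof.
move=> gY Ym Yp <-; have gN := one_paramN gY.
have V := one_paramV gY.
have XN := one_param_adm gY; have XT := one_param_mxpow gY.
have XN' := one_param_adm gN; have XT' := one_param_mxpow gN.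
have [c1 c2 c3] := compl_idem PmI; have [c4 c5 c6] := compl_idem PpI.
have Yp' : Pp *m adM G (- Y) *m (1%:M - Pp) = 0 by rewrite linearN mulmxN mulNmx Yp oppr0.
split.
- by apply: (mxpow_block_limit XN XT) => //; rewrite subrK.
- rewrite V; apply: (mxpow_block_limit XN' XT') => //.
  by rewrite addrC subrK.
rewrite V mulmxBl raddfB raddfB /= expRD.
apply: ler_pM; rewrite ?rn_ge0//.
  by apply: (pdet_exp_le XN XT PmI); right.
have := pdet_exp_le XN' XT' PpI (or_introl Yp').
by rewrite linearN mulmxN raddfN raddfN.
Qed.

Lemma block_bound1 : block_bound 1%g 1.
Proof.
have [c1 c2 c3] := compl_idem PmI; have [c4 c5 c6] := compl_idem PpI.
rewrite /block_bound invg1 adm1 !mulmx1 c2 c4 !pdet1//.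
by split => //; have := rn_natr R 1; rewrite mulr1n => ->; rewrite mulr1.
Qed.

Lemma block_bound_exp Y : (1%:M - Pm) *m adM G Y *m Pm = 0 ->
  Pp *m adM G Y *m (1%:M - Pp) = 0 -> complex.Re (\tr ((Pm - Pp) *m adM G Y)) = 0 ->
  block_bound (lie_exp Y : G) 1 /\ block_bound (lie_exp Y : G)^-1%g 1.
Proof.
(* If no one-parameter group exists, [lie_exp Y] is 1, which meets the bound 1. *)
move=> Ym Yp tr0; rewrite /lie_exp; case: xgetP => [x -> [gamma gY <-]|_]; last first.
  by rewrite invg1; split; exact: block_bound1.
rewrite -expR0; split; first exact: (block_bound_one_param gY Ym Yp).
have gN := one_paramN gY; rewrite (one_paramV gY).
apply: (block_bound_one_param gN).
- by rewrite linearN mulmxN mulNmx Ym oppr0.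
- by rewrite linearN mulmxN mulNmx Yp oppr0.
by rewrite linearN mulmxN raddfN raddfN /= tr0 oppr0.
Qed.

(** A bound below 1 fails for the default value of [lie_exp], so here the existence of the
    one-parameter group is essential. *)
Lemma block_bound_exp_abelian Z s : Z *m adM G Z = 0 ->
  (1%:M - Pm) *m adM G Z *m Pm = 0 -> Pp *m adM G Z *m (1%:M - Pp) = 0 ->
  complex.Re (\tr ((Pm - Pp) *m adM G Z)) = s ->
  block_bound (lie_exp Z : G) (expR s).
Proof.
move=> Z0 Zm Zp trs; have [gamma gZ] := one_param_exists Z0.
rewrite /lie_exp; case: xgetP => [x -> [gamma' gZ' <-]|H].
  exact: (block_bound_one_param gZ' Zm Zp).
by case: (H (gamma 1)); exists gamma.
Qed.

End OneParameter.

(** * Orthonormal coordinates for the Cartan inner product *)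

Section PositiveDefinite.
Variables (C : numClosedFieldType) (n : nat).

(** The rows [u *m B] are coordinates in which the form S is the standard one. *)
Lemma posdef_factor (S : 'M[C]_n) : S^t* = S -> (forall u, u != 0 -> 0 < qf S u) ->
  exists B : 'M[C]_n, B \in unitmx /\ S = B *m B^t*.
Proof.
move=> SH Sp; have [U [d [UU UU' SE dR]]] := herm_spectral SH.
have d0 k : 0 < d 0 k.
  rewrite -(spectral_qf d k UU) -SE; apply: Sp; apply/eqP => E.
  have := congr1 (mulmx^~ (U^t*)) E; rewrite -row_mul UU mul0mx.
  by move/rowP/(_ k); rewrite !mxE eqxx => /eqP; rewrite oner_eq0.
pose s := \row_k sqrtC (d 0 k).
have sH : (diag_mx s)^t* = diag_mx s.
  rewrite tr_diag_mx map_diag_mx; congr diag_mx; apply/rowP => k.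
  by rewrite !mxE; apply: conj_Creal; rewrite ger0_real// sqrtC_ge0 ltW.
exists (U^t* *m diag_mx s); split.
  rewrite unitmx_mul; apply/andP; split.
    by have [] := mulmx1_unit UU'.
  rewrite unitmxE det_diag unitfE; apply/prodf_neq0 => k _.
  by rewrite mxE sqrtC_eq0 gt_eqF.
rewrite SE ctM sH trmxCK !mulmxA -[X in _ = X *m _]mulmxA mulmx_diag.
by congr (_ *m diag_mx _ *m _); apply/rowP => k; rewrite !mxE -expr2 sqrtCK.
Qed.

End PositiveDefinite.

Section GramCoordinates.
Variables (C : numClosedFieldType) (n : nat).
Variables S B B' : 'M[C]_n.
Hypothesis BS : S = B *m B^t*.
Hypothesis BB' : B *m B' = 1%:M.
Hypothesis B'B : B' *m B = 1%:M.

Lemma gram_coord_mul (M N : 'M[C]_n) :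
  B' *m M *m B *m (B' *m N *m B) = B' *m (M *m N) *m B.
Proof. by rewrite !mulmxA -[B' *m M *m B *m B']mulmxA BB' mulmx1. Qed.

(** The hypothesis says that N is the adjoint of M for the form S; in the new coordinates adjoints
    are conjugate transposes. *)
Lemma gram_coord_ct (M N : 'M[C]_n) : N *m S = S *m M^t* ->
  (B' *m M *m B)^t* = B' *m N *m B.
Proof.
move=> H; have BtB't : B^t* *m B'^t* = 1%:M by rewrite -ctM B'B ct1.
have := congr1 (fun X => B' *m X *m B'^t*) H.
rewrite BS !ctM !mulmxA B'B mul1mx => <-.
by rewrite -[_ *m B^t* *m _]mulmxA BtB't mulmx1.
Qed.

Lemma gram_coord_form (a t : 'M[C]_n) : a *m (t *m S) *m a^t* = t *m S ->
  B' *m a *m B *m (B' *m t *m B) *m (B' *m a *m B)^t* = B' *m t *m B.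
Proof.
move=> H; have BtB't : B^t* *m B'^t* = 1%:M by rewrite -ctM B'B ct1.
rewrite gram_coord_mul !ctM.
have := congr1 (fun X => B' *m X *m B'^t*) H; rewrite BS.
have -> : B' *m (t *m (B *m B^t*)) *m B'^t* = B' *m t *m B.
  by rewrite -!mulmxA BtB't mulmx1.
by move=> <-; rewrite !mulmxA.
Qed.

End GramCoordinates.

Section Involutions.
Variables (K : numFieldType) (n : nat) (G : lieGroupType K n).

Lemma dmx_invol (f : G -> G) : involution f -> dmx f *m dmx f = 1%:M.
Proof.
move=> [fh ff].
have H : \forall v \near id_coord G, hatf f (hatf f v) = v.
  have H1 := near_hom fh; have H2 := near_cran G; near=> v.
  rewrite /hatf chart_mapK; last by near: v.
  by rewrite ff cinvK//; near: v.
have D1 : is_diff (hatf f (id_coord G)) (hatf f) (dhom f).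
  by rewrite hatf_e//; exact: is_diff_hatf.
have E := is_diff_near_eq (is_diff_comp (is_diff_hatf fh) D1) (is_diff_id _) H.
apply/row_matrixP => i; rewrite !rowE mulmx1 mulmxA -!dhom_dmx.
exact: E.
Unshelve. all: by end_near. Qed.

End Involutions.

Section CartanGram.
Variables (R : realType) (n : nat) (G : lieGroupType R n).

Lemma killingE (K : numFieldType) l (L : lieGroupType K l) X Y :
  killing L X Y = \tr (adM L X *m adM L Y).
Proof. by rewrite /killing !adME. Qed.

Definition killing_mx : 'M[R]_n :=
  \matrix_(i, j) \tr (adM G (delta_mx 0 i) *m adM G (delta_mx 0 j)).

Lemma bilin_eq (M N : 'M[R]_n) :
  (forall X Y : 'rV[R]_n, (X *m M *m Y^T) 0 0 = (X *m N *m Y^T) 0 0) -> M = N.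
Proof.
move=> H; apply/matrixP => i j.
have E (L : 'M[R]_n) : (delta_mx 0 i *m L *m (delta_mx 0 j)^T) (0 : 'I_1) (0 : 'I_1) = L i j.
  by rewrite -rowE trmx_delta -colE !mxE.
by rewrite -!E H.
Qed.

Lemma killing_mxE X Y : (X *m killing_mx *m Y^T) 0 0 = \tr (adM G X *m adM G Y).
Proof.
have E (Z : 'rV[R]_n) : adM G Z = \sum_i Z 0 i *: adM G (delta_mx 0 i).
  rewrite {1}(row_sum_delta Z) linear_sum /=; apply: eq_bigr => i _.
  by rewrite linearZ.
rewrite (E X) (E Y) mxE mulmx_suml raddf_sum /=.
under [RHS]eq_bigr => i _ do rewrite mulmx_sumr raddf_sum /=.
rewrite exchange_big /=; apply: eq_bigr => j _; rewrite mxE mulr_suml.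
apply: eq_bigr => i _.
by rewrite -scalemxAl -scalemxAr !mxtraceZ !mxE mulrA mulrAC.
Qed.

Lemma killing_mx_sym : killing_mx^T = killing_mx.
Proof. by apply/matrixP => i j; rewrite !mxE mxtrace_mulC. Qed.

Lemma killing_adm (g : G) : adm g *m killing_mx *m (adm g)^T = killing_mx.
Proof.
apply: bilin_eq => X Y; rewrite killing_mxE !mulmxA -[_ *m (adm g)^T *m _]mulmxA -trmx_mul.
rewrite killing_mxE !adm_ad.
have -> : adm g^-1%g *m adM G X *m adm g *m (adm g^-1%g *m adM G Y *m adm g) =
   adm g^-1%g *m (adM G X *m adM G Y *m adm g).
  by rewrite !mulmxA -[adm g^-1%g *m adM G X *m adm g *m _]mulmxA admMV mulmx1.
by rewrite [LHS]mxtrace_mulC -!mulmxA admMV mulmx1.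
Qed.

Lemma killing_ad J : adM G J *m killing_mx = - (killing_mx *m (adM G J)^T).
Proof.
apply/eqP; rewrite -addr_eq0; apply/eqP; apply: bilin_eq => X Y.
rewrite mulmx0 mul0mx [RHS]mxE mulmxDr mulmxDl [LHS]mxE !mulmxA.
rewrite -[X *m killing_mx *m _ *m Y^T]mulmxA -trmx_mul !killing_mxE !jacobi.
rewrite mulmxBl mulmxBr !raddfB /= !mulmxA.
have -> : \tr (adM G J *m adM G X *m adM G Y) = \tr (adM G X *m adM G Y *m adM G J).
  by rewrite -mulmxA mxtrace_mulC.
by rewrite addrA subrK subrr.
Qed.

Variable theta : G -> G.
Hypothesis thetaP : cartan_involution theta.
Let th := dmx theta.

Lemma theta_invol : th *m th = 1%:M.
Proof. by have [+ _] := thetaP; exact: dmx_invol. Qed.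

Lemma ad_theta X : adM G (X *m th) = th *m adM G X *m th.
Proof.
have [[th_hom _] _] := thetaP.
by rewrite -mulmxA ad_hom// mulmxA -/th theta_invol mul1mx.
Qed.

Lemma killing_theta : th *m killing_mx = killing_mx *m th^T.
Proof.
have E : th *m killing_mx *m th^T = killing_mx.
  apply: bilin_eq => X Y; rewrite killing_mxE !mulmxA -[_ *m th^T *m _]mulmxA -trmx_mul.
  rewrite killing_mxE !ad_theta.
  have -> : th *m adM G X *m th *m (th *m adM G Y *m th) = th *m (adM G X *m adM G Y *m th).
    by rewrite !mulmxA -[th *m adM G X *m th *m th]mulmxA theta_invol mulmx1.
  by rewrite [LHS]mxtrace_mulC -!mulmxA theta_invol mulmx1.
by rewrite -{2}E -!mulmxA -trmx_mul theta_invol trmx1 mulmx1.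
Qed.

(** The Gram matrix of - kappa (theta X, Y), kappa being the Killing form. *)
Definition cartan_gram : 'M[R]_n := - (th *m killing_mx).

Lemma gram_sym : cartan_gram^T = cartan_gram.
Proof. by rewrite /cartan_gram linearN /= trmx_mul killing_mx_sym killing_theta. Qed.

Lemma gram_gt0 (X : 'rV[R]_n) : X != 0 -> 0 < (X *m cartan_gram *m X^T) 0 0.
Proof.
have [_ H] := thetaP => /H; rewrite killingE dhom_dmx -/th mxtrace_mulC -killing_mxE.
by rewrite -oppr_gt0 /cartan_gram mulmxN mulNmx [X in _ -> 0 < X]mxE mulmxA.
Qed.

Lemma gram_theta : th *m cartan_gram = cartan_gram *m th^T.
Proof.
by rewrite /cartan_gram mulmxN mulNmx {2}killing_theta -mulmxA -trmx_mul theta_invol trmx1 mulmx1 mulmxA theta_invol mul1mx.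
Qed.

(** [th *m cartan_gram] is minus the Killing matrix, which Ad preserves. *)
Lemma gram_adm (g : G) : adm g *m (th *m cartan_gram) *m (adm g)^T = th *m cartan_gram.
Proof.
by rewrite /cartan_gram mulmxN mulmxA theta_invol mul1mx mulmxN mulNmx killing_adm.
Qed.

(** ad J is skew for the Killing form and commutes with theta, so it is skew for the inner product;
    this will make ad Z0 = -i ad J Hermitian. *)
Lemma gram_ad J : J *m th = J -> adM G J *m cartan_gram = - (cartan_gram *m (adM G J)^T).
Proof.
move=> Jth; have Jc : adM G J *m th = th *m adM G J.
  by rewrite -{2}Jth ad_theta !mulmxA theta_invol mul1mx.
by rewrite /cartan_gram mulmxN mulNmx mulmxA Jc -mulmxA killing_ad mulmxN mulmxA.
Qed.

End CartanGram.

Section Coordinates.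
Variable R : realType.
Local Notation C := (R[i] : numFieldType).
Local Notation rc := (@real_complex R).

Lemma conj_rc (x : R) : (x%:C%C : R[i])^* = x%:C%C.
Proof. by apply: conj_Creal; rewrite complex_real. Qed.

Lemma conj_ci : ('i%C : R[i])^* = - 'i%C.
Proof. by rewrite -[LHS]/(conjc _); simpc. Qed.

Lemma ct_rc p q (M : 'M[R]_(p, q)) : (map_mx rc M)^t* = map_mx rc M^T.
Proof. by apply/matrixP => i j; rewrite ctE !mxE conj_rc. Qed.

Lemma rc_reim p (u : 'rV[R[i]]_p) : u = map_mx rc (re_mx u) + 'i%C *: map_mx rc (im_mx u).
Proof. by apply/rowP => j; rewrite !mxE [LHS]complexE. Qed.

Lemma rc_reim_inj p (x y x' y' : 'rV[R]_p) :
  map_mx rc x + 'i%C *: map_mx rc y = map_mx rc x' + 'i%C *: map_mx rc y' ->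
  x = x' /\ y = y'.
Proof.
move=> /rowP H; split; apply/rowP => j; have := H j; rewrite !mxE; simpc.
  by case.
by case.
Qed.

(** For u = x + iy the mixed terms cancel by symmetry, and the values at x and y add up. *)
Lemma qf_rc_gt0 p (S : 'M[R]_p) : S^T = S ->
  (forall x : 'rV[R]_p, x != 0 -> 0 < (x *m S *m x^T) 0 0) ->
  forall u : 'rV[R[i]]_p, u != 0 -> 0 < qf (map_mx rc S) u.
Proof.
move=> SS Sp u u0; have E := rc_reim u.
move: (re_mx u) (im_mx u) E => x y E.
have Sge0 (z : 'rV[R]_p) : 0 <= (z *m S *m z^T) 0 0.
  have [->|z0] := eqVneq z 0; first by rewrite !mul0mx mxE.
  by apply: ltW; exact: Sp.
have uH : u^t* = map_mx rc x^T - 'i%C *: map_mx rc y^T.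
  rewrite E ctD linearZ map_mxZ !ct_rc /=; congr (_ + _).
  by rewrite -scaleNr; congr (_ *: _); exact: conj_ci.
have xy : x *m S *m y^T = y *m S *m x^T.
  have tr1 (M : 'M[R]_1) : M^T = M by apply/matrixP => i j; rewrite mxE !ord1.
  by rewrite -[LHS]tr1 !trmx_mul trmxK SS mulmxA.
have -> : qf (map_mx rc S) u = ((x *m S *m x^T) 0 0 + (y *m S *m y^T) 0 0)%:C%C.
  rewrite /qf uH E mulmxDl mulmxBr !mulmxDl -!scalemxAr -!scalemxAl -!map_mxM xy.
  move: (x *m S *m x^T) (y *m S *m x^T) (y *m S *m y^T) => a b c.
  rewrite !mxE; simpc; congr (Complex _ _); ring.
have [x0|x0] := eqVneq x 0; last first.
  by rewrite ltcR ltr_wpDr// Sp.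
have [y0|y0] := eqVneq y 0; last first.
  by rewrite ltcR ltr_wpDl// Sp.
by move: u0; rewrite E x0 y0 !map_mx0 scaler0 addr0 eqxx.
Qed.

End Coordinates.

(** * The lower bound for real elements *)

Section CenterElement.
Variable R : realType.
Local Notation C := (R[i] : numFieldType).
Local Notation rc := (@real_complex R).
Variables (n m : nat) (G : lieGroupType R n) (GC : lieGroupType C m) (eta : G -> GC).
Variables (theta tau : G -> G) (Z0 : 'rV[C]_m).
Hypothesis eta_hom : rc_hom eta.
Hypothesis eta_lie : lie_complexification eta.
Hypothesis thetaP : cartan_involution theta.
Hypothesis Z0P : is_Z0 eta theta tau Z0.
Hypothesis G_connected : connected [set: G].

Let thR : 'M[R]_n := dmx theta.

(** The point i Z0 of the line i R Z0 comes from a central element of k; lying in k itself, it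
    commutes with itself. *)
Lemma Z0_center : exists J : 'rV[R]_n, [/\ rc_dhom eta J = 'i%C *: Z0, J *m thR = J
  & J *m adM G J = 0].
Proof.
have [E _ _] := Z0P.
have : [set ('i%C * r%:C%C) *: Z0 | r in [set: R]] ('i%C *: Z0).
  by exists 1 => //; rewrite mulr1.
rewrite -E => -[J [J1 J2 J3] JE]; exists J; split => //.
  by rewrite -dhom_dmx.
by rewrite -bracket_ad; exact: J3.
Qed.

Section Frame.
Variable E' : 'M[C]_(m, n).
Hypothesis EE' : rcE eta *m E' = 1%:M.
Hypothesis E'E : E' *m rcE eta = 1%:M.

Lemma fixed_ker (w : 'rV[C]_n) :
  w *m map_mx rc thR = w <-> w *m rcE eta *m adM GC Z0 = 0.
Proof.
have [_ _ KE] := Z0P.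
have H : (w *m rcE eta *m adM GC Z0 = 0) <-> complexify eta (plus_space theta) (w *m rcE eta).
  by rewrite -KE /= bracket_ad.
have ui X Y : rc_dhom eta X + 'i%C *: rc_dhom eta Y = (map_mx rc X + 'i%C *: map_mx rc Y) *m rcE eta.
  by rewrite !rc_dhomE// mulmxDl -scalemxAl.
split.
  move=> wth; apply/H; exists (re_mx w), (im_mx w).
  have := wth; rewrite {1 2}(rc_reim w) mulmxDl -scalemxAl -!map_mxM => /rc_reim_inj[X1 Y1].
  by split; rewrite /plus_space /= ?dhom_dmx// ui -rc_reim.
move=> /H[X [Y [X1 Y1]]].
rewrite ui => /(congr1 (mulmx^~ E')); rewrite -!mulmxA EE' !mulmx1 => ->.
rewrite mulmxDl -scalemxAl -!map_mxM.
by move: X1 Y1; rewrite /plus_space /= !dhom_dmx -/thR => -> ->.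
Qed.

(** [Q] and [Q'] pass between the orthonormal coordinates defined by [B] and the chart coordinates
    of the complex Lie algebra. *)
Variables (B B' : 'M[C]_n) (Q : 'M[C]_(n, m)) (Q' : 'M[C]_(m, n)).
Hypothesis BS : map_mx rc (cartan_gram theta) = B *m B^t*.
Hypothesis BB' : B *m B' = 1%:M.
Hypothesis B'B : B' *m B = 1%:M.
Hypothesis QE : Q = B' *m rcE eta.
Hypothesis Q'E : Q' = E' *m B.

Lemma coordQQ' : Q *m Q' = 1%:M.
Proof. by rewrite QE Q'E mulmxA -[B' *m _ *m E']mulmxA EE' mulmx1. Qed.

Lemma coordQ'Q : Q' *m Q = 1%:M.
Proof. by rewrite QE Q'E mulmxA -[E' *m _ *m B']mulmxA BB' mulmx1. Qed.

Lemma conj_real (M : 'M[R]_n) X : map_mx rc M *m rcE eta = rcE eta *m X ->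
  Q *m X *m Q' = B' *m map_mx rc M *m B.
Proof.
move=> H; rewrite QE Q'E -[B' *m _ *m X]mulmxA -H !mulmxA.
by rewrite -[B' *m _ *m rcE eta *m E']mulmxA EE' mulmx1.
Qed.

Definition coordTh : 'M[C]_n := B' *m map_mx rc thR *m B.
Definition coordL : 'M[C]_n := Q *m adM GC Z0 *m Q'.
Definition coordA (g : G) : 'M[C]_n := Q *m adm (eta g) *m Q'.
Definition coordf (u : 'rV[C]_n) : 'M[C]_n := Q *m adM GC (u *m Q) *m Q'.

Lemma coordAE g : coordA g = B' *m map_mx rc (adm g) *m B.
Proof. exact: conj_real (adm_rc eta_hom g). Qed.

Lemma coordf_linear : linear coordf.
Proof.
move=> a u v; rewrite /coordf mulmxDl -scalemxAl linearP /=.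
by rewrite mulmxDr mulmxDl -scalemxAr -scalemxAl.
Qed.
HB.instance Definition _ := GRing.isLinear.Build C 'rV[C]_n 'M[C]_n *:%R coordf coordf_linear.

Lemma coordTh_herm : coordTh^t* = coordTh.
Proof.
apply: (gram_coord_ct BS B'B).
by rewrite ct_rc -!map_mxM (gram_theta thetaP).
Qed.

Lemma coordTh_sq : coordTh *m coordTh = 1%:M.
Proof.
have -> : coordTh *m coordTh = B' *m (map_mx rc thR *m map_mx rc thR) *m B.
  exact: (gram_coord_mul BB').
by rewrite -map_mxM (theta_invol thetaP) map_mx1 mulmx1.
Qed.

Lemma coordA_Th g : coordA g *m coordTh *m (coordA g)^t* = coordTh.
Proof.
rewrite coordAE; apply: (gram_coord_form BS BB' B'B).
by rewrite ct_rc -!map_mxM (gram_adm thetaP).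
Qed.

Lemma coordL_herm : coordL^t* = coordL.
Proof.
have [J [JE Jth JJ]] := Z0_center.
have Z0E : Z0 = - 'i%C *: rc_dhom eta J.
  by rewrite JE scalerA mulNr -expr2 sqr_i opprK scale1r.
have LE : coordL = - 'i%C *: (B' *m map_mx rc (adM G J) *m B).
  rewrite -(conj_real (adM_rc eta_hom J)) /coordL Z0E linearZ /=.
  by rewrite -scalemxAr -scalemxAl.
have HJ : (B' *m map_mx rc (adM G J) *m B)^t* = B' *m - map_mx rc (adM G J) *m B.
  apply: (gram_coord_ct BS B'B).
  by rewrite ct_rc mulNmx -!map_mxM (gram_ad thetaP Jth) map_mxN opprK.
rewrite LE linearZ map_mxZ /= HJ mulmxN mulNmx scalerN -scaleNr; congr (_ *: _).
by rewrite rmorphN /= conj_ci opprK.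
Qed.

Lemma coordL_fix (u : 'rV[C]_n) : u *m coordTh = u <-> u *m coordL = 0.
Proof.
have H1 : u *m coordTh = u <-> u *m B' *m map_mx rc thR = u *m B'.
  rewrite /coordTh !mulmxA; split => [E|->]; last by rewrite -mulmxA B'B mulmx1.
  by rewrite -{2}E -[RHS]mulmxA BB' mulmx1.
have H2 : u *m coordL = 0 <-> u *m B' *m rcE eta *m adM GC Z0 = 0.
  rewrite -[u *m B' *m _]mulmxA -QE.
  rewrite /coordL !mulmxA; split => [E|->]; last by rewrite mul0mx.
  have := congr1 (mulmx^~ Q) E.
  by rewrite mul0mx -[_ *m Q' *m Q]mulmxA coordQ'Q mulmx1.
by split => [/H1/fixed_ker/H2|/H2/fixed_ker/H1].
Qed.

(** A Hermitian matrix is diagonalizable, so it is enough that each of its eigenvalues, being -1, 0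
    or 1, satisfies z^3 = z. *)
Lemma coordL_cube : coordL *m coordL *m coordL = coordL.
Proof.
have [U [d [UU UU' LE dR]]] := herm_spectral coordL_herm.
have [_ sp _] := Z0P.
have d3 k : d 0 k * d 0 k * d 0 k = d 0 k.
  suff : d 0 k \in [:: -1; 0; 1].
    rewrite !inE => /or3P[] /eqP ->; by rewrite ?mulr0 ?mulrNN ?mulr1 ?mul1r.
  rewrite -sp; apply/eigenvalueP; exists (row k U *m Q); last first.
    apply/eqP => E; have := congr1 (mulmx^~ (Q' *m U^t*)) E.
    rewrite mul0mx mulmxA -[row k U *m Q *m Q']mulmxA coordQQ' mulmx1 -row_mul UU.
    by move/rowP/(_ k); rewrite !mxE eqxx => /eqP; rewrite oner_eq0.
  rewrite adME; have H : row k U *m coordL = d 0 k *: row k U.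
    by rewrite LE !mulmxA -row_mul UU row1 -rowE row_diag_mx -scalemxAl -rowE.
  have := congr1 (mulmx^~ Q) H.
  by rewrite /coordL -scalemxAl !mulmxA -[_ *m Q' *m Q]mulmxA coordQ'Q mulmx1.
have cd (x y : 'rV[R[i]]_n) : U^t* *m diag_mx x *m U *m (U^t* *m diag_mx y *m U) =
    U^t* *m diag_mx (\row_k (x 0 k * y 0 k)) *m U.
  by rewrite !mulmxA -[X in X *m diag_mx y]mulmxA UU mulmx1 -[_ *m diag_mx x *m _]mulmxA mulmx_diag.
rewrite LE !cd; congr (_ *m diag_mx _ *m _); apply/rowP => k.
by rewrite !mxE d3.
Qed.

(** Row by row through [coordL_fix]: 1 - L^2 has image in the kernel of L, which Th fixes, and 1 +
    Th has image in the fixed space of Th, which L kills. The adjoint of the second fact is L Th =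
    -L. *)
Lemma coordTh_L : coordTh = 1%:M - 2 *: (coordL *m coordL).
Proof.
have Th2 := coordTh_sq; have ThH := coordTh_herm; have LH := coordL_herm.
have P0 : (1%:M - coordL *m coordL) *m coordTh = 1%:M - coordL *m coordL.
  apply/row_matrixP => i; rewrite row_mul; apply/coordL_fix.
  by rewrite -row_mul mulmxBl mul1mx coordL_cube subrr row0.
have F0 : (1%:M + coordTh) *m coordL = 0.
  apply/row_matrixP => i; rewrite row_mul row0; apply/coordL_fix.
  by rewrite -row_mul mulmxDl mul1mx Th2 addrC.
have LTh : coordL *m coordTh = - coordL.
  move/eqP: F0; rewrite mulmxDl mul1mx addrC addr_eq0 => /eqP/(congr1 (fun M => M^t*)).
  by rewrite ctM LH ThH linearN map_mxN LH.
move: P0; rewrite mulmxBl mul1mx -mulmxA LTh mulmxN opprK => /eqP.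
by rewrite eq_sym subr_eq => /eqP H; apply/eqP; rewrite eq_sym subr_eq H -addrA -scale2.
Qed.

Local Notation f := coordf.
Local Notation A := coordA.
Local Notation Th := coordTh.

Lemma coord_mul (X Y : 'M[C]_m) : Q *m X *m Q' *m (Q *m Y *m Q') = Q *m (X *m Y) *m Q'.
Proof. by rewrite !mulmxA -[Q *m X *m Q' *m Q]mulmxA coordQ'Q mulmx1. Qed.

Lemma coordf_jac u v : f (u *m f v) = f u *m f v - f v *m f u.
Proof.
rewrite /coordf !coord_mul -mulmxBl -mulmxBr -jacobi !mulmxA.
by rewrite -[_ *m Q' *m Q]mulmxA coordQ'Q mulmx1.
Qed.

Lemma coordA_aut g : isaut f (A g).
Proof.
move=> u; rewrite /coordf /coordA !coord_mul; congr (_ *m _ *m _).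
have -> : u *m (Q *m adm (eta g) *m Q') *m Q = u *m Q *m adm (eta g).
  by rewrite !mulmxA -[_ *m Q' *m Q]mulmxA coordQ'Q mulmx1.
by rewrite adm_ad !mulmxA admMV mul1mx.
Qed.

Lemma coordA_unit g : A g \in unitmx.
Proof.
have E : A g *m (Q *m adm (eta g)^-1%g *m Q') = 1%:M.
  by rewrite /coordA coord_mul admMV mulmx1 coordQQ'.
exact: (proj1 (@mulmx1_unit C n _ _ E)).
Qed.

Lemma coordA1 : A 1%g = 1%:M.
Proof. by rewrite /coordA (rc_hom1 eta_hom) adm1 mulmx1 coordQQ'. Qed.

Lemma coordA_cont g : {for g, continuous (A : G -> 'M[C]_n)}.
Proof.
have cE : {for g, continuous (fun x => adm (eta x) : 'M[C]_m)}.
  have [_ ec _] := eta_hom.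
  by apply: (@continuous_comp _ _ _ eta (@adm C m GC)); [exact: ec | exact: adm_cont].
have c1 := @cont_mulmx R G _ _ _ (fun=> Q) _ g (@cst_continuous G _ Q g) cE.
exact: (@cont_mulmx R G _ _ _ _ (fun=> Q') g c1 (@cst_continuous G _ Q' g)).
Qed.

(** theta is an automorphism of the real Lie algebra; both sides are complex linear in the argument,
    which is split as x + iy. *)
Lemma coordTh_aut : isaut f Th.
Proof.
have fE w : f w = B' *m (rcE eta *m adM GC (w *m B' *m rcE eta) *m E') *m B.
  by rewrite /coordf QE Q'E !mulmxA.
have real (X : 'rV[R]_n) : rcE eta *m adM GC (map_mx rc X *m rcE eta) *m E' = map_mx rc (adM G X).
  by rewrite -rc_dhomE// -adM_rc// -mulmxA EE' mulmx1.
have [g gE] : exists g : 'rV[C]_n -> 'M[C]_n, forall w, g w = rcE eta *m adM GC (w *m rcE eta) *m E'.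
  by eexists.
have glin (x y : 'rV[C]_n) : g (x + 'i%C *: y) = g x + 'i%C *: g y.
  by rewrite !gE mulmxDl -scalemxAl linearD linearZ /= mulmxDr mulmxDl -scalemxAr -scalemxAl.
have greal (X : 'rV[R]_n) : g (map_mx rc X) = map_mx rc (adM G X) by rewrite gE real.
have cplx w : map_mx rc (dmx theta) *m g (w *m map_mx rc (dmx theta)) = g w *m map_mx rc (dmx theta).
  have gTh (X : 'rV[R]_n) : map_mx rc (dmx theta) *m g (map_mx rc X *m map_mx rc (dmx theta)) =
      g (map_mx rc X) *m map_mx rc (dmx theta).
    rewrite -[map_mx rc X *m map_mx rc _]map_mxM !greal -!map_mxM; congr map_mx.
    by rewrite (ad_theta thetaP) !mulmxA (theta_invol thetaP) mul1mx.
  have [x [y ->]] : exists x y : 'rV[R]_n, w = map_mx rc x + 'i%C *: map_mx rc y.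
    by exists (re_mx w), (im_mx w); apply/rowP => j; rewrite !mxE [LHS]complexE.
  rewrite glin mulmxDl -scalemxAl glin mulmxDr mulmxDl gTh; congr (_ + _).
  by rewrite -scalemxAr gTh -scalemxAl.
clear real greal glin.
have {}fE w : f w = B' *m g (w *m B') *m B by rewrite fE gE.
move=> u.
have E1 : f (u *m Th) = B' *m g (u *m B' *m map_mx rc (dmx theta)) *m B.
  rewrite fE; congr (_ *m g _ *m _).
  by rewrite !mulmxA -[_ *m B *m B']mulmxA BB' mulmx1.
have -> : Th *m f (u *m Th) = B' *m (map_mx rc (dmx theta) *m
    g (u *m B' *m map_mx rc (dmx theta))) *m B.
  by rewrite E1; exact: (gram_coord_mul BB').
have E2 : f u *m Th = B' *m (g (u *m B') *m map_mx rc (dmx theta)) *m B.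
  by rewrite fE; exact: (gram_coord_mul BB').
by rewrite cplx; exact: esym E2.
Qed.

End Frame.

(** [pdet] is unchanged under conjugation, so the bound found in orthonormal coordinates holds for
    Ad on the complex Lie algebra. *)
Lemma center_bound : adM GC Z0 *m adM GC Z0 *m adM GC Z0 = adM GC Z0 /\
  forall g, 1 <= rn (pdet (proj_neg (adM GC Z0)) (adm (eta g)) : C).
Proof.
have [E' [EE' E'E]] := complexification_split eta_hom eta_lie.
have SH : (map_mx rc (cartan_gram theta))^t* = map_mx rc (cartan_gram theta).
  by rewrite ct_rc (gram_sym thetaP).
have [B [Bu BS]] := posdef_factor SH (qf_rc_gt0 (gram_sym thetaP) (gram_gt0 thetaP)).
have BB' := mulmxV Bu; have B'B := mulVmx Bu; move: (invmx B) BB' B'B => B' BB' B'B.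
have [Q QE] : exists Q, Q = B' *m rcE eta by exists (B' *m rcE eta).
have [Q' Q'E] : exists Q', Q' = E' *m B by exists (E' *m B).
have QQ' := coordQQ' EE' B'B QE Q'E; have Q'Q := coordQ'Q E'E BB' QE Q'E.
have L3 := coordL_cube EE' E'E BS BB' B'B QE Q'E.
split.
  have := congr1 (fun M => Q' *m M *m Q) L3.
  rewrite /coordL !(coord_mul E'E BB' QE Q'E) !mulmxA Q'Q mul1mx -!mulmxA Q'Q mulmx1.
  by [].
have fz0 : coordf Q Q' (Z0 *m Q') = coordL Q Q'.
  by rewrite /coordf -[Z0 *m Q' *m Q]mulmxA Q'Q mulmx1.
have z0L : Z0 *m Q' *m coordL Q Q' = 0.
  have Z00 : Z0 *m adM GC Z0 = 0.
    have [J [JE _ JJ]] := Z0_center.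
    have Z0E : Z0 = - 'i%C *: rc_dhom eta J.
      by rewrite JE scalerA mulNr -expr2 sqr_i opprK scale1r.
    rewrite Z0E linearZ /= -scalemxAl -scalemxAr rc_dhomE// -mulmxA -rc_dhomE// -adM_rc//.
    by rewrite mulmxA -map_mxM JJ map_mx0 mul0mx !scaler0.
  by rewrite /coordL !mulmxA -[Z0 *m Q' *m Q]mulmxA Q'Q mulmx1 Z00 mul0mx.
have H := pdet_ge1 (coordTh_herm BS B'B) (coordTh_sq BB' B'B)
  (coordTh_aut EE' BB' QE Q'E)
  (coordL_herm EE' BS B'B QE Q'E)
  (coordTh_L EE' E'E BS BB' B'B QE Q'E)
  fz0 z0L (coordf_jac E'E BB' QE Q'E) G_connected (@coordA_cont Q Q') (coordA_unit EE' E'E BB' B'B QE Q'E)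
  (coordA_Th EE' BS BB' B'B QE Q'E) (coordA_aut E'E BB' QE Q'E)
  (coordA1 EE' B'B QE Q'E).
move=> g; have := H g.
have -> : proj_neg (coordL Q Q') = Q *m proj_neg (adM GC Z0) *m Q'.
  rewrite /proj_neg /coordL (coord_mul E'E BB' QE Q'E) -scalemxAr -scalemxAl; congr (_ *: _).
  by rewrite mulmxBr mulmxBl.
have -> := pdet_conj (proj_neg (adM GC Z0)) (adm (eta g)) QQ' Q'Q.
by rewrite rnE lecR.
Qed.

End CenterElement.

(** * Finitely supported sums and common eigenvectors *)

Lemma fsum_ind (K : zmodType) (I : choiceType) (P : K -> Prop) (D : set I) (F : I -> K) :
  P 0 -> (forall x y, P x -> P y -> P (x + y)) -> (forall i, D i -> P (F i)) ->
  P (\sum_(i \in D) F i).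
Proof.
move=> P0 PD PF; rewrite big_seq_cond; elim/big_ind: _ => // i; rewrite andbT.
case: finite_supportP => [|X XD _ _]; first by rewrite inE.
by move=> iX; apply: PF; exact: XD.
Qed.

Section CommonEigenvector.
Variables (C : numClosedFieldType) (n : nat).

(** The linear factors of the characteristic polynomial are applied to u in turn. By Cayley-Hamilton
    the result is 0, and the last nonzero vector is an eigenvector that is still in V. *)
Lemma invariant_eigenvector (A : 'M[C]_n) (V : 'rV[C]_n -> Prop) u :
  (forall (a : C) v, V v -> V (v *m A - a *: v)) -> V u -> u != 0 ->
  exists w, [/\ V w, w != 0 & exists a, w *m A = a *: w].
Proof.
move=> VA Vu u0; have [r Hr] := closed_field_poly_normal (char_poly A).
rewrite (monicP (char_poly_monic A)) scale1r in Hr.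
case: n A V u VA Vu u0 Hr => [|n'] A V u VA Vu u0 Hr.
  by case/eqP: u0; apply/rowP => -[].
have H0 : u *m horner_mx A (\prod_(z <- r) ('X - z%:P)) = 0.
  by rewrite -Hr Cayley_Hamilton mulmx0.
elim: r u Vu u0 H0 {Hr} => [|z r IH] u Vu u0 H0.
  by move: H0 u0; rewrite big_nil rmorph1 mulmx1 => ->; rewrite eqxx.
have E : u *m (A - z%:M) = u *m A - z *: u by rewrite mulmxBr mul_mx_scalar.
have [uz|uz] := eqVneq (u *m A - z *: u) 0.
  by exists u; split => //; exists z; apply/eqP; rewrite -subr_eq0 uz.
apply: (IH (u *m A - z *: u)) => //; first exact: VA.
move: H0; rewrite big_cons rmorphM /= rmorphB /= horner_mx_X horner_mx_C mulmxA.
by rewrite E.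
Qed.

(** The eigenvalue equation of a matrix already treated is added to V; it survives the later steps
    because the matrices commute. *)
Lemma invariant_common_eigenvector (As : seq 'M[C]_n) (V : 'rV[C]_n -> Prop) u :
  (forall A, A \in As -> forall (a : C) v, V v -> V (v *m A - a *: v)) ->
  (forall A B, A \in As -> B \in As -> A *m B = B *m A) -> V u -> u != 0 ->
  exists w, [/\ V w, w != 0 & forall A, A \in As -> exists a, w *m A = a *: w].
Proof.
elim: As V u => [|A As IH] V u VA cA Vu u0; first by exists u.
have [w [Vw w0 [a wa]]] := invariant_eigenvector (VA A (mem_head _ _)) Vu u0.
have [w' [[Vw' wa'] w0' Hw']] : exists w', [/\ V w' /\ w' *m A = a *: w', w' != 0 &
    forall B, B \in As -> exists b, w' *m B = b *: w'].
  apply: (IH (fun v => V v /\ v *m A = a *: v) w) => //.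
  - move=> B BA b v [Vv va]; split; first by apply: VA => //; rewrite inE BA orbT.
    rewrite mulmxBl -mulmxA (cA B A) ?inE ?eqxx ?BA ?orbT// mulmxA va.
    by rewrite -!scalemxAl va scalerBr !scalerA mulrC.
  - by move=> B B' BA BA'; apply: cA; rewrite inE ?BA ?BA' orbT.
exists w'; split => // B; rewrite inE => /orP[/eqP ->|]; first by exists a.
exact: Hw'.
Qed.

End CommonEigenvector.

(** * Roots, coroots and the absence of real points *)

Section NoRealPoints.
Variable R : realType.
Local Notation C := (R[i] : numFieldType).
Local Notation rc := (@real_complex R).
Variables (n m : nat) (G : lieGroupType R n) (GC : lieGroupType C m) (eta : G -> GC).
Variables (theta tau : G -> G) (tauC : GC -> GC) (Z0 : 'rV[C]_m).
Hypothesis eta_hom : rc_hom eta.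
Hypothesis eta_lie : lie_complexification eta.
Hypothesis G_connected : connected [set: G].
Hypothesis tau_inv : involution tau.
Hypothesis tauC_hom : lie_hom tauC.
Hypothesis tauC_ext : forall x, tauC (eta x) = eta (tau x).
Hypothesis thetaP : cartan_involution theta.
Hypothesis Z0P : is_Z0 eta theta tau Z0.
Variable t : {vspace 'rV[R]_n}.
Hypothesis t_max : max_abelian_in G (minus_space tau) t.
Hypothesis t_Z0 : exists2 X, X \in t & rc_dhom eta X = 'i%C *: Z0.
Variable Delta_plus : set (functional eta t).
Hypothesis Delta_plusP : positive_system Delta_plus.
Hypothesis Delta_plus_Z0 : forall alpha, Delta alpha -> 0 < pairing alpha Z0 ->
  Delta_plus alpha.
Variable coroot : functional eta t -> 'rV[C]_m.
Hypothesis corootP : forall alpha, Delta alpha -> is_coroot alpha (coroot alpha).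

Local Notation deta := (rc_dhom eta).
Local Notation L := (adM GC Z0).
Local Notation D := (dmx tauC).
Local Notation tc := (tC eta t).
Local Notation Pm := (proj_neg L).
Local Notation Pp := (proj_pos L).

Let LLL : L *m L *m L = L.
Proof. by have [] := center_bound eta_hom eta_lie thetaP Z0P G_connected. Qed.
Let PmI := proj_neg_idem LLL.
Let PpI := proj_pos_idem LLL.
Local Notation bounded := (block_bound Pm Pp).

Lemma deta_tC X : X \in t -> deta X \in tc.
Proof.
move=> Xt; rewrite (coord_vbasis Xt) rc_dhomE// raddf_sum /= mulmx_suml.
apply: memv_suml => i _; rewrite map_mxZ -scalemxAl memvZ// -rc_dhomE//.
apply: memv_span; apply/mapP; exists (vbasis t)`_i => //.
by apply: mem_nth; rewrite size_tuple.
Qed.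

Lemma tC_ind (P : 'rV[C]_m -> Prop) : P 0 ->
  (forall (a : C) X Y, X \in t -> P Y -> P (a *: deta X + Y)) ->
  forall T, T \in tc -> P T.
Proof.
move=> P0 PD T Tt.
have /coord_span -> : T \in <<in_tuple [seq deta X | X <- vbasis t]>>%VS by [].
elim/big_rec: _ => // i Y _ PY.
have /mapP[X Xt ->] : [seq deta X | X <- vbasis t]`_i \in [seq deta X | X <- vbasis t].
  by apply: mem_nth; exact: ltn_ord.
by apply: PD => //; exact: vbasis_mem.
Qed.

Lemma Z0_in_tC : Z0 \in tc.
Proof.
have [X Xt XE] := t_Z0.
have -> : Z0 = - 'i%C *: deta X by rewrite XE scalerA mulNr -expr2 sqr_i opprK scale1r.
by rewrite memvZ// deta_tC.
Qed.

Lemma t_comm X Y : X \in t -> Y \in t -> deta X *m adM GC (deta Y) = 0.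
Proof.
have [_ ab _] := t_max => Xt Yt.
have := ab Y X Yt Xt; rewrite bracket_ad => XY.
by rewrite (rc_dhomE eta_hom X) -mulmxA -(adM_rc eta_hom) mulmxA -map_mxM XY map_mx0 mul0mx.
Qed.

Lemma tC_comm T T' : T \in tc -> T' \in tc -> T *m adM GC T' = 0.
Proof.
move=> Tt; elim/tC_ind: T' / => [|a X Y Xt IH]; first by rewrite linear0 mulmx0.
rewrite linearP /= mulmxDr IH addr0 -scalemxAr {Y IH}.
elim/tC_ind: T / Tt => [|b X' Y' X't IH']; first by rewrite mul0mx scaler0.
by rewrite mulmxDl -scalemxAl t_comm// scaler0 add0r IH'.
Qed.

Lemma tC_ad_comm T T' : T \in tc -> T' \in tc -> adM GC T *m adM GC T' = adM GC T' *m adM GC T.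
Proof.
move=> Tt Tt'; have := jacobi GC T T'; rewrite tC_comm// linear0 => /esym/eqP.
by rewrite subr_eq0 => /eqP.
Qed.

(** [tauC] is given as a homomorphism extending tau; its differential squares to 1 because it is the
    complexification of that of tau. *)
Lemma D_sq : D *m D = 1%:M.
Proof.
have [E' [EE' E'E]] := complexification_split eta_hom eta_lie.
have DE : D = E' *m map_mx rc (dmx tau) *m rcE eta.
  have H := dmx_rc eta_hom (proj1 tau_inv) tauC_hom tauC_ext.
  by rewrite -mulmxA H mulmxA E'E mul1mx.
rewrite DE !mulmxA -[_ *m rcE eta *m E']mulmxA EE' mulmx1.
rewrite -[_ *m map_mx rc _ *m map_mx rc _]mulmxA -map_mxM dmx_invol// map_mx1 mulmx1.
exact: E'E.
Qed.

Lemma tC_D T : T \in tc -> T *m D = - T.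
Proof.
have [tq _ _] := t_max.
elim/tC_ind: T / => [|a X Y Xt IH]; first by rewrite mul0mx oppr0.
rewrite mulmxDl IH -scalemxAl opprD -scalerN; congr (_ *: _ + _).
have H := dmx_rc eta_hom (proj1 tau_inv) tauC_hom tauC_ext.
have := tq _ Xt; rewrite /minus_space /= dhom_dmx => XD.
by rewrite rc_dhomE// -mulmxA -H mulmxA -map_mxM XD map_mxN mulNmx.
Qed.

Lemma ad_D X : adM GC X *m D = D *m adM GC (X *m D).
Proof. exact: ad_hom. Qed.

Lemma L_D : L *m D = - (D *m L).
Proof. by rewrite ad_D tC_D ?Z0_in_tC// linearN mulmxN. Qed.

(** Z0 lies in t_C, where tau is -1; so tau conjugates L to -L and exchanges its extreme
    eigenspaces. *)
Lemma D_proj : D *m proj_neg L *m D = proj_pos L.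
Proof.
have DL : D *m L *m D = - L by rewrite -mulmxA L_D mulmxN mulmxA D_sq mul1mx.
have DLL : D *m (L *m L) *m D = L *m L.
  have -> : D *m (L *m L) *m D = (D *m L *m D) *m (D *m L *m D).
    by rewrite !mulmxA -[_ *m D *m D]mulmxA D_sq mulmx1.
  by rewrite DL mulmxN mulNmx opprK.
by rewrite /proj_neg /proj_pos -scalemxAr -scalemxAl mulmxBr mulmxBl DL DLL opprK.
Qed.

Lemma root_ad (alpha : functional eta t) Y T : root_space alpha Y -> T \in tc ->
  Y *m adM GC T = pairing alpha T *: Y.
Proof.
move=> H Tt; have := H (vsproj tc T).
by rewrite vsprojK// bracket_ad.
Qed.

Lemma root_spaceP (alpha : functional eta t) Y :
  (forall T, T \in tc -> Y *m adM GC T = pairing alpha T *: Y) -> root_space alpha Y.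
Proof.
move=> H T; rewrite bracket_ad H ?subvsP//.
by rewrite /pairing vsvalK.
Qed.

Lemma root_value (alpha : functional eta t) : Delta alpha ->
  [\/ pairing alpha Z0 = -1, pairing alpha Z0 = 0 | pairing alpha Z0 = 1].
Proof.
move=> [_ [Y YR Y0]]; have YL := root_ad YR Z0_in_tC.
set a := pairing alpha Z0 in YL *.
have : (a * a * a - a) *: Y = 0.
  rewrite scalerBl -YL -{1}LLL !mulmxA YL -!scalemxAl YL -scalemxAl YL !scalerA.
  by rewrite subrr.
have -> : a * a * a - a = a * ((a - 1) * (a + 1)) by ring.
move=> /eqP; rewrite scaler_eq0 (negPf Y0) orbF !mulf_eq0 => /or3P[] /eqP E.
- by constructor 2.
- by constructor 3; apply/eqP; rewrite -subr_eq0 E.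
- by constructor 1; apply/eqP; rewrite -addr_eq0 E.
Qed.

(** tau, being -1 on t_C, maps the root space of alpha to that of -alpha. *)
Lemma Delta_opp (alpha : functional eta t) : Delta alpha -> Delta (- alpha).
Proof.
have D2 := D_sq.
move=> [a0 [Y YR Y0]]; split; first by rewrite oppr_eq0.
exists (Y *m D); last first.
  apply/eqP => /(congr1 (mulmx^~ D)); rewrite -mulmxA D2 mulmx1 mul0mx => /eqP.
  by rewrite (negPf Y0).
apply: root_spaceP => T Tt.
have DT : D *m adM GC T = - (adM GC T *m D).
  have TD := tC_D Tt.
  by rewrite ad_D TD linearN mulmxN opprK.
rewrite -mulmxA DT mulmxN mulmxA (root_ad YR Tt) -scalemxAl.
by rewrite /pairing opp_lfunE scaleNr.
Qed.

(** If the value were -1, the opposite root would take the value 1 and be positive as well. *)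
Lemma positive_value (alpha : functional eta t) : Delta_plus alpha ->
  pairing alpha Z0 = 0 \/ pairing alpha Z0 = 1.
Proof.
have [PD PN _] := Delta_plusP => aP; have aD := PD _ aP.
case: (root_value aD) => E; [|by left|by right].
have := proj1 (PN _ aD) aP; case.
apply: Delta_plus_Z0; first exact: Delta_opp.
by rewrite /pairing opp_lfunE -/(pairing alpha Z0) E opprK ltr01.
Qed.

(** If alpha(T) is nonzero, Y is up to this scalar a bracket with T, and T commutes with Z0;
    invariance of the trace form gives 0. *)
Lemma trace_L_root (alpha : functional eta t) Y : alpha != 0 -> root_space alpha Y ->
  \tr (L *m adM GC Y) = 0.
Proof.
move=> a0 YR.
have [T Tt aT] : exists2 T, T \in tc & pairing alpha T != 0.
  apply/not_exists2P => H; move/eqP: a0; apply; apply/lfunP => T.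
  rewrite lfunE /=; have [|] := H (vsval T); first by rewrite subvsP.
  by move/negP; rewrite negbK /pairing vsvalK => /eqP.
have LT := tC_ad_comm Z0_in_tC Tt.
apply: (mulfI aT); rewrite mulr0 -mxtraceZ scalemxAr.
have <- : adM GC (Y *m adM GC T) = pairing alpha T *: adM GC Y by rewrite (root_ad YR Tt) linearZ.
rewrite jacobi mulmxBr raddfB /=.
have -> : \tr (L *m (adM GC T *m adM GC Y)) = \tr (L *m (adM GC Y *m adM GC T)).
  by rewrite mulmxA LT -mulmxA mxtrace_mulC mulmxA.
by rewrite subrr.
Qed.

(** By the value 0 or 1 of a positive root on Z0, its root vectors commute with L or raise the
    eigenvalues of L. *)
Lemma nC_blocks Y : nC Delta_plus Y ->
  [/\ (1%:M - Pm) *m adM GC Y *m Pm = 0, Pp *m adM GC Y *m (1%:M - Pp) = 0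
    & \tr (L *m adM GC Y) = 0].
Proof.
have [PD _ _] := Delta_plusP.
move=> [f fR ->].
pose P (X : 'rV[C]_m) := [/\ (1%:M - Pm) *m adM GC X *m Pm = 0,
  Pp *m adM GC X *m (1%:M - Pp) = 0 & \tr (L *m adM GC X) = 0].
apply: (@fsum_ind _ _ P Delta_plus f) => [|x y [x1 x2 x3] [y1 y2 y3]|alpha aP].
- by rewrite /P linear0 !mulmx0 !mul0mx raddf0.
- have add (U V : 'M[C]_m) : U *m adM GC x *m V = 0 -> U *m adM GC y *m V = 0 ->
      U *m adM GC (x + y) *m V = 0.
    by move=> Ux Uy; rewrite linearD mulmxDr mulmxDl Ux Uy addr0.
  split; [exact: add | exact: add |].
  by rewrite linearD mulmxDr raddfD /= x3 y3 addr0.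
have YR := fR _ aP; have YL := root_ad YR Z0_in_tC.
have J := jacobi GC (f alpha) Z0; rewrite YL linearZ /= in J.
have [a0 _] := PD _ aP.
have tr0 := trace_L_root a0 YR.
case: (positive_value aP) J => -> J.
  have [] // := @comm_blocks _ _ _ LLL (adM GC (f alpha)).
  by apply/eqP; rewrite -subr_eq0 -J scale0r.
by have [] // := @raising_blocks _ _ _ LLL (adM GC (f alpha)); rewrite -J scale1r.
Qed.

Lemma tC_blocks T : T \in tc ->
  (1%:M - Pm) *m adM GC T *m Pm = 0 /\ Pp *m adM GC T *m (1%:M - Pp) = 0.
Proof.
move=> Tt; apply: (comm_blocks LLL).
exact: (tC_ad_comm Tt Z0_in_tC).
Qed.

Lemma pdet_tauC x : pdet Pm (adm (tauC x)) = pdet Pp (adm x).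
Proof.
have D2 := D_sq.
have DP := D_proj.
have E : adm (tauC x) = D *m adm x *m D.
  by rewrite -mulmxA (adm_hom tauC_hom) mulmxA D2 mul1mx.
have PE : Pm = D *m Pp *m D.
  by rewrite -DP !mulmxA D2 mul1mx -mulmxA D2 mulmx1.
by rewrite E [in LHS]PE; exact: (pdet_conj Pp (adm x) D2 D2).
Qed.

(** Since tau fixes h, c_+ and c_- agree on Ad of its inverse, and the product becomes c_- of the
    identity. *)
Lemma MC_block_bound h : MC eta t tauC h -> block_bound Pm Pp h 1.
Proof.
move=> [hC hT].
have Lh : adm h *m L = L *m adm h.
  have := adm_ad h Z0; rewrite -Ad_adm hT ?Z0_in_tC//.
  by move=> /(congr1 (mulmx (adm h))); rewrite !mulmxA admMV mul1mx.
have Lh' : adm (h^-1)%g *m L = L *m adm (h^-1)%g.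
  have := congr1 (fun M => adm (h^-1)%g *m M *m adm (h^-1)%g) Lh.
  by rewrite !mulmxA admVM mul1mx -mulmxA admMV mulmx1.
have [b1 b2] := comm_blocks LLL Lh; have [b3 b4] := comm_blocks LLL Lh'.
split=> //; rewrite -rnM -pdet_tauC (lie_homV tauC_hom).
rewrite [tauC h]hC.
have <- := pdetM PmI (or_intror b3 : Pm *m adm h *m (1%:M - Pm) = 0 \/ _).
by rewrite admMV (pdet1 PmI); have := rn_natr R 1; rewrite mulr1n => ->.
Qed.

(** Elements of t commute with Z0, whose centralizer is k_C. *)
Lemma t_fixed X : X \in t -> X *m dmx theta = X.
Proof.
move=> Xt; have [E' [EE' E'E]] := complexification_split eta_hom eta_lie.
have : map_mx rc X *m map_mx rc (dmx theta) = map_mx rc X.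
  apply/(fixed_ker eta_hom Z0P EE').
  rewrite -(rc_dhomE eta_hom); exact: (tC_comm (deta_tC Xt) Z0_in_tC).
rewrite -map_mxM => /matrixP H; apply/matrixP => i j.
by have := H i j; rewrite !mxE => -[].
Qed.

Lemma killing_t_lt0 X : X \in t -> X != 0 ->
  exists2 r : R, r < 0 & \tr (adM GC (deta X) *m adM GC (deta X)) = r%:C%C.
Proof.
move=> Xt X0; have [E' [EE' E'E]] := complexification_split eta_hom eta_lie.
exists (\tr (adM G X *m adM G X)).
  by have [_ /(_ _ X0)] := thetaP; rewrite dhom_dmx t_fixed// killingE.
have E : adM GC (deta X) = E' *m map_mx rc (adM G X) *m rcE eta.
  by rewrite -mulmxA (adM_rc eta_hom) mulmxA E'E mul1mx.
have -> : adM GC (deta X) *m adM GC (deta X) = E' *m map_mx rc (adM G X *m adM G X) *m rcE eta.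
  by rewrite E map_mxM !mulmxA -[_ *m rcE eta *m E']mulmxA EE' mulmx1.
by rewrite mxtrace_mulC mulmxA EE' mul1mx trace_map_mx.
Qed.

Lemma coroot_in_tC (alpha : functional eta t) v : is_coroot alpha v -> v \in tc.
Proof. by move=> [[X Xt <-] _ _]; rewrite memvZ// deta_tC. Qed.

(** From kappa(v, .) = c alpha follow kappa(v, Z0) = c and kappa(v, v) = 2 c. As v = iX with X in t,
    where the Killing form is negative, c is positive. *)
Lemma killing_Z0_coroot (alpha : functional eta t) v : is_coroot alpha v ->
  pairing alpha Z0 = 1 -> exists2 r : R, 0 < r & \tr (L *m adM GC v) = r%:C%C.
Proof.
move=> cv aZ; have vt := coroot_in_tC cv.
move: cv => [[X Xt vE] av [c Hc]].
have X0 : X != 0.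
  apply: contra_eq_neq av => X0.
  have -> : v = 0 by rewrite -vE X0 (rc_dhomE eta_hom) map_mx0 mul0mx scaler0.
  by rewrite /pairing !linear0 eq_sym pnatr_eq0.
have [r r0 rE] := killing_t_lt0 Xt X0.
have H1 : \tr (adM GC v *m adM GC v) = c * 2.
  by rewrite -av -killingE -Hc vsprojK.
have H2 : \tr (adM GC v *m L) = c.
  by rewrite -[RHS]mulr1 -aZ -killingE -Hc vsprojK ?Z0_in_tC.
have H3 : \tr (adM GC v *m adM GC v) = - r%:C%C.
  rewrite -vE linearZ /= -scalemxAl -scalemxAr scalerA mxtraceZ rE.
  by rewrite -expr2 sqr_i mulN1r.
exists (- r / 2); first by rewrite divr_gt0 ?oppr_gt0.
rewrite mxtrace_mulC H2 rmorphM rmorphN /= fmorphV rmorph_nat -H3 H1.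
by rewrite mulfK// pnatr_eq0.
Qed.

Lemma functional_eq (alpha beta : functional eta t) :
  (forall i, pairing alpha (vbasis tc)`_i = pairing beta (vbasis tc)`_i) -> alpha = beta.
Proof.
move=> H; apply/lfunP => T.
have -> : T = \sum_i coord (vbasis tc) i (vsval T) *: vsproj tc (vbasis tc)`_i.
  rewrite -[LHS]vsvalK {1}(coord_vbasis (subvsP T)) linear_sum /=.
  by apply: eq_bigr => i _; rewrite linearZ.
rewrite !linear_sum; apply: eq_bigr => i _; rewrite !linearZ /=.
by congr (_ *: _); exact: H.
Qed.

(** A root is determined by its values on a basis of t_C, each of them an eigenvalue of the
    corresponding ad. With infinite support the sum in [Omega] would be 0. *)
Lemma finite_Delta : finite_set (@Delta R n m G GC eta t).
Proof.
have /(_ (\dim tc))[r Hr] : forall d, exists r : seq R[i], forall i z, (i < d)%N ->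
    eigenvalue (adM GC (vbasis tc)`_i : 'M[R[i]]_m) z -> z \in r.
  have ex (A : 'M[R[i]]_m) : exists r : seq R[i], forall z, eigenvalue A z -> z \in r.
    have [r Hr] := closed_field_poly_normal (char_poly A).
    exists r => z; rewrite eigenvalue_root_char Hr (monicP (char_poly_monic A)) scale1r.
    by rewrite root_prod_XsubC.
  elim=> [|d [r Hr]]; first by exists [::].
  have [r' Hr'] := ex (adM GC (vbasis tc)`_d); exists (r ++ r') => i z.
  rewrite ltnS leq_eqVlt mem_cat => /orP[/eqP ->|id] ez.
    by rewrite (Hr' _ ez) orbT.
  by rewrite (Hr _ _ id ez).
have valr (alpha : functional eta t) i : Delta alpha -> (i < \dim tc)%N ->
    pairing alpha (vbasis tc)`_i \in r.
  move=> [_ [Y YR Y0]] id; apply: (Hr i) => //.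
  apply/eigenvalueP; exists Y => //; apply: (root_ad YR).
  by apply: vbasis_mem; apply: mem_nth; rewrite size_tuple.
pose h (alpha : functional eta t) : {ffun 'I_(\dim tc) -> 'I_(size r).+1} :=
  [ffun i : 'I_(\dim tc) => inord (index (pairing alpha (vbasis tc)`_i) r)].
have hinj (alpha beta : functional eta t) : Delta alpha -> Delta beta -> h alpha = h beta -> alpha = beta.
  move=> aD bD /ffunP H; apply: functional_eq => i.
  have [id|di] := ltnP i (\dim tc); last first.
    by rewrite nth_default ?size_tuple// /pairing !linear0.
  have := H (Ordinal id); rewrite !ffunE /= => /(congr1 val) /=.
  rewrite !inordK ?ltnS ?index_size// => E.
  by rewrite -(nth_index 0 (valr _ _ aD id)) E nth_index// valr.
pose g (phi : {ffun 'I_(\dim tc) -> 'I_(size r).+1}) : functional eta t :=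
  xget 0 [set alpha | Delta alpha /\ h alpha = phi].
apply: (@sub_finite_set _ _ (range g)); last exact/finite_image/finite_finset.
move=> alpha aD; exists (h alpha) => //.
rewrite /g; case: xgetP => [beta _ [bD hb]|/(_ alpha)]; first exact: hinj.
by case.
Qed.

(** Without such a root [Omega] would be reduced to 0 and the bound on [A_plus] would not be below
    1. The spectrum of ad Z0 contains 1, and the commuting family ad t_C has a common eigenvector in
    that eigenspace. *)
Lemma positive_root_exists : exists2 alpha : functional eta t, Delta alpha & pairing alpha Z0 = 1.
Proof.
have [_ sp _] := Z0P.
have : eigenvalue (ad_mx GC Z0) (1 : R[i]) by rewrite sp !inE eqxx !orbT.
rewrite adME => /eigenvalueP[u uL u0]; rewrite scale1r in uL.
have [] := @invariant_common_eigenvector R[i] m [seq adM GC b | b <- vbasis tc] (fun v => v *m L = v) u.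
- move=> _ /mapP[b bt ->] a v vL; have bL := tC_ad_comm (vbasis_mem bt) Z0_in_tC.
  by rewrite mulmxBl -mulmxA bL mulmxA vL -scalemxAl vL.
- move=> _ _ /mapP[b bt ->] /mapP[b' bt' ->].
  exact: (tC_ad_comm (vbasis_mem bt) (vbasis_mem bt')).
- exact: uL.
- exact: u0.
move=> w [wL w0 Hw].
have {}Hw T : T \in tc -> exists a, w *m adM GC T = a *: w.
  move=> Tt; rewrite (coord_vbasis Tt) linear_sum mulmx_sumr.
  elim/big_rec: _ => [|i x _ [a ->]]; first by exists 0; rewrite scale0r.
  have [b Hb] : exists b, w *m adM GC (vbasis tc)`_i = b *: w.
    by apply: Hw; apply/map_f/mem_nth; rewrite size_tuple.
  exists (coord (vbasis tc) i T * b + a).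
  by rewrite linearZ /= -scalemxAr Hb scalerA scalerDl.
have [k wk] : exists k, w 0 k != 0.
  apply/existsP; apply: contra_neqT w0 => /existsPn H; apply/rowP => k.
  by have := H k; rewrite negbK mxE => /eqP.
(* The eigenvalue is read off at a nonzero coordinate of [w], which makes it visibly linear in T. *)
pose f (T : subvs_of tc) : R[i]^o := (w *m adM GC (vsval T)) 0 k / w 0 k.
have f_lin : linear f.
  move=> a T T'; rewrite /f.
  have -> : vsval (a *: T + T') = a *: vsval T + vsval T' by rewrite linearP.
  rewrite [adM GC _]linearP /= mulmxDr -scalemxAr.
  by rewrite [(_ + _ : 'rV[C]_m) 0 k]mxE [(_ *: _ : 'rV[C]_m) 0 k]mxE mulrDl -mulrA.
pose f' : {linear subvs_of tc -> R[i]^o} := HB.pack f (GRing.isLinear.Build _ _ _ _ _ f_lin).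
pose alpha : functional eta t := linfun f'.
have aE T : T \in tc -> w *m adM GC T = pairing alpha T *: w.
  move=> Tt; have [a Ha] := Hw _ Tt.
  by rewrite /pairing lfunE /= /f vsprojK// Ha mxE mulfK.
have aZ : pairing alpha Z0 = 1.
  have := aE _ Z0_in_tC; rewrite wL => /rowP/(_ k); rewrite mxE -{1}[w 0 k]mul1r => /mulIf.
  by move=> /(_ wk).
exists alpha => //; split.
  apply/eqP => a0; move: aZ; rewrite a0 /pairing zero_lfunE => /esym/eqP.
  by rewrite oner_eq0.
by exists w => //; exact: root_spaceP.
Qed.

Lemma Delta_n_plus_value alpha : Delta_n_plus Z0 Delta_plus alpha ->
  Delta alpha /\ pairing alpha Z0 = 1.
Proof.
move=> [[aD H] aP]; split => //.
have := positive_value aP.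
case: H => // -> [] /eqP.
  by rewrite oppr_eq0 oner_eq0.
by rewrite eq_sym -addr_eq0 (_ : 1 + 1 = 2%:R)// pnatr_eq0.
Qed.

Lemma Omega_trace Z : Omega Z0 Delta_plus coroot Z ->
  Z \in tC eta t /\ exists2 r : R, 0 < r & \tr (adM GC Z0 *m adM GC Z) = r%:C%C.
Proof.
move=> [c c0 ->]; have fD := finite_Delta.
have fDn : finite_set (Delta_n_plus Z0 Delta_plus) by apply: sub_finite_set fD => a [[]].
have [alpha aD aZ] := positive_root_exists.
have aDn : Delta_n_plus Z0 Delta_plus alpha.
  split; first by split => //; left.
  by apply: Delta_plus_Z0 => //; rewrite aZ ltr01.
have term a : Delta_n_plus Z0 Delta_plus a -> (c a)%:C%C *: coroot a \in tC eta t /\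
    exists2 r : R, 0 < r & \tr (adM GC Z0 *m adM GC ((c a)%:C%C *: coroot a)) = r%:C%C.
  move=> an; have [aD' aZ'] := Delta_n_plus_value an; have cv := corootP aD'.
  have [q q0 qE] := killing_Z0_coroot cv aZ'.
  split; first by apply: memvZ; exact: (coroot_in_tC cv).
  exists (c a * q); first by rewrite mulr_gt0// c0.
  by rewrite linearZ /= -scalemxAr mxtraceZ qE rmorphM.
(* One term is split off to keep the sum strictly positive; the rest, possibly empty, is only
   nonnegative. *)
rewrite (fsbigD1 alpha)//=; have [At [r r0 rE]] := term _ aDn.
pose P (X : 'rV[C]_m) := X \in tC eta t /\
  exists2 r : R, 0 <= r & \tr (adM GC Z0 *m adM GC X) = r%:C%C.
have [||a [/term[H1 [q q0 qE]] _]|Bt [s s0 sE]] := @fsum_ind _ _ P (Delta_n_plus Z0 Delta_plus `\ alpha)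
   (fun a => (c a)%:C%C *: coroot a).
- by split; [exact: mem0v | exists 0 => //; rewrite linear0 mulmx0 raddf0].
- move=> x y [xt [p p0 pE]] [yt [q q0 qE]]; split; first exact: memvD.
  by exists (p + q); [exact: addr_ge0 | rewrite linearD mulmxDr raddfD /= pE qE rmorphD].
- by split => //; exists q => //; exact: ltW.
split; first exact: memvD.
exists (r + s); first by rewrite ltr_wpDr.
by rewrite linearD mulmxDr raddfD /= rE sE rmorphD.
Qed.

Lemma trace_proj X : \tr ((proj_neg (adM GC Z0) - proj_pos (adM GC Z0)) *m adM GC X) =
  - \tr (adM GC Z0 *m adM GC X).
Proof. by rewrite proj_negB mulNmx raddfN. Qed.

Lemma NC_bounded u : NC Delta_plus u -> bounded u 1 /\ bounded u^-1%g 1.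
Proof.
move=> [Y YN <-].
have [b1 b2 b3] := nC_blocks YN.
by apply: (block_bound_exp PmI PpI b1 b2); rewrite trace_proj b3 oppr0.
Qed.

Lemma A_plus_bounded a : A_plus Z0 Delta_plus coroot a ->
  exists2 r : R, r < 1 & bounded a r.
Proof.
move=> [Z ZO <-].
have [Zt [r r0 rE]] := Omega_trace ZO.
exists (expR (- r)); first by rewrite expR_lt1 oppr_lt0.
have [b1 b2] := tC_blocks Zt.
apply: (block_bound_exp_abelian PmI PpI _ b1 b2).
  exact: (tC_comm Zt Zt).
by rewrite trace_proj rE raddfN.
Qed.

Lemma bounded_not_real (b : GC) (r : R) (w : G) (h : GC) : r < 1 -> bounded b r ->
  HC tauC h -> eta w <> (b * h)%g.
Proof.
move=> r1 [b1 b2 b3] hC E.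
have [_ lower] := center_bound eta_hom eta_lie thetaP Z0P G_connected.
have [tM _ _] := tauC_hom; have [eM _ _] := eta_hom.
have zE : eta (w * (tau w)^-1)%g = (b * tauC b^-1)%g.
  rewrite eM (rc_homV eta_hom) -tauC_ext E tM [tauC h]hC (lie_homV tauC_hom).
  by rewrite invgM mulgA mulgK.
have := lower (w * (tau w)^-1)%g; rewrite zE admM.
(* [adm] reverses products, so [adm b] is the right factor, and its own vanishing block is the one
   required. *)
have -> := pdetM PmI (or_intror b1 : proj_neg (adM GC Z0) *m adm (tauC b^-1)%g *m
  (1%:M - proj_neg (adM GC Z0)) = 0 \/ _).
rewrite pdet_tauC.
move: b3; move: (pdet _ _) (pdet _ _) => x y xy.
rewrite rnM mulrC => le1.
by have := lt_le_trans r1 (le_trans le1 xy); rewrite ltxx.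
Qed.

Lemma horosphere_no_real (g0 : G) (a : GC) : A_plus Z0 Delta_plus coroot a ->
  horosphere Delta_plus tauC (act (eta g0 * a)%g (xi0 Delta_plus tauC))
    `&` X_real eta tauC = set0.
Proof.
move=> aA; apply/seteqP; split => // y [[g [u [E uN ->]]] [g1 _ E1]].
have [tM _ _] := tauC_hom; have [eM _ _] := eta_hom.
have one_MC : MC eta t tauC 1%g by split; [exact: lie_hom1 | move=> T _; exact: Ad1].
(* The representative g need not be the given one. As g u0 lies in the coset of g, g is the product
   of [eta g0 * a], an element of M_C, an element of N_C and the inverse of [u0]. *)
have [u0 u0N] : exists u0 : GC, NC Delta_plus u0.
  exists (lie_exp 0), 0 => //; exists (fun=> 0); last by rewrite fsbig1.
  by move=> alpha _ T; rewrite bracket_ad mul0mx scaler0.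
have : act (eta g0 * a)%g (xi0 Delta_plus tauC) (g * u0)%g.
  rewrite E; exists u0 => //; exists 1%g => //; exists u0 => //.
  by rewrite mul1g.
move=> [_ [mm mM [nn nN <-]] Eg].
have : act (g * u)%g (x0 tauC) (g * u)%g.
  by exists 1%g; [exact: lie_hom1 | rewrite mulg1].
rewrite -E1 => -[h hC Eh].
have [ra ra1 aB] := A_plus_bounded aA.
have mB := MC_block_bound mM.
have [nB _] := NC_bounded nN; have [_ u0B] := NC_bounded u0N; have [uB _] := NC_bounded uN.
have bB := block_bound_mul PmI PpI (block_bound_mul PmI PpI aB mB)
  (block_bound_mul PmI PpI (block_bound_mul PmI PpI nB u0B) uB).
rewrite !mulr1 in bB.
have hVC : HC tauC h^-1%g by rewrite /HC /= (lie_homV tauC_hom) [tauC h]hC.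
(* The common point is that of [g1], so g0^-1 g1 is sent to a m n u0^-1 u h^-1. *)
apply: (bounded_not_real (w := (g0^-1 * g1)%g) ra1 bB hVC).
rewrite eM (rc_homV eta_hom).
apply: (@mulgI _ (eta g0)); rewrite mulgA mulgV mul1g.
apply: (@mulIg _ h); rewrite Eh.
have gE : g = (eta g0 * a * (mm * nn) * u0^-1)%g by rewrite Eg mulgK.
by rewrite gE !mulgA -[(_ * h^-1 * h)%g]mulgA mulVg mulg1.
Qed.

End NoRealPoints.

Theorem corollary4p7 (R : realType) (n m : nat)
  (* G, contained in its simply connected universal complexification GC *)
  (G : lieGroupType R n) (GC : lieGroupType R[i] m) (eta : G -> GC)
  (G_connected : connected [set: G])
  (G_semisimple : semisimple G)
  (eta_universal : universal_complexification eta)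
  (eta_inj : injective eta)
  (eta_lie : lie_complexification eta)
  (GC_sc : simply_connected R GC)
  (* the non-trivial involution tau, and its holomorphic extension tauC *)
  (tau : G -> G) (tauC : GC -> GC)
  (tau_inv : involution tau)
  (tau_nontrivial : exists x, tau x <> x)
  (tauC_hom : lie_hom tauC)
  (tauC_ext : forall x, tauC (eta x) = eta (tau x))
  (irr : irreducible_pair tau)
  (* the Cartan involution theta *)
  (theta : G -> G)
  (theta_cartan : cartan_involution theta)
  (theta_tau : forall x, theta (tau x) = tau (theta x))
  (herm : hermitian_antiholomorphic theta tau)
  (* Z0, t, and the positive system *)
  (Z0 : 'rV[R[i]]_m) (Z0P : is_Z0 eta theta tau Z0)
  (t : {vspace 'rV[R]_n})
  (t_max : max_abelian_in G (minus_space tau) t)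
  (t_Z0 : exists2 X, X \in t & rc_dhom eta X = 'i%C *: Z0)
  (Delta_plus : set (functional eta t))
  (Delta_plusP : positive_system Delta_plus)
  (Delta_plus_Z0 : forall alpha, Delta alpha -> 0 < pairing alpha Z0 ->
     Delta_plus alpha)
  (coroot : functional eta t -> 'rV[R[i]]_m)
  (corootP : forall alpha, Delta alpha -> is_coroot alpha (coroot alpha)) :
  Xi_plus Z0 Delta_plus coroot tauC `<=` Xi_nr Delta_plus tauC.
Proof.
have [eta_hom _] := eta_universal.
move=> _ [g0 [a [aA ->]]]; split; first by exists (eta g0 * a)%g.
exact: (horosphere_no_real eta_hom eta_lie G_connected tau_inv tauC_hom tauC_ext
  theta_cartan Z0P t_max t_Z0 Delta_plusP Delta_plus_Z0 corootP).
Qed.
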